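(* Let $r\in \mathbb{N}$, $\alpha\in (0,1)$, $\mu\in \mathbb{R}_{>0}$, and let $\mathcal{G}$ be a hereditary graph class such that every $G\in \mathcal{G}$ with $n$ vertices and clique number $\omega$ has $O_r(\omega^\mu n)$ cliques of order less than $r$ and treewidth $O_r(\omega^\mu n^\alpha)$. Then there exist $\varepsilon < 1$ and an algorithm that solves $K_r$-Cover on graphs of $\mathcal{G}$ in time $2^{k^\varepsilon} \cdot n^{O_r(1)}$.
   Context: In the $K_r$-Cover problem, given a graph $G$ and an integer $k$, one has to decide whether there is a set of at most $k$ vertices of $G$ whose deletion yields a graph with no clique on $r$ vertices. A graph class is hereditary if it is closed under taking induced subgraphs. The clique number of $G$ is the maximum number of vertices of a clique in $G$. In running times, $n$ is the number of vertices of the input graph, and $O_r(\cdot)$ hides constants depending on $r$. *)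

(* Defs.v *)
From HB Require Import structures.
From mathcomp Require Import all_boot all_order all_algebra.
From mathcomp Require Import boolp reals exp.
Set Implicit Arguments.
Unset Strict Implicit.
Unset Printing Implicit Defensive.
Import Order.TTheory GRing.Theory Num.Theory.
Local Open Scope ring_scope.

(** * Graphs *)

Record sgraph := SGraph {
  nverts : nat;
  adj : rel 'I_nverts;
  adj_sym : symmetric adj;
  adj_irrefl : irreflexive adj }.

Definition is_clique (G : sgraph) (A : {set 'I_(nverts G)}) : bool :=
  [forall x in A, forall y in A, (x != y) ==> adj x y].

Definition clique_number (G : sgraph) : nat :=
  (\max_(A : {set 'I_(nverts G)} | is_clique A) #|A|)%N.

(* The empty set is not counted.  If it were, the bound
   [C * omega ^ mu * n] would fail on the graph without vertices, which lies
   in every nonempty hereditary class; on graphs with [n > 0] the choice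
   only affects the constant. *)
Definition nb_cliques_lt (r : nat) (G : sgraph) : nat :=
  #|[set A : {set 'I_(nverts G)} | is_clique A && (0 < #|A| < r)%N]|.

(* A class lives on the vertex sets 'I_n, so an induced subgraph is given by
   an embedding; the case of a bijective [f] gives closure under
   isomorphism. *)
Definition induced_subgraph (H G : sgraph) : Prop :=
  exists f : 'I_(nverts H) -> 'I_(nverts G),
    injective f /\ forall x y, adj x y = adj (f x) (f y).

Definition hereditary (P : sgraph -> Prop) : Prop :=
  forall G H, P G -> induced_subgraph H G -> P H.

(** * Treewidth *)

Definition is_tree (T : finType) (e : rel T) : Prop :=
  [/\ symmetric e, irreflexive e, (0 < #|T|)%N,
      forall s t : T, connect e s t
    & forall p : seq T, ucycle e p -> (size p < 3)%N].

Definition is_tree_decomposition (G : sgraph) (T : finType) (e : rel T)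
    (B : T -> {set 'I_(nverts G)}) : Prop :=
  [/\ is_tree e,
      forall v, exists t, v \in B t,
      forall u v, adj u v -> exists t, (u \in B t) && (v \in B t)
    & forall v s t, v \in B s -> v \in B t ->
        connect [rel a b | [&& e a b, v \in B a & v \in B b]] s t].

(* Truncated predecessor: the graph without vertices gets width 0, not -1. *)
Definition width (V T : finType) (B : T -> {set V}) : nat :=
  (\max_(t : T) #|B t|).-1.

Definition has_width_le (G : sgraph) (w : nat) : Prop :=
  exists (T : finType) (e : rel T) (B : T -> {set 'I_(nverts G)}),
    is_tree_decomposition e B /\ (width B <= w)%N.

Lemma has_width_le_ex (G : sgraph) : exists w, `[< has_width_le G w >].
Proof.
exists (width (fun _ : unit => [set: 'I_(nverts G)])); apply/asboolP.
exists unit, (fun _ _ => false), (fun _ => setT); split=> //.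
split.
- split=> //.
  + by rewrite card_unit.
  + by move=> [] [].
  + by case=> [|x [|y p]] //= /andP[].
- by move=> v; exists tt; rewrite inE.
- by move=> u v _; exists tt; rewrite !inE.
- by move=> v [] [] _ _; apply: connect0.
Qed.

Definition treewidth (G : sgraph) : nat := ex_minn (has_width_le_ex G).

(** * The K_r-Cover problem *)

Definition Kr_cover (r : nat) (G : sgraph) (k : nat) : bool :=
  [exists S : {set 'I_(nverts G)}, (#|S| <= k)%N &&
     ~~ [exists A : {set 'I_(nverts G)},
           [&& is_clique A, #|A| == r & [disjoint A & S]]]].

(** * Random access machines *)

(* Structured programs of a random access machine with unbounded natural
   numbers in its cells, uniform cost, and addition and truncated subtraction
   as the only arithmetic.  There is no multiplication or shift, so a cell
   grows by at most one bit per step and the uniform cost is polynomially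
   related to the time of a Turing machine. *)
Inductive prog :=
| Skip
| Const (d c : nat)           (* reg[d] := c *)
| Add   (d a b : nat)         (* reg[d] := reg[a] + reg[b] *)
| Sub   (d a b : nat)         (* reg[d] := reg[a] - reg[b] *)
| Read  (d a : nat)           (* reg[d] := mem[reg[a]] *)
| Write (a s : nat)           (* mem[reg[a]] := reg[s] *)
| Seq   (p q : prog)
| If    (a : nat) (p q : prog)  (* if reg[a] <> 0 then p else q *)
| While (a : nat) (p : prog).   (* while reg[a] <> 0 do p *)

Record state := State { reg : nat -> nat; mem : nat -> nat }.

Definition upd (f : nat -> nat) (a v : nat) : nat -> nat :=
  fun b => if b == a then v else f b.

Definition set_reg (s : state) (d v : nat) : state :=
  State (upd (reg s) d v) (mem s).

Definition set_mem (s : state) (a v : nat) : state :=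
  State (reg s) (upd (mem s) a v).

(* [exec p s s' t]: started in [s], the program [p] halts in [s'] after
   exactly [t] steps, every instruction and every test being one step. *)
Inductive exec : prog -> state -> state -> nat -> Prop :=
| exec_Skip s : exec Skip s s 1
| exec_Const s d c : exec (Const d c) s (set_reg s d c) 1
| exec_Add s d a b : exec (Add d a b) s (set_reg s d (reg s a + reg s b)%N) 1
| exec_Sub s d a b : exec (Sub d a b) s (set_reg s d (reg s a - reg s b)%N) 1
| exec_Read s d a : exec (Read d a) s (set_reg s d (mem s (reg s a))) 1
| exec_Write s a b : exec (Write a b) s (set_mem s (reg s a) (reg s b)) 1
| exec_Seq p q s s1 s2 t1 t2 :
    exec p s s1 t1 -> exec q s1 s2 t2 -> exec (Seq p q) s s2 (t1 + t2)%N
| exec_IfT a p q s s' t :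
    reg s a != 0%N -> exec p s s' t -> exec (If a p q) s s' t.+1
| exec_IfF a p q s s' t :
    reg s a = 0%N -> exec q s s' t -> exec (If a p q) s s' t.+1
| exec_WhileF a p s : reg s a = 0%N -> exec (While a p) s s 1
| exec_WhileT a p s s1 s2 t1 t2 :
    reg s a != 0%N -> exec p s s1 t1 -> exec (While a p) s1 s2 t2 ->
    exec (While a p) s s2 (t1 + t2).+1.

(* reg[0] = n, reg[1] = k, and mem[0 .. n^2 - 1] is the adjacency matrix of G
   in row-major order; all other cells are 0. *)
Definition input (G : sgraph) (k : nat) : state :=
  State (fun i => if i == 0%N then nverts G else if i == 1%N then k else 0%N)
        (fun a => [exists x : 'I_(nverts G), exists y : 'I_(nverts G),
                     (a == x * nverts G + y)%N && adj x y] : nat).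

(* The answer is read off reg[0]: 0 for no, anything else for yes.  Nothing
   is required of the program outside the class [P]. *)
Definition solves_Kr_cover_within (R : realType) (p : prog) (r : nat)
    (P : sgraph -> Prop) (T : sgraph -> nat -> R) : Prop :=
  forall (G : sgraph) (k : nat), P G ->
    exists (s : state) (t : nat),
      [/\ exec p (input G k) s t,
          (reg s 0 != 0%N) = Kr_cover r G k
        & t%:R <= T G k].

(* Main.v *)
Require Import Defs.
From HB Require Import structures.
From mathcomp Require Import all_boot all_order all_algebra.
From mathcomp Require Import boolp reals exp.
From mathcomp Require Import zify lra.
Set Implicit Arguments.
Unset Strict Implicit.
Unset Printing Implicit Defensive.
Import Order.TTheory GRing.Theory Num.Theory.
Local Open Scope nat_scope.

(* Let t be about k^(1/q) for a large q.  Take a maximal packing M of disjoint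
   r-cliques; a solution leaves fewer than r vertices of each clique of order
   t^2 + r in M, so guessing these survivors (few in total) deletes all large
   cliques and bounds the clique number by O(t^2).

   Now M is grown in r rounds.  For every clique C in M of order less than r,
   consider a maximal packing of disjoint sets outside M extending C to an
   r-clique.  If it is small, it joins M.  If it is large, guess whether the
   solution meets C: if so, C becomes a set to be hit; if not, every member of
   the packing is hit by a separate vertex, so this happens at most k/t^2 times,
   and the packing joins M.  As M has few small cliques, it stays of size
   k t^O(1), and after r rounds every r-clique lies in M or contains a set to be
   hit.

   Cutting a tree decomposition of G[M] at lowest heavy nodes yields a sublinear
   set Z whose removal leaves components of sublinear size.  Guess Z and its
   part in the solution; the components are then solved separately by brute
   force.  Every guess is a subset of M of size O(t^(q-2)), so there are only
   2^O(t^(q-1)) of them.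

   The machine performs this search on numbers: sets of vertices are bit masks,
   and guesses are decoded from loop counters by naive arithmetic, which costs
   only a power of the number of guesses. *)

(** * Terms with bounded loops and their compilation *)

(** Soundness holds for arbitrary thresholds and guesses: an accepting run always yields a cover.
    The class enters only in the completeness direction, for sets whose cliques have order at most
    [t ^ 2 + 2 * r].

    The obstacle is that a guess is fixed before a phase starts, while the packings met in the phase
    depend on it. The way out is to follow the ideal run, which knows the complement of the solution
    [S], and to collect a set [R] that determines all its decisions. Each contribution to [R] has
    fewer than [r] vertices and is paid for by at least [t ^ 2] new vertices of [S], so
    [t ^ 2 * #|R| <= r * k].

    Up to constants the kernel has order [t ^ (q + exp1 * r)] and treewidth [t ^ (2 * m + a)], with
    [a] about [alpha * (q + exp1 * r)]. For components of order [t ^ (q - 2)] the separator fits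
    into a guess as soon as [2 * m + a + exp1 * r + 4 <= q], and [alpha < 1] makes this possible for
    large [q].

    The time is a fixed power of the largest parameter. That power is the nesting depth of the
    loops, which depends on [r] alone; hence so does the exponent of [n]. *)

(* First-order terms over numbers.  Variables are de Bruijn levels: [Let] adds
   one variable at the end of the environment, [Sum] the index, [Loop] the index
   and the accumulator, and [App] evaluates a closed body in the environment of
   its arguments.  The bounds of [Sum] and [Loop] are parameters, never computed
   values, so the cost of a term does not depend on its environment. *)
Inductive tm :=
| Par (j : nat)
| Var (l : nat)
| Lit (c : nat)
| Plus (a b : tm)
| Minus (a b : tm)
| Rd (a : tm)
| Ite (a b c : tm)
| Let (a b : tm)
| Sum (j : nat) (a : tm)
| Loop (j : nat) (a b : tm)
| App (f : tm) (args : seq tm).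

Section TmInd.
Variable Q : tm -> Prop.
Hypothesis HPar : forall j, Q (Par j).
Hypothesis HVar : forall l, Q (Var l).
Hypothesis HLit : forall c, Q (Lit c).
Hypothesis HPlus : forall a b, Q a -> Q b -> Q (Plus a b).
Hypothesis HMinus : forall a b, Q a -> Q b -> Q (Minus a b).
Hypothesis HRd : forall a, Q a -> Q (Rd a).
Hypothesis HIte : forall a b c, Q a -> Q b -> Q c -> Q (Ite a b c).
Hypothesis HLet : forall a b, Q a -> Q b -> Q (Let a b).
Hypothesis HSum : forall j a, Q a -> Q (Sum j a).
Hypothesis HLoop : forall j a b, Q a -> Q b -> Q (Loop j a b).
Hypothesis HApp : forall f args, Q f ->
  foldr (fun a P => Q a /\ P) True args -> Q (App f args).

Fixpoint tm_nested_ind (t : tm) : Q t :=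
  match t with
  | Par j => HPar j
  | Var l => HVar l
  | Lit c => HLit c
  | Plus a b => HPlus (tm_nested_ind a) (tm_nested_ind b)
  | Minus a b => HMinus (tm_nested_ind a) (tm_nested_ind b)
  | Rd a => HRd (tm_nested_ind a)
  | Ite a b c => HIte (tm_nested_ind a) (tm_nested_ind b) (tm_nested_ind c)
  | Let a b => HLet (tm_nested_ind a) (tm_nested_ind b)
  | Sum j a => HSum j (tm_nested_ind a)
  | Loop j a b => HLoop j (tm_nested_ind a) (tm_nested_ind b)
  | App f args => HApp (tm_nested_ind f)
      ((fix go (l : seq tm) : foldr (fun a P => Q a /\ P) True l :=
          match l with
          | [::] => I
          | a :: l' => conj (tm_nested_ind a) (go l')
          end) args)
  end.
End TmInd.

Fixpoint eval (mm : nat -> nat) (pl : seq nat) (t : tm) (e : seq nat) : nat :=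
  match t with
  | Par j => nth 0 pl j
  | Var l => nth 0 e l
  | Lit c => c
  | Plus a b => eval mm pl a e + eval mm pl b e
  | Minus a b => eval mm pl a e - eval mm pl b e
  | Rd a => mm (eval mm pl a e)
  | Ite a b c => if eval mm pl a e != 0 then eval mm pl b e else eval mm pl c e
  | Let a b => eval mm pl b (rcons e (eval mm pl a e))
  | Sum j a => \sum_(i < nth 0 pl j) eval mm pl a (rcons e i)
  | Loop j a b =>
      iteri (nth 0 pl j) (fun i acc => eval mm pl b (rcons (rcons e i) acc))
        (eval mm pl a e)
  | App f args => eval mm pl f [seq eval mm pl a e | a <- args]
  end.

(** [Ite] is charged for both branches, which keeps the bound a function of the parameters alone. *)
Fixpoint cost (pl : seq nat) (t : tm) : nat :=
  match t with
  | Par _ | Var _ | Lit _ => 3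
  | Plus a b | Minus a b => cost pl a + cost pl b + 1
  | Rd a => cost pl a + 1
  | Ite a b c => cost pl a + cost pl b + cost pl c + 1
  | Let a b => cost pl a + cost pl b + 3
  | Sum j a => nth 0 pl j * (cost pl a + 8) + 7
  | Loop j a b => cost pl a + nth 0 pl j * (cost pl b + 9) + 7
  | App f args => sumn [seq cost pl a | a <- args] + cost pl f + 4
  end.

(** The machine has no move instruction. The target is cleared first, so this copies only if [d]
    differs from [a]. *)
Definition copy (d a : nat) : prog := Seq (Const d 0) (Add d d a).

Definition load_par (np d j : nat) : prog :=
  if j < np then copy d j else Const d 0.

(* Maintains the number of iterations left in register [h.+2]. *)
Definition tick (np h j : nat) : prog :=
  Seq (Seq (Const h.+3 1) (Add h.+1 h.+1 h.+3))
      (Seq (load_par np h.+2 j) (Defs.Sub h.+2 h.+2 h.+1)).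

(* [np] parameters sit in the registers below [np]; [rho] lists the registers
   of the local variables; the value goes to register [h], and no register
   below [h] is written. *)
Fixpoint compile (np : nat) (t : tm) (rho : seq nat) (h : nat) : prog :=
  match t with
  | Par j => load_par np h j
  | Var l => if l < size rho then copy h (nth 0 rho l) else Const h 0
  | Lit c => Const h c
  | Plus a b =>
      Seq (compile np a rho h) (Seq (compile np b rho h.+1) (Add h h h.+1))
  | Minus a b =>
      Seq (compile np a rho h) (Seq (compile np b rho h.+1) (Defs.Sub h h h.+1))
  | Rd a => Seq (compile np a rho h) (Read h h)
  | Ite a b c =>
      Seq (compile np a rho h) (If h (compile np b rho h) (compile np c rho h))
  | Let a b =>
      Seq (compile np a rho h)
        (Seq (compile np b (rcons rho h) h.+1) (copy h h.+1))
  | Sum j a =>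
      Seq (Const h 0) (Seq (Const h.+1 0) (Seq (load_par np h.+2 j)
        (While h.+2
          (Seq (Seq (compile np a (rcons rho h.+1) h.+3) (Add h h h.+3))
            (tick np h j)))))
  | Loop j a b =>
      Seq (compile np a rho h) (Seq (Const h.+1 0) (Seq (load_par np h.+2 j)
        (While h.+2
          (Seq (Seq (compile np b (rcons (rcons rho h.+1) h) h.+3)
                    (copy h h.+3))
            (tick np h j)))))
  | App f args =>
      Seq ((fix go (l : seq tm) (i : nat) : prog :=
              match l with
              | [::] => Skip
              | a :: l' => Seq (compile np a rho i) (go l' i.+1)
              end) args h.+1)
        (Seq (compile np f (iota h.+1 (size args)) (h.+1 + size args))
             (copy h (h.+1 + size args)))
  end.

Fixpoint compile_args (np : nat) (rho : seq nat) (l : seq tm) (i : nat) : prog :=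
  match l with
  | [::] => Skip
  | a :: l' => Seq (compile np a rho i) (compile_args np rho l' i.+1)
  end.

(** The inner fixpoint in [compile] is there for the guard condition; [compile_args] is its named
    version, on which induction is possible. *)
Lemma compile_App np f args rho h :
  compile np (App f args) rho h =
  Seq (compile_args np rho args h.+1)
    (Seq (compile np f (iota h.+1 (size args)) (h.+1 + size args))
         (copy h (h.+1 + size args))).
Proof.
rewrite /=; congr Seq; elim: args h.+1 => //= a l IH i; congr Seq; exact: IH.
Qed.

Lemma updE f a v b : upd f a v b = if b == a then v else f b.
Proof. by []. Qed.

Section CompileCorrect.
Local Notation mem := Defs.mem.
Variables (mm : nat -> nat) (pl : seq nat).
Let np := size pl.

(** Everything above [h] is scratch space. This is why a subterm is compiled at [h.+1] or [h.+3]
    once [h] holds a value. *)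
Definition runs (p : prog) (h : nat) (s : state) (v c : nat) : Prop :=
  exists s' t, [/\ exec p s s' t, reg s' h = v,
    (forall x, x < h -> reg s' x = reg s x), mem s' = mem s & t <= c].

Definition pars_ok (s : state) : Prop :=
  mem s = mm /\ forall j, j < np -> reg s j = nth 0 pl j.

Definition env_ok (rho : seq nat) (h : nat) (s : state) (e : seq nat) : Prop :=
  [/\ np <= h, size rho = size e, all (fun x => x < h) rho
    & forall l, l < size rho -> reg s (nth 0 rho l) = nth 0 e l].

Lemma env_okP rho h s s' h' e : env_ok rho h s e -> h <= h' ->
  (forall x, x < h -> reg s' x = reg s x) -> env_ok rho h' s' e.
Proof.
move=> [H1 H2 H3 H4] hh E; split=> //; first exact: leq_trans H1 hh.
- by apply: sub_all H3 => x xh; apply: leq_trans xh hh.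
- move=> l ll; rewrite E ?H4 //; exact: (allP H3 _ (mem_nth 0 ll)).
Qed.

Lemma env_ok_rcons rho h s e x v h' : env_ok rho h s e -> h <= h' -> x < h' ->
  reg s x = v -> env_ok (rcons rho x) h' s (rcons e v).
Proof.
move=> H hh xh E; have [H1 H2 H3 H4] := env_okP H hh (fun _ _ => erefl).
split=> //; first by rewrite !size_rcons H2.
- by rewrite all_rcons xh.
- move=> l; rewrite size_rcons ltnS leq_eqVlt !nth_rcons H2.
  by case/orP=> [/eqP->|ll]; rewrite ?ltnn ?eqxx // ll H4 ?H2.
Qed.

Lemma pars_okP h s s' : np <= h -> pars_ok s ->
  (forall x, x < h -> reg s' x = reg s x) -> mem s' = mem s -> pars_ok s'.
Proof.
move=> hh [P1 P2] E1 E2; split; first by rewrite E2.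
by move=> j jn; rewrite E1 ?P2 //; apply: leq_trans jn hh.
Qed.

Lemma exec_copy d a s : d != a ->
  exec (copy d a) s (set_reg (set_reg s d 0) d (reg s a)) 2.
Proof.
move=> da; have := exec_Seq (exec_Const s d 0) (exec_Add _ d d a).
by rewrite /= /upd eqxx eq_sym (negbTE da) /=.
Qed.

Lemma runs_load_par d j s : np <= d -> pars_ok s ->
  runs (load_par np d j) d s (nth 0 pl j) 2.
Proof.
move=> nd [_ Ps]; rewrite /load_par; case: ltnP => jn.
- have dj : d != j by apply/eqP => E; move: (leq_trans jn nd); rewrite E ltnn.
  exists (set_reg (set_reg s d 0) d (reg s j)), 2; split=> //; first exact: exec_copy.
  + by rewrite /= updE eqxx Ps.
  + by move=> x xd; rewrite /= !updE ltn_eqF.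
- exists (set_reg s d 0), 1; split=> //; first exact: exec_Const.
  + by rewrite /= updE eqxx nth_default.
  + by move=> x xd; rewrite /= updE ltn_eqF.
Qed.

Lemma exec_tick s h j : np <= h -> pars_ok s -> exists s' t,
  [/\ exec (tick np h j) s s' t, reg s' h.+1 = (reg s h.+1).+1,
      reg s' h.+2 = nth 0 pl j - (reg s h.+1).+1,
      forall x, x <= h -> reg s' x = reg s x
    & mem s' = mem s /\ t <= 5].
Proof.
move=> nh Ps.
set s1 := set_reg s h.+3 1.
set s2 := set_reg s1 h.+1 (reg s1 h.+1 + reg s1 h.+3).
have H12 x : x <= h -> reg s2 x = reg s x.
  by move=> xh; rewrite /= !updE !ltn_eqF //; lia.
have Ps2 : pars_ok s2.
  by apply: (@pars_okP h.+1 s) => //; rewrite // ltnW.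
have [s3 [t3 [E3 R3 F3 M3 L3]]] := @runs_load_par h.+2 j s2 (leqW (leqW nh)) Ps2.
exists (set_reg s3 h.+2 (reg s3 h.+2 - reg s3 h.+1)), (1 + 1 + (t3 + 1)).
have i3 : reg s3 h.+1 = (reg s h.+1).+1.
  rewrite F3 // /= !updE !eqxx ltn_eqF // ?addn1 //; lia.
split.
- apply: exec_Seq; last exact: exec_Seq E3 (exec_Sub _ _ _ _).
  exact: exec_Seq (exec_Const _ _ _) (exec_Add _ _ _ _).
- by rewrite /= updE ltn_eqF // i3.
- by rewrite /= updE eqxx R3 i3.
- move=> x xh; rewrite /= updE ltn_eqF ?F3 ?H12 //; lia.
- split; [by rewrite /= M3 | lia].
Qed.

(** [F i] is the content of register [h] before iteration [i]; [Sum] and [Loop] differ only in [F]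
    and in the body. The 6 consists of five steps of [tick] and one test. *)
Lemma exec_loop (body : prog) h j (F : nat -> nat) (c : nat) s0 :
  np <= h -> pars_ok s0 ->
  (forall i s, i < nth 0 pl j -> pars_ok s -> (forall x, x < h -> reg s x = reg s0 x) ->
     reg s h = F i -> reg s h.+1 = i ->
     exists s' t, [/\ exec body s s' t, reg s' h = F i.+1, reg s' h.+1 = i,
       (forall x, x < h -> reg s' x = reg s x) & mem s' = mem s /\ t <= c]) ->
  reg s0 h = F 0 -> reg s0 h.+1 = 0 -> reg s0 h.+2 = nth 0 pl j ->
  runs (While h.+2 (Seq body (tick np h j))) h s0 (F (nth 0 pl j))
    (nth 0 pl j * (c + 6) + 1).
Proof.
move=> nh P0 Hb E0 E1 E2; set n := nth 0 pl j in Hb E2 *.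
suff H d : forall i s, i + d = n -> pars_ok s ->
    (forall x, x < h -> reg s x = reg s0 x) -> mem s = mem s0 ->
    reg s h = F i -> reg s h.+1 = i -> reg s h.+2 = n - i ->
    exists s' t, [/\ exec (While h.+2 (Seq body (tick np h j))) s s' t,
      reg s' h = F n, (forall x, x < h -> reg s' x = reg s0 x),
      mem s' = mem s0 & t <= d * (c + 6) + 1].
  by apply: (H n 0 s0) => //; rewrite subn0.
elim: d => [|d IH] i s Ei Ps Fs Ms H0 H1 H2.
  rewrite addn0 in Ei; exists s, 1; split=> //; last by rewrite -Ei.
  by apply: exec_WhileF; rewrite H2 Ei subnn.
have iltn : i < n by lia.
have [s1 [t1 [X1 A1 B1 C1 [D1 L1]]]] := Hb i s iltn Ps Fs H0 H1.
have Ps1 : pars_ok s1 by apply: (@pars_okP h s).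
have [s2 [t2 [X2 A2 B2 C2 [D2 L2]]]] := exec_tick j nh Ps1.
have [||||||| s' [t' [X R Fr Mr Lr]]] := IH i.+1 s2.
- by lia.
- by apply: (@pars_okP h s1) => // x xh; rewrite C2 // ltnW.
- by move=> x xh; rewrite C2 ?C1 ?Fs // ltnW.
- by rewrite D2 D1.
- by rewrite C2.
- by rewrite A2 B1.
- by rewrite B2 B1.
exists s', (t1 + t2 + t').+1; split=> //; last by rewrite mulSn; lia.
apply: exec_WhileT X; last exact: exec_Seq X1 X2.
by rewrite H2 subn_eq0 -ltnNge.
Qed.

Lemma runs_seq p q h s v1 c1 v c : runs p h s v1 c1 ->
  (forall s', reg s' h = v1 -> (forall x, x < h -> reg s' x = reg s x) ->
     mem s' = mem s -> runs q h s' v c) ->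
  runs (Seq p q) h s v (c1 + c).
Proof.
move=> [s1 [t1 [X1 R1 F1 M1 L1]]] /(_ s1 R1 F1 M1) [s2 [t2 [X2 R2 F2 M2 L2]]].
exists s2, (t1 + t2); split=> //; first exact: exec_Seq X1 X2.
- by move=> x xh; rewrite F2 ?F1.
- by rewrite M2.
- exact: leq_add.
Qed.

Lemma runs_leq p h s v c c' : runs p h s v c -> c <= c' -> runs p h s v c'.
Proof.
move=> [s1 [t1 [X1 R1 F1 M1 L1]]] cc; exists s1, t1; split=> //.
exact: leq_trans cc.
Qed.

Definition compile_ok (t : tm) : Prop :=
  forall rho h s e, pars_ok s -> env_ok rho h s e ->
    runs (compile np t rho h) h s (eval mm pl t e) (cost pl t).

Lemma runs_args args rho h : foldr (fun a P => compile_ok a /\ P) True args ->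
  forall i s e, h <= i -> pars_ok s -> env_ok rho h s e ->
  exists s' t, [/\ exec (compile_args np rho args i) s s' t,
    (forall l, l < size args ->
       reg s' (i + l) = eval mm pl (nth (Lit 0) args l) e),
    (forall x, x < i -> reg s' x = reg s x), mem s' = mem s
    & t <= sumn [seq cost pl a | a <- args] + 1].
Proof.
elim: args => [_ i s e hi Ps Es|a l IH [Ha Hl] i s e hi Ps Es] /=.
  by exists s, 1; split=> //; exact: exec_Skip.
have nh : np <= h by case: Es.
have Ei : env_ok rho i s e by apply: (env_okP Es).
have [s1 [t1 [X1 R1 F1 M1 L1]]] := Ha rho i s e Ps Ei.
have Ps1 : pars_ok s1 by apply: (@pars_okP i s) => //; apply: leq_trans hi.
have Es1 : env_ok rho h s1 e.
  by apply: (env_okP Es) => // x xh; rewrite F1 //; apply: leq_trans hi.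
have [s2 [t2 [X2 R2 F2 M2 L2]]] := IH Hl i.+1 s1 e (leqW hi) Ps1 Es1.
exists s2, (t1 + t2); split; first exact: exec_Seq X1 X2.
- case=> [|l'] ll /=; first by rewrite addn0 F2 ?R1.
  by rewrite addnS -addSn R2.
- by move=> x xi; rewrite F2 ?F1 // ltnW.
- by rewrite M2.
- by lia.
Qed.

Lemma exec_copy_frame h d s : h < d -> exists s' t,
  [/\ exec (copy h d) s s' t, reg s' h = reg s d,
      forall x, x != h -> reg s' x = reg s x, mem s' = mem s & t <= 2].
Proof.
move=> hd; exists (set_reg (set_reg s h 0) h (reg s d)), 2; split=> //.
- by apply: exec_copy; rewrite ltn_eqF.
- by rewrite /= updE eqxx.
- by move=> x xh; rewrite /= !updE (negbTE xh).
Qed.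

Lemma runs_copy h d s : h < d -> runs (copy h d) h s (reg s d) 2.
Proof.
move=> hd; have [s' [t [X R F M L]]] := exec_copy_frame s hd.
by exists s', t; split=> // x xh; rewrite F // ltn_eqF.
Qed.

Lemma runs_1 p h s s' v : exec p s s' 1 -> reg s' h = v ->
  (forall x, x < h -> reg s' x = reg s x) -> mem s' = mem s -> runs p h s v 1.
Proof. by move=> X E F M; exists s', 1. Qed.

(** In contrast to [runs_seq], the first program delivers its value in [h.+1], so the value already
    stored in [h] survives for the second. *)
Lemma runs_above p q h s v w c c' :
  runs q h.+1 s w c ->
  (forall s', reg s' h.+1 = w -> (forall x, x <= h -> reg s' x = reg s x) ->
     mem s' = mem s -> runs p h s' v c') ->
  runs (Seq q p) h s v (c + c').
Proof.
move=> [s1 [t1 [X1 R1 F1 M1 L1]]] /(_ s1 R1 F1 M1) [s2 [t2 [X2 R2 F2 M2 L2]]].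
exists s2, (t1 + t2); split=> //; first exact: exec_Seq X1 X2.
- by move=> x xh; rewrite F2 ?F1 // ltnW.
- by rewrite M2.
- exact: leq_add.
Qed.

Lemma compile_correct t : compile_ok t.
Proof.
elim/tm_nested_ind: t.
- move=> j rho h s e Ps Es; apply: runs_leq (runs_load_par _ _ Ps) _ => //.
  by case: Es.
- move=> l rho h s e Ps [nh sE rh rE] /=; case: ltnP => ll.
    have lh := allP rh _ (mem_nth 0 ll).
    rewrite -rE //; exists (set_reg (set_reg s h 0) h (reg s (nth 0 rho l))), 2.
    split=> //; first by apply: exec_copy; rewrite neq_ltn lh orbT.
    + by rewrite /= updE eqxx.
    + by move=> x xh; rewrite /= !updE ltn_eqF.
  apply: (runs_leq (c := 1)) => //; apply: runs_1 (exec_Const _ _ _) _ _ _ => //=.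
  + by rewrite updE eqxx nth_default // -sE.
  + by move=> x xh; rewrite /= updE ltn_eqF.
- move=> c rho h s e Ps Es /=; apply: (runs_leq (c := 1)) => //.
  apply: runs_1 (exec_Const _ _ _) _ _ _ => //=; first by rewrite updE eqxx.
  by move=> x xh; rewrite /= updE ltn_eqF.
- move=> a b Ha Hb rho h s e Ps Es /=; rewrite -addnA.
  have nh : np <= h by case: Es.
  apply: runs_seq (Ha _ _ _ _ Ps Es) _ => s1 R1 F1 M1.
  apply: (runs_above (w := eval mm pl b e)).
    apply: Hb; first exact: pars_okP F1 M1.
    exact: env_okP Es _ F1.
  move=> s2 R2 F2 M2; apply: runs_1 (exec_Add _ _ _ _) _ _ _ => //=.
    by rewrite updE eqxx R2 F2 // R1.
  by move=> x xh; rewrite /= updE ltn_eqF.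
- move=> a b Ha Hb rho h s e Ps Es /=; rewrite -addnA.
  have nh : np <= h by case: Es.
  apply: runs_seq (Ha _ _ _ _ Ps Es) _ => s1 R1 F1 M1.
  apply: (runs_above (w := eval mm pl b e)).
    apply: Hb; first exact: pars_okP F1 M1.
    exact: env_okP Es _ F1.
  move=> s2 R2 F2 M2; apply: runs_1 (exec_Sub _ _ _ _) _ _ _ => //=.
    by rewrite updE eqxx R2 F2 // R1.
  by move=> x xh; rewrite /= updE ltn_eqF.
- move=> a Ha rho h s e Ps Es /=.
  apply: runs_seq (Ha _ _ _ _ Ps Es) _ => s1 R1 F1 M1.
  apply: runs_1 (exec_Read _ _ _) _ _ _ => //=.
    by rewrite updE eqxx R1 M1; case: Ps => ->.
  by move=> x xh; rewrite /= updE ltn_eqF.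
- move=> a b c Ha Hb Hc rho h s e Ps Es /=.
  have nh : np <= h by case: Es.
  apply: (runs_leq (c := cost pl a + (cost pl b + cost pl c + 1))); last by lia.
  apply: runs_seq (Ha _ _ _ _ Ps Es) _ => s1 R1 F1 M1.
  have Ps1 : pars_ok s1 by exact: pars_okP F1 M1.
  have Es1 : env_ok rho h s1 e by exact: env_okP Es _ F1.
  case: ifPn => [nz|/negPn/eqP z].
    have [s2 [t2 [X2 R2 F2 M2 L2]]] := Hb rho h s1 e Ps1 Es1.
    by exists s2, t2.+1; split=> //; [apply: exec_IfT; rewrite ?R1 | lia].
  have [s2 [t2 [X2 R2 F2 M2 L2]]] := Hc rho h s1 e Ps1 Es1.
  by exists s2, t2.+1; split=> //; [apply: exec_IfF; rewrite ?R1 | lia].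
- move=> a b Ha Hb rho h s e Ps Es /=; rewrite -addnA.
  have nh : np <= h by case: Es.
  apply: runs_seq (Ha _ _ _ _ Ps Es) _ => s1 R1 F1 M1.
  apply: (runs_above (w := eval mm pl b (rcons e (eval mm pl a e)))).
    apply: Hb; first exact: pars_okP F1 M1.
    exact: env_ok_rcons (env_okP Es (leqnn h) F1) _ _ R1.
  move=> s2 R2 F2 M2; apply: (runs_leq (c := 2)) => //.
  by rewrite -R2; exact: runs_copy.
- move=> j a Ha rho h s e Ps Es /=.
  have nh : np <= h by case: Es.
  pose F i := \sum_(l < i) eval mm pl a (rcons e l).
  rewrite -/(F _).
  apply: (runs_leq (c := 1 + (1 + (2 + (nth 0 pl j * (cost pl a + 2 + 6) + 1))))); last by lia.
  pose s1 := set_reg s h 0; pose s2 := set_reg s1 h.+1 0.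
  have F1 x : x < h -> reg s1 x = reg s x by move=> xh; rewrite /= updE ltn_eqF.
  apply: runs_seq.
    by apply: (runs_1 (s' := s1) (exec_Const _ _ _)) => //=; rewrite updE eqxx.
  move=> s3 R3 F3 M3; apply: runs_above.
    apply: (runs_1 (v := 0) (s' := set_reg s3 h.+1 0) (exec_Const _ _ _)) => //.
      by rewrite /= /upd eqxx.
    by move=> x xh; rewrite /= updE ltn_eqF.
  move=> s4 R4 F4 M4.
  have Ps4 : pars_ok s4.
    apply: (@pars_okP h s) => //; last by rewrite M4.
    by move=> x xh; rewrite F4 ?F3 // ltnW.
  have [s5 [t5 [X5 R5 F5 M5 L5]]] := @runs_load_par h.+2 j s4 (leqW (leqW nh)) Ps4.
  have [||||| s6 [t6 [X6 R6 F6 M6 L6]]] :=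
      @exec_loop (Seq (compile np a (rcons rho h.+1) h.+3) (Add h h h.+3))
        h j F (cost pl a + 2) s5 nh.
  + by apply: (@pars_okP h s4) => // x xh; apply: F5; lia.
  + move=> i s6 iN P6 F6 R6 I6.
    have E6 : env_ok (rcons rho h.+1) h.+3 s6 (rcons e i).
      apply: (env_ok_rcons (h := h)) I6 => //; last by lia.
      by apply: (env_okP Es) => // x xh; rewrite F6 // F5 ?F4 ?F3 //; lia.
    have [s7 [t7 [X7 R7 F7 M7 L7]]] := Ha _ _ _ _ P6 E6.
    exists (set_reg s7 h (reg s7 h + reg s7 h.+3)), (t7 + 1); split=> //.
    * exact: exec_Seq X7 (exec_Add _ _ _ _).
    * by rewrite /= updE eqxx R7 F7 ?R6 /F ?big_ord_recr //; lia.
    * by rewrite /= updE gtn_eqF // F7.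
    * by move=> x xh; rewrite /= updE ltn_eqF ?F7 //; lia.
    * by split=> //; lia.
  + by rewrite F5 // F4 // R3 /F big_ord0 updE eqxx.
  + by rewrite F5.
  + by rewrite R5.
  exists s6, (t5 + t6); split=> //; first exact: exec_Seq X5 X6.
  + by move=> x xh; rewrite F6 // F5 //; lia.
  + by rewrite M6.
  + by lia.
- move=> j a b Ha Hb rho h s e Ps Es /=.
  have nh : np <= h by case: Es.
  pose F i := iteri i
    (fun i acc => eval mm pl b (rcons (rcons e i) acc)) (eval mm pl a e).
  rewrite -/(F _).
  apply: (runs_leq (c := cost pl a +
    (1 + (2 + (nth 0 pl j * (cost pl b + 2 + 6) + 1))))); last by lia.
  apply: runs_seq (Ha _ _ _ _ Ps Es) _ => s3 R3 F3 M3.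
  apply: runs_above.
    apply: (runs_1 (v := 0) (s' := set_reg s3 h.+1 0) (exec_Const _ _ _)) => //.
      by rewrite /= /upd eqxx.
    by move=> x xh; rewrite /= updE ltn_eqF.
  move=> s4 R4 F4 M4.
  have Ps4 : pars_ok s4.
    apply: (@pars_okP h s) => //; last by rewrite M4.
    by move=> x xh; rewrite F4 ?F3 // ltnW.
  have [s5 [t5 [X5 R5 F5 M5 L5]]] := @runs_load_par h.+2 j s4 (leqW (leqW nh)) Ps4.
  have [||||| s6 [t6 [X6 R6 F6 M6 L6]]] :=
      @exec_loop (Seq (compile np b (rcons (rcons rho h.+1) h) h.+3) (copy h h.+3))
        h j F (cost pl b + 2) s5 nh.
  + by apply: (@pars_okP h s4) => // x xh; apply: F5; lia.
  + move=> i s6 iN P6 F6 R6 I6.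
    have E6 : env_ok (rcons (rcons rho h.+1) h) h.+3 s6 (rcons (rcons e i) (F i)).
      apply: (env_ok_rcons (h := h.+3)) R6 => //; last by lia.
      apply: (env_ok_rcons (h := h)) I6 => //; last by lia.
      by apply: (env_okP Es) => // x xh; rewrite F6 // F5 ?F4 ?F3 //; lia.
    have [s7 [t7 [X7 R7 F7 M7 L7]]] := Hb _ _ _ _ P6 E6.
    have [|s8 [t8 [X8 R8 F8 M8 L8]]] := @exec_copy_frame h h.+3 s7; first by lia.
    exists s8, (t7 + t8); split=> //.
    * exact: exec_Seq X7 X8.
    * by rewrite R8 R7.
    * by rewrite F8 ?F7 //; lia.
    * by move=> x xh; rewrite F8 ?F7 //; lia.
    * by split; [rewrite M8 | lia].
  + by rewrite F5 // F4 // R3.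
  + by rewrite F5.
  + by rewrite R5.
  exists s6, (t5 + t6); split=> //; first exact: exec_Seq X5 X6.
  + by move=> x xh; rewrite F6 // F5 //; lia.
  + by rewrite M6.
  + by lia.
- move=> f args Hf Hargs rho h s e Ps Es; rewrite compile_App /=.
  have nh : np <= h by case: Es.
  have [s1 [t1 [X1 R1 F1 M1 L1]]] := runs_args Hargs (leqnSn h) Ps Es.
  have Ps1 : pars_ok s1 by apply: (pars_okP nh Ps _ M1) => x xh; apply: F1; lia.
  have E1 : env_ok (iota h.+1 (size args)) (h.+1 + size args) s1
              [seq eval mm pl a e | a <- args].
    split; first by lia.
    - by rewrite size_iota size_map.
    - by apply/allP => x; rewrite mem_iota => /andP[].
    - move=> l; rewrite size_iota => ll; rewrite nth_iota // R1 //.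
      by rewrite (nth_map (Lit 0)).
  have [s2 [t2 [X2 R2 F2 M2 L2]]] := Hf _ _ _ _ Ps1 E1.
  have [|s3 [t3 [X3 R3 F3 M3 L3]]] := @runs_copy h (h.+1 + size args) s2; first by lia.
  exists s3, (t1 + (t2 + t3)); split.
  + exact: exec_Seq X1 (exec_Seq X2 X3).
  + by rewrite R3 R2.
  + by move=> x xh; rewrite F3 // F2 ?F1 //; lia.
  + by rewrite M3 M2.
  + by lia.
Qed.

End CompileCorrect.

(** * Running time as a power of the largest parameter *)

Fixpoint csize (t : tm) : nat :=
  match t with
  | Par _ | Var _ | Lit _ => 3
  | Plus a b | Minus a b => csize a + csize b + 1
  | Rd a => csize a + 1
  | Ite a b c => csize a + csize b + csize c + 1
  | Let a b => csize a + csize b + 3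
  | Sum _ a => csize a + 15
  | Loop _ a b => csize a + csize b + 16
  | App f args => sumn [seq csize a | a <- args] + csize f + 4
  end.

Fixpoint depth (t : tm) : nat :=
  match t with
  | Par _ | Var _ | Lit _ => 0
  | Plus a b | Minus a b | Let a b => maxn (depth a) (depth b)
  | Rd a => depth a
  | Ite a b c => maxn (depth a) (maxn (depth b) (depth c))
  | Sum _ a => (depth a).+1
  | Loop _ a b => maxn (depth a) (depth b).+1
  | App f args => maxn (foldr maxn 0 [seq depth a | a <- args]) (depth f)
  end.

(** A loop multiplies the cost of its body by a parameter, hence by at most [V]; all other
    constructors, calls included, only add costs. So the exponent is the nesting depth of the
    loops. *)
Lemma cost_leq V pl t : 0 < V -> (forall j, nth 0 pl j <= V) ->
  cost pl t <= csize t * V ^ depth t.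
Proof.
move=> V0 pV; have X0 m : 0 < V ^ m by rewrite expn_gt0 V0.
have mono m m' c : m <= m' -> c * V ^ m <= c * V ^ m'.
  by move=> mm; rewrite leq_mul2l leq_pexp2l ?orbT.
have step c m m' x : x <= c * V ^ m -> m <= m' -> x <= c * V ^ m'.
  by move=> H1 H2; apply: leq_trans H1 (mono _ _ _ H2).
elim/tm_nested_ind: t => //=.
- by move=> a b Ha Hb; rewrite !mulnDl; apply: leq_add; [apply: leq_add|];
    [apply: step Ha _|apply: step Hb _|rewrite mul1n]; rewrite ?leq_maxl ?leq_maxr.
- by move=> a b Ha Hb; rewrite !mulnDl; apply: leq_add; [apply: leq_add|];
    [apply: step Ha _|apply: step Hb _|rewrite mul1n]; rewrite ?leq_maxl ?leq_maxr.
- by move=> a Ha; rewrite !mulnDl; apply: leq_add => //; rewrite mul1n.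
- move=> a b c Ha Hb Hc; rewrite !mulnDl; do !apply: leq_add; last by rewrite mul1n.
  + by apply: step Ha _; rewrite leq_maxl.
  + by apply: step Hb _; rewrite leq_max leq_maxl orbT.
  + by apply: step Hc _; rewrite leq_max leq_maxr orbT.
- move=> a b Ha Hb; rewrite !mulnDl; do !apply: leq_add.
  + by apply: step Ha _; rewrite leq_maxl.
  + by apply: step Hb _; rewrite leq_maxr.
  + exact: leq_pmulr.
- move=> j a Ha; rewrite (_ : 15 = 8 + 7) // addnA mulnDl; apply: leq_add; last exact: leq_pmulr.
  rewrite expnS mulnCA; apply: leq_mul => //.
  by rewrite mulnDl; apply: leq_add => //; apply: leq_pmulr.
- move=> j a b Ha Hb; rewrite (_ : 16 = 9 + 7) // addnA mulnDl.
  apply: leq_add; last exact: leq_pmulr.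
  rewrite -addnA mulnDl; apply: leq_add; first by apply: step Ha _; rewrite leq_maxl.
  apply: (@step _ (depth b).+1); last by rewrite leq_maxr.
  rewrite expnS mulnCA; apply: leq_mul => //.
  by rewrite mulnDl; apply: leq_add => //; apply: leq_pmulr.
- move=> f args Hf Hargs; rewrite !mulnDl; do !apply: leq_add; last exact: leq_pmulr.
    apply: (@step _ (foldr maxn 0 [seq depth a | a <- args])); last by rewrite leq_maxl.
    elim: args Hargs => //= a l IH [Ha Hl]; rewrite mulnDl; apply: leq_add.
      by apply: step Ha _; rewrite leq_maxl.
    by apply: (@step _ _ _ _ (IH Hl)); rewrite leq_maxr.
  by apply: step Hf _; rewrite leq_maxr.
Qed.

(** Loop bounds must be parameters, so each bound is itself the value of a closed term over the
    parameters computed before it, and is stored in the next register. *)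
Definition extend (mm : nat -> nat) (pl : seq nat) (ts : seq tm) : seq nat :=
  foldl (fun pl t => rcons pl (eval mm pl t [::])) pl ts.

Fixpoint compile_defs (np : nat) (ts : seq tm) : prog :=
  match ts with
  | [::] => Skip
  | t :: ts' => Seq (compile np t [::] np) (compile_defs np.+1 ts')
  end.

Lemma size_extend mm pl ts : size (extend mm pl ts) = size pl + size ts.
Proof.
by elim: ts pl => [|t ts IH] pl /=; rewrite ?addn0 // IH size_rcons addnS.
Qed.

Lemma mem_extend mm pl ts : {subset pl <= extend mm pl ts}.
Proof.
elim: ts pl => [|t ts IH] pl x xp //=; apply: IH.
by rewrite mem_rcons inE xp orbT.
Qed.

Lemma compile_defs_correct mm V d ts pl s : 0 < V ->
  all (fun x => x <= V) (extend mm pl ts) -> all (fun t => depth t <= d) ts ->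
  pars_ok mm pl s ->
  exists s' t, [/\ exec (compile_defs (size pl) ts) s s' t,
    pars_ok mm (extend mm pl ts) s'
    & t <= sumn [seq csize t | t <- ts] * V ^ d + 1].
Proof.
move=> V0; elim: ts pl s => [|t ts IH] pl s /=.
  by move=> _ _ Ps; exists s, 1; split=> //; exact: exec_Skip.
move=> HV /andP[dt Hd] Ps.
have E0 : env_ok pl [::] (size pl) s [::] by split.
have [s1 [t1 [X1 R1 F1 M1 L1]]] := @compile_correct mm pl t _ _ _ _ Ps E0.
have Ps1 : pars_ok mm (rcons pl (eval mm pl t [::])) s1.
  case: Ps => [Pm Pr]; split; first by rewrite M1.
  move=> j; rewrite size_rcons ltnS leq_eqVlt nth_rcons.
  by case/orP=> [/eqP->|jl]; rewrite ?ltnn ?eqxx // jl F1 // Pr.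
have [s2 [t2 [X2 P2 L2]]] := IH _ s1 HV Hd Ps1.
exists s2, (t1 + t2); split=> //.
  by apply: exec_Seq X1 _; move: X2; rewrite size_rcons.
rewrite mulnDl -addnA; apply: leq_add L2; apply: leq_trans L1 _.
apply: leq_trans (cost_leq t V0 _) _.
  move=> j; case: (ltnP j (size pl)) => jl; last by rewrite nth_default.
  apply: (allP HV); apply: mem_extend.
  by rewrite mem_rcons inE mem_nth ?orbT.
by rewrite leq_mul2l leq_pexp2l ?orbT.
Qed.

(** The two subtractions compute [k - (k - n)], that is [minn k n]. Register 2 is then free for the
    first definition, and the value of the last one sits in register [(size ts).+1]. *)
Definition program (ts : seq tm) : prog :=
  Seq (Seq (Defs.Sub 2 1 0) (Defs.Sub 1 1 2))
    (Seq (compile_defs 2 ts) (copy 0 (size ts).+1)).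

Lemma program_correct V d ts s : 0 < V -> 0 < size ts ->
  let vals := extend (Defs.mem s) [:: reg s 0; minn (reg s 1) (reg s 0)] ts in
  all (fun x => x <= V) vals -> all (fun t => depth t <= d) ts ->
  exists s' t, [/\ exec (program ts) s s' t, reg s' 0 = last 0 vals
    & t <= sumn [seq csize t | t <- ts] * V ^ d + 5].
Proof.
move=> V0 ts0 vals HV Hd.
pose s1 := set_reg s 2 (reg s 1 - reg s 0).
pose s2 := set_reg s1 1 (reg s1 1 - reg s1 2).
have X2 : exec (Seq (Defs.Sub 2 1 0) (Defs.Sub 1 1 2)) s s2 (1 + 1).
  exact: exec_Seq (exec_Sub _ _ _ _) (exec_Sub _ _ _ _).
have P2 : pars_ok (Defs.mem s) [:: reg s 0; minn (reg s 1) (reg s 0)] s2.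
  split=> // -[|[|j]] //= _; rewrite /upd /=; lia.
have [s3 [t3 [X3 P3 L3]]] := compile_defs_correct V0 HV Hd P2.
have [|s4 [t4 [X4 R4 F4 M4 L4]]] := @exec_copy_frame 0 (size ts).+1 s3; first by [].
exists s4, (1 + 1 + (t3 + t4)); split.
- exact: exec_Seq X2 (exec_Seq X3 X4).
- case: P3 => _ P3; rewrite R4 P3 /= ?size_extend //.
  by rewrite -nth_last size_extend.
- by lia.
Qed.

(** * The search *)

Definition digit (b x i : nat) : nat := x %/ b ^ i %% b.

Lemma digits_surj b l (f : nat -> nat) : (forall i, i < l -> f i < b) ->
  exists2 x, x < b ^ l & forall i, i < l -> digit b x i = f i.
Proof.
elim: l f => [|l IH] f fb; first by exists 0.
have [x xl xf] := IH (fun i => f i.+1) (fun i => fb i.+1).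
have f0 : f 0 < b by apply: fb.
exists (x * b + f 0).
  by rewrite expnSr (leq_trans (n := x.+1 * b)) // ?leq_mul2r ?xl ?orbT // mulSn addnC ltn_add2r.
case=> [|i] il; rewrite /digit; first by rewrite expn0 divn1 modnMDl modn_small.
have b0 : 0 < b by apply: leq_ltn_trans f0.
by rewrite expnS divnMA divnMDl // (divn_small f0) addn0 -/(digit b x i) xf.
Qed.

Section Decode.
Variable n : nat.
Implicit Types (M A : {set 'I_n}) (v : 'I_n).

Definition rank M v : nat := #|[set u in M | u < v]|.

(** A code is a word of [l] digits, each naming a vertex of [M] by its rank. Order and repetition
    are immaterial, and digits that are no rank are ignored. *)
Definition decode (b l : nat) M (x : nat) : {set 'I_n} :=
  [set v in M | [exists i : 'I_l, digit b x i == rank M v]].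

Lemma decode_sub b l M x : decode b l M x \subset M.
Proof. by apply/subsetP => v; rewrite inE => /andP[]. Qed.

Lemma rank_ltn M v : v \in M -> rank M v < #|M|.
Proof.
move=> vM; rewrite /rank proper_card //; apply/properP; split.
  by apply/subsetP => u; rewrite inE => /andP[].
by exists v => //; rewrite inE ltnn andbF.
Qed.

Lemma rank_inj M : {in M &, injective (rank M)}.
Proof.
have lt u v : u \in M -> v \in M -> u < v -> rank M u < rank M v.
  move=> uM vM uv; rewrite /rank proper_card //; apply/properP; split.
    by apply/subsetP => w; rewrite !inE => /andP[-> /ltn_trans]; apply.
  by exists u; rewrite !inE ?uM // ltnn.
move=> u v uM vM E; apply/val_inj; case: (ltngtP u v) => // /lt; rewrite E ltnn.
  by move/(_ uM vM).
by move/(_ vM uM).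
Qed.

(* The digit [#|M|] stands for no vertex, since ranks are below [#|M|]. *)
Lemma decode_surj b l M A : A \subset M -> #|A| <= l -> #|M| < b ->
  exists2 x, x < b ^ l & decode b l M x = A.
Proof.
move=> AM Al Mb.
pose f i := nth #|M| [seq rank M v | v <- enum A] i.
have fr i : f i <= #|M|.
  rewrite /f; case: (ltnP i (size [seq rank M v | v <- enum A])) => il; last by rewrite nth_default.
  have /mapP[v] := mem_nth #|M| il; rewrite mem_enum => vA ->.
  by rewrite ltnW // rank_ltn // (subsetP AM).
have [x xl xf] := @digits_surj b l f (fun i _ => leq_ltn_trans (fr i) Mb).
exists x => //; apply/setP => v; rewrite inE; apply/andP/idP.
  move=> [vM /existsP[i /eqP]]; rewrite xf // /f => E.
  case: (ltnP i (size [seq rank M v | v <- enum A])) => il; last first.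
    by move: (rank_ltn vM); rewrite -E nth_default // ltnn.
  have /mapP[w] := mem_nth #|M| il; rewrite mem_enum E => wA /rank_inj -> //.
  exact: (subsetP AM).
move=> vA; split; first exact: (subsetP AM).
have vi : index v (enum A) < size (enum A) by rewrite index_mem mem_enum.
have il : index v (enum A) < l by apply: leq_trans vi _; rewrite -cardE.
apply/existsP; exists (Ordinal il); rewrite xf // /f /= (nth_map v) //.
by rewrite nth_index // mem_enum.
Qed.

End Decode.

Section Algorithm.
Variable G : sgraph.
Variables (r k b len N p thr : nat).
Local Notation n := (nverts G).
Local Notation V := 'I_n.
Implicit Types (A B C D E K M Q R S W X Y Z acc Rest : {set V}) (v : V) 
  (H : {set {set V}})
  (st : {set V} * {set {set V}}).

Definition Nr : nat := n.+1 ^ r.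
Definition dv (c : nat) : {set V} := decode n.+1 r setT c.
Definition dm M (x : nat) : {set V} := decode b len M x.

(** A greedy packing is maximal. Only the union of its members is recorded. *)
Definition pack_step B C (acc : {set V}) (c : nat) : {set V} :=
  if [&& is_clique (dv c :|: C), #|dv c :|: C| == r
       & [disjoint dv c & B :|: acc]]
  then acc :|: dv c else acc.

Definition pack B C : {set V} := foldl (pack_step B C) set0 (iota 0 Nr).

Definition del_step M R (D : {set V}) (y : nat) : {set V} :=
  if [&& is_clique (dm M y), #|dm M y| == p & [disjoint dm M y & D]]
  then D :|: (dm M y :\: R) else D.

Definition del M R : {set V} := foldl (del_step M R) set0 (iota 0 N).

(* [c] is the least code of its set. *)
Definition fresh (c : nat) : bool :=
  ~~ has (fun c' => (c' < c) && (dv c' == dv c)) (iota 0 Nr).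

Definition branchable D M (c : nat) : bool :=
  [&& fresh c, is_clique (dv c), 0 < #|dv c| < r, dv c \subset M
    & [disjoint dv c & D]].

(* The state is a pair of a kernel and a family of sets to be hit.  The guess
   [R] predicts which small cliques [C] with a large packing are avoided by the
   solution: these have [C \subset R], and the packing joins the kernel. *)
Definition round_step D R M (st : {set V} * {set {set V}}) (c : nat) :=
  if branchable D M c then
    let X := pack (D :|: st.1) (dv c) in
    if (thr <= #|X|) && ~~ (dv c \subset R) then (st.1, dv c |: st.2)
    else (st.1 :|: X, st.2)
  else st.

Definition round D R (st : {set V} * {set {set V}}) :=
  foldl (round_step D R st.1) st (iota 0 Nr).

Definition good H W A : bool :=
  all (fun c => [&& is_clique (dv c), dv c \subset A & (dv c \in H) || (#|dv c| == r)]
                ==> ~~ [disjoint dv c & W]) (iota 0 Nr).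

Definition comp_step (Rest : {set V}) (v : V) (acc : {set V}) : {set V} :=
  [set u | (u == v) || (u \in Rest) && [exists w, (w \in acc) && adj w u]].

Definition component (Rest : {set V}) (v : V) : {set V} :=
  iter n (comp_step Rest v) set0.

(** The least vertex of a component represents it, so a sum over the roots counts every component
    once. *)
Definition is_root (Rest : {set V}) (v : V) : bool :=
  (v \in Rest) && [forall u : V, (u < v) ==> (u \notin component Rest v)].

(* [minsol] is [k.+1] if no small subset of [K] extends [X]. *)
Definition min_step H X Z K (m y : nat) : nat :=
  if good H (X :|: dm K y) (Z :|: K) && (#|dm K y| < m) then #|dm K y| else m.

Definition minsol H X Z K : nat := foldl (min_step H X Z K) k.+1 (iota 0 N).

Definition final_check D H M X Z : bool :=
  good H X Z &&
  (#|D| + #|X| +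
     \sum_(v : V | is_root (M :\: Z) v) minsol H X Z (component (M :\: Z) v) <= k).

Definition final D (st : {set V} * {set {set V}}) : bool :=
  has (fun z => has (fun x =>
      final_check D st.2 (st.1 :\: D) (dm (st.1 :\: D) x) (dm (st.1 :\: D) z))
    (iota 0 N)) (iota 0 N).

Fixpoint search (i : nat) D (st : {set V} * {set {set V}}) : bool :=
  if i is i'.+1 then
    has (fun x => search i' D (round D (dm st.1 x) st)) (iota 0 N)
  else final D st.

Definition accept : bool :=
  let M := pack set0 set0 in
  has (fun x => search r (del M (dm M x)) (M, set0)) (iota 0 N).

(** ** Soundness *)

Lemma dvP A : #|A| <= r -> exists2 c, c \in iota 0 Nr & dv c = A.
Proof.
move=> Ar; have [|x xl xE] := @decode_surj n n.+1 r setT A (subsetT _) Ar.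
  by rewrite cardsT card_ord.
by exists x => //; rewrite mem_iota.
Qed.

Lemma pack_step_sub B C (acc : {set V}) c : acc \subset pack_step B C acc c.
Proof. by rewrite /pack_step; case: ifP => // _; apply: subsetUl. Qed.

Lemma foldl_sub (f : {set V} -> nat -> {set V}) l A :
  (forall A c, A \subset f A c) -> A \subset foldl f A l.
Proof.
move=> Hf; elim: l A => //= c l IH A; exact: subset_trans (Hf A c) (IH _).
Qed.

Lemma pack_disjoint B C : [disjoint pack B C & B].
Proof.
rewrite /pack; have : [disjoint set0 & B] by rewrite -setI_eq0 set0I.
elim: (iota 0 Nr) set0 => //= c l IH acc dab; apply: IH; rewrite /pack_step.
case: ifP => // /and3P[_ _ d]; rewrite -setI_eq0 setIUl setU_eq0 !setI_eq0 dab.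
by move: d; rewrite -!setI_eq0 setIUr setU_eq0 => /andP[].
Qed.

(** A set [E] that avoids even the final packing would have been added when its code came up. *)
Lemma pack_max B C E : is_clique (E :|: C) -> #|E :|: C| = r -> E != set0 ->
  ~~ [disjoint E & B :|: pack B C].
Proof.
move=> cE sE nE; apply/negP => d.
have [|c cl dE] := @dvP E; first by rewrite -sE subset_leq_card // subsetUl.
move: d; rewrite /pack; case/splitPr: cl => l1 l2; rewrite foldl_cat /=.
set acc := foldl _ set0 l1 => d.
have sub : pack_step B C acc c \subset foldl (pack_step B C) (pack_step B C acc c) l2.
  exact: foldl_sub (pack_step_sub B C).
have accs := subset_trans (pack_step_sub B C acc c) sub.
have dacc : [disjoint E & B :|: acc].
  by apply: disjointWr d; apply: setUS.
move: sub; rewrite {1}/pack_step dE cE sE eqxx dacc /= subUset => /andP[_ Es].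
have [x xE] := set0Pn _ nE; move: d; rewrite disjoints_subset => /subsetP/(_ x xE).
by rewrite !inE (subsetP Es) // orbT.
Qed.

Lemma round_foldP D R M l st (M' : {set V}) (H' : {set {set V}}) :
  foldl (round_step D R M) st l = (M', H') ->
  [/\ st.1 \subset M', st.2 \subset H'
    & forall C, C \in H' -> C \in st.2 \/
        [/\ is_clique C, C \subset M & [disjoint C & D]]].
Proof.
elim: l st => [|c l IH] st /=; first by case: st => ? ? [-> ->]; split=> // C; left.
move/IH; rewrite /round_step; case: ifP => [/and5P[_ cl _ cM cD]|_] //.
case: ifP => _ /= [H1 H2 H3].
- split=> //; first by apply: subset_trans H2; apply: subsetUr.
  move=> C /H3[]; last by right.
  by rewrite !inE => /orP[/eqP->|]; [right|left].
- by split=> //; apply: subset_trans H1; apply: subsetUl.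
Qed.

Lemma ltn_ex_least (P : nat -> bool) c0 : P c0 ->
  exists c, [/\ P c, c <= c0 & forall c', P c' -> c <= c'].
Proof.
move=> Pc; exists (ex_minn (ex_intro P c0 Pc)).
by case: ex_minnP => m Pm mM; split=> //; apply: mM.
Qed.

Lemma fresh_code A : #|A| <= r -> exists c, [/\ c \in iota 0 Nr, dv c = A & fresh c].
Proof.
move=> Ar; have [c0 c0N E0] := dvP Ar.
have [|c [/eqP cE cc0 least]] := @ltn_ex_least (fun c => dv c == A) c0; first exact/eqP.
exists c; split=> //; first by move: c0N; rewrite !mem_iota /= !add0n => /(leq_ltn_trans cc0).
apply/hasPn => c' _; rewrite cE; apply/negP => /andP[lt /least].
by rewrite leqNgt lt.
Qed.

(* A maximal packing for [C = K :&: st.1] meets [K], which gains a kernel vertex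
   unless [C] was declared to be hit. *)
Lemma round_progress D R st K : is_clique K -> #|K| = r -> [disjoint K & D] ->
  0 < #|K :&: st.1| < r ->
  (forall C, C \in (round D R st).2 -> ~~ (C \subset K)) ->
  #|K :&: st.1| < #|K :&: (round D R st).1|.
Proof.
move=> cK sK dK /andP[lo hi] noH.
set C := K :&: st.1.
have [|c [cN cE cf]] := @fresh_code C; first exact: ltnW.
have clC : is_clique C.
  apply/'forall_implyP => x; rewrite inE => /andP[xK _]; apply/'forall_implyP => y.
  by rewrite inE => /andP[yK _]; move/'forall_implyP/(_ x xK)/'forall_implyP: cK; apply.
have br : branchable D st.1 c.
  rewrite /branchable cf cE clC lo hi subsetIr /=.
  by apply: disjointWl dK; apply: subsetIl.
move: noH; rewrite /round; case/splitPr: cN => l1 l2; rewrite foldl_cat /=.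
case E1 : (foldl (round_step D R st.1) st l1) => [M1 H1].
case E2 : (foldl (round_step D R st.1) _ l2) => [M2 H2] /= noH.
have [/= sM1 _ _] := round_foldP E1.
have := round_foldP E2; rewrite /round_step br cE /=.
case: ifP => _ /= [sM2 sH2 _].
  have /noH : C \in H2 by apply: (subsetP sH2); rewrite !inE eqxx.
  by rewrite subsetIl.
set X := pack _ C in sM2.
have EC : (K :\: C) :|: C = K.
  by apply/setP => x; rewrite !inE; case: (x \in K); case: (x \in st.1).
have nE : K :\: C != set0.
  by rewrite -card_gt0 cardsD (_ : K :&: C = C) ?subn_gt0 ?sK // setIA setIid.
have := @pack_max (D :|: M1) C (K :\: C); rewrite EC => /(_ cK sK nE).
rewrite -setI_eq0 => /set0Pn[x]; rewrite !inE => /andP[/andP[xC xK] xU].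
apply: proper_card; apply/properP; split.
  apply/subsetP => y; rewrite !inE => /andP[-> ys] /=.
  by apply: (subsetP sM2); rewrite inE (subsetP sM1).
exists x; last by rewrite !inE xK in xC *.
rewrite !inE xK /=; apply: (subsetP sM2); rewrite inE.
case/orP: xU => [/orP[xD|->]|->]; rewrite ?orbT //.
by move: dK; rewrite disjoints_subset => /subsetP/(_ x xK); rewrite inE xD.
Qed.

Definition rest_rel (Rest : {set V}) : rel V :=
  [rel u w | [&& u \in Rest, w \in Rest & adj u w]].

Lemma rest_rel_sym Rest : symmetric (rest_rel Rest).
Proof. by move=> u w; rewrite /rest_rel /= adj_sym; case: (u \in Rest); case: (w \in Rest). Qed.

Lemma comp_step_mono Rest v :
  {homo comp_step Rest v : A B / A \subset B}.
Proof.
move=> A B AB; apply/subsetP => u; rewrite !inE => /orP[->//|/andP[-> /existsP[w /andP[wA aw]]]].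
by apply/orP; right; apply/existsP; exists w; rewrite aw (subsetP AB).
Qed.

(** The iterates of a monotone map from the empty set grow by a vertex until they are stationary, so
    [n] of them reach the least fixed point. *)
Lemma compE Rest v : v \in Rest ->
  component Rest v = [set u | connect (rest_rel Rest) v u].
Proof.
move=> vR; have E : component Rest v = fixset (comp_step Rest v) by rewrite /fixset card_ord.
have fixE : comp_step Rest v (component Rest v) = component Rest v.
  by rewrite E fixsetK //; apply: comp_step_mono.
have iter_sub m : iter m (comp_step Rest v) set0 \subset component Rest v.
  elim: m => [|m IH] /=; first exact: sub0set.
  by rewrite -fixE; apply: comp_step_mono.
have iter_conn m : iter m (comp_step Rest v) set0
    \subset [set u | connect (rest_rel Rest) v u].
  elim: m => [|m IH] /=; first exact: sub0set.
  apply/subsetP => u; rewrite !inE => /orP[/eqP-> //|/andP[uR /existsP[w /andP[wi aw]]]].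
  have := subsetP IH _ wi; rewrite inE => vw.
  apply: connect_trans vw (connect1 _); rewrite /rest_rel /= uR aw /= andbT.
  have := subsetP (iter_sub m) _ wi.
  by rewrite -fixE inE => /orP[/eqP->|/andP[]].
apply/eqP; rewrite eqEsubset iter_conn /=.
apply/subsetP => u; rewrite inE => /connectP[q]; elim/last_ind: q u => [|q w IH] u /=.
  by move=> _ ->; rewrite -fixE inE eqxx.
rewrite rcons_path last_rcons => /andP[/IH/(_ erefl) H /and3P[_ wR aw]] ->.
by rewrite -fixE inE wR; apply/orP; right; apply/existsP; exists (last v q); rewrite H.
Qed.

Lemma is_rootP Rest v : v \in Rest ->
  exists2 w, is_root Rest w & v \in component Rest w.
Proof.
move=> vR.
have P0 : (v \in Rest) && connect (rest_rel Rest) v v by rewrite vR connect0.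
case: (@arg_minnP _ v (fun u => (u \in Rest) && connect (rest_rel Rest) v u) val P0).
move=> w /andP[wR vw] least; exists w; last first.
  by rewrite compE // inE (sym_connect_sym (@rest_rel_sym Rest)).
rewrite /is_root wR; apply/forallP => u; apply/implyP => uw.
apply/negP; rewrite compE // inE => wu.
suff uR : u \in Rest.
  by move: (least u); rewrite uR (connect_trans vw wu) leqNgt uw => /(_ isT).
case/connectP: wu => q; case/lastP: q => [_ -> //|q x].
by rewrite rcons_path last_rcons => /andP[_ /and3P[_ xR _]] ->.
Qed.

Lemma goodP H W A C : good H W A -> is_clique C -> C \subset A -> #|C| <= r ->
  (C \in H) || (#|C| == r) -> ~~ [disjoint C & W].
Proof.
move=> /allP gd cC CA Cr HC; have [c cN cE] := dvP Cr.
by move/implyP: (gd c cN); rewrite cE cC CA HC; apply.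
Qed.

(** The fold starts at [k.+1], so a value of at most [k] was set by an actual subset. *)
Lemma minsolP H X Z K : minsol H X Z K <= k ->
  exists Y, [/\ Y \subset K, good H (X :|: Y) (Z :|: K) & #|Y| = minsol H X Z K].
Proof.
rewrite /minsol.
suff Hf m l : foldl (min_step H X Z K) m l = m \/ exists Y,
    [/\ Y \subset K, good H (X :|: Y) (Z :|: K) & #|Y| = foldl (min_step H X Z K) m l].
  by case: (Hf k.+1 (iota 0 N)) => // -> /=; rewrite ltnn.
elim: l m => [|y l IH] m /=; first by left.
case: (IH (min_step H X Z K m y)) => [|]; last by right.
rewrite /min_step; case: ifP => [/andP[gd _] E|_]; last by left.
by right; exists (dm K y); split=> //; rewrite ?decode_sub // E.
Qed.

(** A clique meets at most one component, so every clique of the kernel lies in [Z] plus a single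
    component. This is what allows the components to be solved independently. *)
Lemma clique_in_comp Rest v K : is_clique K -> v \in K -> v \in Rest ->
  exists2 w, is_root Rest w & K :&: Rest \subset component Rest w.
Proof.
move=> cK vK vR; have [w rw vw] := is_rootP vR; exists w => //.
have wR : w \in Rest by case/andP: rw.
apply/subsetP => u; rewrite inE => /andP[uK uR].
move: vw; rewrite !compE // !inE => wv.
case: (eqVneq v u) => [<- //|vu]; apply: connect_trans wv (connect1 _).
rewrite /rest_rel /= vR uR /=; move/'forall_implyP/(_ v vK)/'forall_implyP/(_ u uK): cK.
by rewrite vu.
Qed.

Lemma clique_sub A B : A \subset B -> is_clique B -> is_clique A.
Proof.
move=> /subsetP AB /'forall_implyP cB; apply/'forall_implyP => x /AB/cB/'forall_implyP cx.
by apply/'forall_implyP => y /AB/cx.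
Qed.

Lemma final_sound D st :
  (forall C, C \in st.2 -> C \subset st.1) ->
  (forall K, is_clique K -> #|K| = r -> [disjoint K & D] ->
     (exists2 C, C \in st.2 & C \subset K) \/ K \subset st.1) ->
  final D st -> Kr_cover r G k.
Proof.
case: st => M H /= HM HK /hasP[z _ /hasP[x _]].
set M' := M :\: D; set Z := dm M' z; set X := dm M' x => /andP[gXZ tot].
set Rest := M' :\: Z in tot.
have ex v : {Y : {set V} | is_root Rest v ->
    [/\ Y \subset component Rest v, good H (X :|: Y) (Z :|: component Rest v)
      & #|Y| = minsol H X Z (component Rest v)]}.
  apply: cid; case: (boolP (is_root Rest v)) => rv; last by exists set0.
  have [|Y HY] := @minsolP H X Z (component Rest v); last by exists Y.
  apply: leq_trans tot; rewrite (bigD1 v) //=; lia.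
pose Y v := sval (ex v).
have YP v (rv : is_root Rest v) := svalP (ex v) rv.
pose S := D :|: X :|: \bigcup_(v | is_root Rest v) Y v.
apply/existsP; exists S; apply/andP; split.
  apply: leq_trans tot; apply: leq_trans (leq_card_setU _ _) _.
  apply: leq_add; first exact: leq_card_setU.
  rewrite (eq_bigr (fun v => #|Y v|)); last by move=> v /YP[_ _ ->].
  elim/big_rec2: _ => [|v m B rv IH]; first by rewrite cards0.
  by apply: leq_trans (leq_card_setU _ _) _; rewrite leq_add2l.
(* This serves both for [r]-cliques inside the kernel and for the sets to be hit: as parts of an
   [r]-clique, the latter are cliques too. *)
have hit C : is_clique C -> C \subset M -> #|C| <= r ->
    (C \in H) || (#|C| == r) -> ~~ [disjoint C & S].
  move=> cC CM Cr HC; apply/negP => d.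
  have CM' : C \subset M'.
    apply/subsetP => u uC; rewrite inE (subsetP CM) // andbT; apply/negP => uD.
    by move: d; rewrite disjoints_subset => /subsetP/(_ u uC); rewrite !inE uD.
  case: (boolP (C \subset Z)) => [CZ|/subsetPn[u uC uZ]].
    move: (goodP gXZ cC CZ Cr HC); rewrite (disjointWr _ d) //.
    by rewrite /S -setUA setUCA subsetUl.
  have uR : u \in Rest by rewrite inE uZ (subsetP CM').
  have [w rw sub] := clique_in_comp cC uC uR; have [_ gd _] := YP w rw.
  have CA : C \subset Z :|: component Rest w.
    apply/subsetP => a aC; rewrite inE; case: (boolP (a \in Z)) => //= aZ.
    by apply: (subsetP sub); rewrite inE aC inE aZ (subsetP CM').
  move: (goodP gd cC CA Cr HC); rewrite (disjointWr _ d) //.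
  rewrite /S -setUA [D :|: _]setUC -setUA; apply: setUS.
  by apply: subset_trans (subsetUl _ _); apply: bigcup_sup.
apply/existsP => -[K /and3P[cK /eqP sK dK]].
have dKD : [disjoint K & D].
  by apply: disjointWr dK; rewrite /S -setUA subsetUl.
case: (HK K cK sK dKD) => [[C CH CK]|KM].
  have /negP := hit C (clique_sub CK cK) (HM C CH) ltac:(by rewrite -sK subset_leq_card)
    ltac:(by rewrite CH).
  by apply; apply: disjointWl dK.
by move/negP: (hit K cK KM ltac:(by rewrite sK) ltac:(by rewrite sK eqxx orbT)).
Qed.

Lemma search_sound i D st :
  (forall C, C \in st.2 -> C \subset st.1) ->
  (forall K, is_clique K -> #|K| = r -> [disjoint K & D] ->
     (exists2 C, C \in st.2 & C \subset K) \/
     (0 < r -> 0 < #|K :&: st.1|) /\ r <= #|K :&: st.1| + i) ->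
  search i D st -> Kr_cover r G k.
Proof.
elim: i st => [|i IH] st HM HK /=.
  apply: final_sound => // K cK sK dK; case: (HK K cK sK dK); first by left.
  rewrite addn0 -sK => -[_ le]; right; apply/setIidPl/eqP.
  by rewrite eqEcard subsetIl.
case/hasP => x _; set R := dm st.1 x.
case E : (round D R st) => [M' H'].
have [sM sH fromH] := round_foldP E.
apply: IH => /= [C /fromH[/HM CM|[_ CM _]]|K cK sK dK].
- exact: subset_trans CM sM.
- exact: subset_trans CM sM.
- case: (HK K cK sK dK) => [[C CH CK]|[pos le]].
    by left; exists C => //; apply: (subsetP sH).
  case: (pselect (exists2 C, C \in H' & C \subset K)) => [|noH]; [by left|right].
  have mono : #|K :&: st.1| <= #|K :&: M'| by apply: subset_leq_card; apply: setIS.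
  split; first by move/pos => p0; apply: leq_trans mono.
  case: (ltnP #|K :&: st.1| r) => [lt|ge]; last first.
    by rewrite (leq_trans ge) // (leq_trans mono) ?leq_addr.
  have := @round_progress D R st K cK sK dK; rewrite E /= lt andbT.
  move=> /(_ (pos (leq_ltn_trans (leq0n _) lt))) pr.
  suff Hx : #|K :&: st.1| < #|K :&: M'|.
    by clear -Hx le; rewrite addnS in le; apply: leq_trans le _; rewrite -addSn leq_add2r.
  by apply: pr => C CH; apply/negP => CK; apply: noH; exists C.
Qed.

Lemma accept_sound : accept -> Kr_cover r G k.
Proof.
case/hasP => x _ /=; apply: search_sound => /= [C|K cK sK _]; first by rewrite inE.
(* With [r] rounds left the counting condition is void; the maximality of the first packing makes it
   meet every [r]-clique. *)
right; rewrite leq_addl; split=> // r0.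
have := @pack_max set0 set0 K; rewrite setU0 set0U => /(_ cK sK).
by rewrite -setI_eq0 -card_gt0 sK -card_gt0 => /(_ r0).
Qed.

End Algorithm.

(** * The search as a term *)

(* [locked] prevents rewriting with the evaluation rules from looking through
   the name of a subprogram. *)
Definition Ind a := locked (Ite a (Lit 1) (Lit 0)).
Definition Not a := locked (Ite a (Lit 0) (Lit 1)).
Definition And a b := locked (Ite a b (Lit 0)).
Definition Or a b := locked (Ite a (Lit 1) b).
Definition Lt a b := locked (Minus b a).
Definition Eq a b := locked (Not (Plus (Minus a b) (Minus b a))).

(* Indices of the parameters: n, k, n+1, t, the length, base and number of
   codes of small subsets, the clique and packing thresholds, (n+1)^r,
   n+(n+1)^r and r. *)
Definition pn := 0.
Definition pk := 1.
Definition pn1 := 2.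
Definition pt := 3.
Definition plen := 4.
Definition pb := 5.
Definition pN := 6.
Definition pp := 7.
Definition pthr := 8.
Definition pNr := 9.
Definition pU := 10.
Definition pr := 11.

(** Repeated addition; the second factor is truncated at the parameter [j]. *)
Definition mulF (j : nat) : tm :=
  locked (Sum j (Ite (Lt (Var 2) (Var 1)) (Var 0) (Lit 0))).

(** Counts the [i] with [(i + 1) * y <= x]. The divisor is always the parameter [jb] itself, so that
    the product is not truncated. *)
Definition divF (j jb : nat) : tm :=
  locked (Sum j (Ind (Not (Lt (Var 0) (App (mulF jb) [:: Plus (Var 2) (Lit 1); Var 1]))))).

(** A loop bound cannot be the variable [i]: the loop runs over all positions and divides only at
    the first [i] of them. *)
Definition digF (jb jl jN : nat) : tm :=
  locked (Let (Loop jl (Var 0) (Ite (Lt (Var 2) (Var 1))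
         (App (divF jN jb) [:: Var 3; Par jb]) (Var 3)))
    (Minus (Var 2) (App (mulF jb) [:: App (divF jN jb) [:: Var 2; Par jb]; Par jb]))).

Definition pow2F : tm :=
  locked (Loop pU (Lit 1) (Ite (Lt (Var 1) (Var 0)) (Plus (Var 2) (Var 2)) (Var 2))).

(** Masks are numbers up to [2 ^ U], far too large for the counting division [divF]. Instead [2 ^ d]
    is subtracted where possible for [d] from [U - 1] down to [i + 1], which leaves the mask modulo
    [2 ^ i.+1], to be compared with [2 ^ i]. *)
Definition bitF : tm := locked (Let (Loop pU (Var 0)
        (Let (Minus (Minus (Par pU) (Lit 1)) (Var 2))
          (Ite (Lt (Var 1) (Var 4))
             (Let (App pow2F [:: Var 4])
                (Ite (Lt (Var 3) (Var 5)) (Var 3) (Minus (Var 3) (Var 5))))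
             (Var 3))))
    (Not (Lt (Var 2) (App pow2F [:: Var 1])))).

Definition Bit X i := locked (App bitF [:: X; i]).

(* [d] is the level of the index variable bound by the comprehension. *)
Definition Mk (j d : nat) (phi : tm) : tm :=
  locked (Sum j (Ite phi (App pow2F [:: Var d]) (Lit 0))).

Definition rankF : tm :=
  locked (Sum pn (Ind (And (Lt (Var 2) (Var 1)) (Bit (Var 0) (Var 2))))).

Definition decF (jb jl jN : nat) : tm := locked (Mk pn 2 (And (Bit (Var 0) (Var 2))
    (Sum jl (Eq (App (digF jb jl jN) [:: Var 1; Var 3]) (App rankF [:: Var 0; Var 2]))))).

Definition dvF : tm := locked (App (decF pn1 pr pNr) [:: Mk pn 1 (Lit 1); Var 0]).
Definition dmF : tm := locked (decF pb plen pN).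
Definition unionF : tm :=
  locked (Mk pn 2 (Or (Bit (Var 0) (Var 2)) (Bit (Var 1) (Var 2)))).
Definition diffF : tm :=
  locked (Mk pn 2 (And (Bit (Var 0) (Var 2)) (Not (Bit (Var 1) (Var 2))))).
Definition cardF : tm := locked (Sum pn (Ind (Bit (Var 0) (Var 1)))).
Definition subF : tm :=
  locked (Not (Sum pn (And (Bit (Var 0) (Var 2)) (Not (Bit (Var 1) (Var 2)))))).
Definition disjF : tm :=
  locked (Not (Sum pn (And (Bit (Var 0) (Var 2)) (Bit (Var 1) (Var 2))))).
Definition adjF : tm :=
  locked (Rd (Plus (App (mulF pn) [:: Var 0; Par pn]) (Var 1))).
Definition cliqueF : tm :=
  locked (Not (Sum pn (And (Bit (Var 0) (Var 1)) (Sum pn (And (Bit (Var 0) (Var 2))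
    (And (Not (Eq (Var 1) (Var 2))) (Not (App adjF [:: Var 1; Var 2])))))))).

Definition packF : tm := locked (Loop pNr (Lit 0)
    (Let (App dvF [:: Var 2]) (Let (App unionF [:: Var 4; Var 1])
      (Ite (And (App cliqueF [:: Var 5]) (And (Eq (App cardF [:: Var 5]) (Par pr))
              (App disjF [:: Var 4; App unionF [:: Var 0; Var 3]])))
         (App unionF [:: Var 3; Var 4]) (Var 3))))).

Definition delF : tm := locked (Loop pN (Lit 0)
    (Let (App dmF [:: Var 0; Var 2])
      (Ite (And (App cliqueF [:: Var 4]) (And (Eq (App cardF [:: Var 4]) (Par pp))
              (App disjF [:: Var 4; Var 3])))
         (App unionF [:: Var 3; App diffF [:: Var 4; Var 1]]) (Var 3)))).

Definition freshF : tm :=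
  locked (Not (Sum pNr (And (Lt (Var 1) (Var 0)) (Eq (App dvF [:: Var 1]) (App dvF [:: Var 0]))))).

Definition getF : tm := locked (Mk pn 1 (Bit (Var 0) (Var 1))).

(** Sets are compared rather than codes, so the bits of all codes of the inserted set are switched
    on. *)
Definition insF : tm := locked (Mk pU 2 (Or (Bit (Var 0) (Var 2))
    (And (Not (Lt (Var 2) (Par pn))) (Eq (App dvF [:: Minus (Var 2) (Par pn)]) (Var 1))))).

Definition addF : tm :=
  locked (Mk pU 2 (Or (Bit (Var 0) (Var 2)) (Bit (Var 1) (Var 2)))).

Definition roundF : tm := locked (Let (App getF [:: Var 2])
    (Loop pNr (Var 2) (Let (App dvF [:: Var 4])
      (Ite (And (App freshF [:: Var 4]) (And (App cliqueF [:: Var 6])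
              (And (And (Lt (Lit 0) (App cardF [:: Var 6])) (Lt (App cardF [:: Var 6]) (Par pr)))
                 (And (App subF [:: Var 6; Var 3]) (App disjF [:: Var 6; Var 0])))))
        (Let (App packF [:: App unionF [:: Var 0; App getF [:: Var 5]]; Var 6])
          (Ite (And (Not (Lt (App cardF [:: Var 7]) (Par pthr)))
                    (Not (App subF [:: Var 6; Var 1])))
             (App insF [:: Var 5; Var 6]) (App addF [:: Var 5; Var 7])))
        (Var 5))))).

Definition goodF : tm := locked (Not (Sum pNr (Let (App dvF [:: Var 3])
    (And (And (App cliqueF [:: Var 4]) (And (App subF [:: Var 4; Var 2])
            (Or (Bit (Var 0) (Plus (Par pn) (Var 3))) (Eq (App cardF [:: Var 4]) (Par pr)))))
       (App disjF [:: Var 4; Var 1]))))).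

Definition compF : tm :=
  locked (Loop pn (Lit 0) (Mk pn 4 (Or (Eq (Var 4) (Var 1)) (And (Bit (Var 0) (Var 4))
    (Sum pn (And (Bit (Var 3) (Var 5)) (App adjF [:: Var 5; Var 4]))))))).

Definition rootF : tm := locked (Let (App compF [:: Var 0; Var 1])
    (And (Bit (Var 0) (Var 1))
       (Not (Sum pn (And (Lt (Var 3) (Var 1)) (Bit (Var 2) (Var 3))))))).

Definition minF : tm := locked (Loop pN (Plus (Par pk) (Lit 1))
    (Let (App dmF [:: Var 3; Var 4])
      (Ite (And (App goodF [:: Var 0; App unionF [:: Var 1; Var 6]; App unionF [:: Var 2; Var 3]])
                (Lt (App cardF [:: Var 6]) (Var 5)))
         (App cardF [:: Var 6]) (Var 5)))).

Definition checkF : tm := locked (Let (App diffF [:: Var 2; Var 4])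
    (And (App goodF [:: Var 1; Var 3; Var 4])
       (Not (Lt (Par pk) (Plus (Plus (App cardF [:: Var 0]) (App cardF [:: Var 3]))
          (Sum pn (Ite (App rootF [:: Var 5; Var 6])
             (App minF [:: Var 1; Var 3; Var 4; App compF [:: Var 5; Var 6]]) (Lit 0)))))))).

Definition finalF : tm := locked (Let (App diffF [:: App getF [:: Var 1]; Var 0])
    (Sum pN (Sum pN (App checkF [:: Var 0; Var 1; Var 2;
       App dmF [:: Var 2; Var 4]; App dmF [:: Var 2; Var 3]])))).

(** Each round nests one more sum over all guesses; the loop depth therefore depends on [r], but on
    nothing else. *)
Fixpoint searchF (i : nat) : tm :=
  if i is i'.+1 then
    Let (App getF [:: Var 1])
      (Sum pN (App (searchF i')
         [:: Var 0; App roundF [:: Var 0; App dmF [:: Var 2; Var 3]; Var 1]]))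
  else finalF.

Definition mainF (r : nat) : tm := locked (Let (App packF [:: Lit 0; Lit 0])
    (Sum pN (App (searchF r)
       [:: App delF [:: Var 0; App dmF [:: Var 0; Var 1]]; Var 0]))).

Lemma iteri_enc (S T : Type) (enc : S -> T) (g : S -> nat -> S) (f : nat -> T -> T) m x :
  (forall i y, i < m -> f i (enc y) = enc (g y i)) ->
  iteri m f (enc x) = enc (foldl g x (iota 0 m)).
Proof.
elim: m => // m IH Hf.
have -> : iota 0 m.+1 = rcons (iota 0 m) m by rewrite -cats1 -addn1 iotaD.
rewrite iteriS foldl_rcons -Hf // IH // => i y im.
by rewrite Hf // ltnW.
Qed.

Lemma foldl_iota T (f : T -> T) m x :
  foldl (fun acc _ => f acc) x (iota 0 m) = iter m f x.
Proof.
elim: m => // m IH.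
have -> : iota 0 m.+1 = rcons (iota 0 m) m by rewrite -cats1 -addn1 iotaD.
by rewrite foldl_rcons IH.
Qed.

Lemma iteri_iter_le T (f : T -> T) m i x : i <= m ->
  iteri m (fun j a => if j < i then f a else a) x = iter i f x.
Proof.
have E : iteri m (fun j a => if j < i then f a else a) x = iter (minn m i) f x.
  elim: m => [|m IH]; first by rewrite min0n.
  rewrite iteriS IH; case: (boolP (m < i)) => mi.
    by rewrite (minn_idPl mi) (minn_idPl (ltnW mi)).
  by congr (iter _ f x); lia.
by move=> im; rewrite E (minn_idPr im).
Qed.

(** * Bit masks *)

Definition code (m : nat) (f : nat -> bool) : nat := \sum_(i < m) f i * 2 ^ i.

Lemma code_ltn m f : code m f < 2 ^ m.
Proof.
elim: m => [|m IH]; first by rewrite /code big_ord0.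
rewrite /code big_ord_recr /= -/(code m f) expnS mul2n -addnn.
by case: (f m); rewrite ?mul1n ?mul0n; lia.
Qed.

Lemma eq_code m f g : (forall i, i < m -> f i = g i) -> code m f = code m g.
Proof. by move=> E; apply: eq_bigr => i _; rewrite E. Qed.

Lemma code_mod m u f : m <= u -> code u f %% 2 ^ m = code m f.
Proof.
move/subnK => <-; elim: (u - m) => [|d IH]; first by rewrite modn_small ?code_ltn.
rewrite addSn /code big_ord_recr /= -/(code (d + m) f) expnD mulnA addnC modnMDl.
exact: IH.
Qed.

Lemma code_bit u f i : i < u -> (2 ^ i <= code u f %% 2 ^ i.+1) = f i.
Proof.
move=> iu; rewrite code_mod // /code big_ord_recr /= -/(code i f).
case: (f i); rewrite ?mul1n ?mul0n ?leq_addl // addn0.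
by apply/negbTE; rewrite -ltnNge code_ltn.
Qed.

Lemma code_inj u f g : code u f = code u g -> forall i, i < u -> f i = g i.
Proof. by move=> E i iu; rewrite -(code_bit f iu) E code_bit. Qed.

Lemma code_widen m u f : m <= u -> (forall i, m <= i -> i < u -> f i = false) ->
  code u f = code m f.
Proof.
move/subnK => <-; elim: (u - m) => // d IH Hf.
rewrite addSn /code big_ord_recr /= Hf ?leq_addl // mul0n addn0.
by apply: IH => i mi id; apply: Hf => //; rewrite addSn ltnS ltnW.
Qed.

(** Halving the modulus takes one conditional subtraction: this is one iteration of the loop in
    [bitF]. *)
Lemma modn_pow2S x e : x %% 2 ^ e =
  if x %% 2 ^ e.+1 < 2 ^ e then x %% 2 ^ e.+1 else x %% 2 ^ e.+1 - 2 ^ e.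
Proof.
have Hy : x %% 2 ^ e.+1 < 2 ^ e + 2 ^ e by rewrite addnn -mul2n -expnS ltn_pmod ?expn_gt0.
have -> : x %% 2 ^ e = (x %% 2 ^ e.+1) %% 2 ^ e by rewrite modn_dvdm // dvdn_exp2l.
set y := x %% 2 ^ e.+1 in Hy *; case: ltnP => [lt|ge]; first by rewrite modn_small.
by rewrite -{1}(subnK ge) modnDr modn_small //; lia.
Qed.

#[global] Arguments eval : simpl never.

Section EvalLemmas.
Variables (mm : nat -> nat) (pl : seq nat).
Local Notation ev := (eval mm pl).
Implicit Types e : seq nat.

Lemma evPar j e : ev (Par j) e = nth 0 pl j. Proof. by []. Qed.
Lemma evVar l e : ev (Var l) e = nth 0 e l. Proof. by []. Qed.
Lemma evLit c e : ev (Lit c) e = c. Proof. by []. Qed.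
Lemma evPlus x y e : ev (Plus x y) e = ev x e + ev y e. Proof. by []. Qed.
Lemma evMinus x y e : ev (Minus x y) e = ev x e - ev y e. Proof. by []. Qed.
Lemma evRd x e : ev (Rd x) e = mm (ev x e). Proof. by []. Qed.
Lemma evIte x y z e : ev (Ite x y z) e = if ev x e != 0 then ev y e else ev z e.
Proof. by []. Qed.
Lemma evLet x y e : ev (Let x y) e = ev y (rcons e (ev x e)). Proof. by []. Qed.
Lemma evSum j x e : ev (Sum j x) e = \sum_(i < nth 0 pl j) ev x (rcons e i).
Proof. by []. Qed.
Lemma evLoop j x y e : ev (Loop j x y) e =
  iteri (nth 0 pl j) (fun i acc => ev y (rcons (rcons e i) acc)) (ev x e).
Proof. by []. Qed.
Lemma evApp f a e : ev (App f a) e = ev f [seq ev x e | x <- a]. Proof. by []. Qed.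
Definition evE := (evPar, evVar, evLit, evPlus, evMinus, evRd, evIte, evLet, evApp).

Lemma trInd x e : ev (Ind x) e = (ev x e != 0).
Proof. by rewrite /Ind -lock !evE; case: ifP. Qed.
Lemma trNot x e : (ev (Not x) e != 0) = ~~ (ev x e != 0).
Proof. by rewrite /Not -lock !evE; case: ifP. Qed.
Lemma trAnd x y e : (ev (And x y) e != 0) = (ev x e != 0) && (ev y e != 0).
Proof. by rewrite /And -lock !evE; case: ifP. Qed.
Lemma trOr x y e : (ev (Or x y) e != 0) = (ev x e != 0) || (ev y e != 0).
Proof. by rewrite /Or -lock !evE; case: ifP. Qed.
Lemma trLt x y e : (ev (Lt x y) e != 0) = (ev x e < ev y e).
Proof. by rewrite /Lt -lock !evE subn_eq0 -ltnNge. Qed.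
Lemma trEq x y e : (ev (Eq x y) e != 0) = (ev x e == ev y e).
Proof. by rewrite /Eq -lock trNot negbK !evE addn_eq0 !subn_eq0 eqn_leq. Qed.
Lemma trSum j x e :
  (ev (Sum j x) e != 0) = [exists i : 'I_(nth 0 pl j), ev x (rcons e i) != 0].
Proof.
rewrite evSum sum_nat_eq0 negb_forall.
by apply: eq_existsb => i.
Qed.
Lemma trSumI j x e :
  (ev (Sum j x) e != 0) = has (fun i => ev x (rcons e i) != 0) (iota 0 (nth 0 pl j)).
Proof.
rewrite trSum; apply/existsP/hasP => [[i xi]|[i]].
  by exists (val i); rewrite ?mem_iota ?add0n ?ltn_ord.
by rewrite mem_iota add0n => im xi; exists (Ordinal im).
Qed.
Definition trE := (trNot, trAnd, trOr, trLt, trEq, trInd).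

Lemma mulFP j x y : ev (mulF j) [:: x; y] = x * minn y (nth 0 pl j).
Proof.
rewrite /mulF -lock evSum (eq_bigr (fun i : 'I_ _ => (i < y) * x)) => [|i _]; last first.
  by rewrite evIte trLt !evE /=; case: (_ < _); rewrite ?mul1n.
rewrite -big_distrl /= mulnC; congr (_ * _).
elim: (nth 0 pl j) => [|m IH]; first by rewrite big_ord0 minn0.
by rewrite big_ord_recr /= IH; lia.
Qed.

Lemma divFP j jb x : 0 < nth 0 pl jb -> x <= nth 0 pl j ->
  ev (divF j jb) [:: x; nth 0 pl jb] = x %/ nth 0 pl jb.
Proof.
move=> y0 xj; rewrite /divF -lock evSum; set y := nth 0 pl jb in y0 *.
rewrite (eq_bigr (fun i : 'I_ _ => nat_of_bool (i < x %/ y))) => [|i _]; last first.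
  rewrite trInd !trE evApp /= mulFP !evE /= minnn -leqNgt addn1.
  by rewrite leq_divRL.
have : x %/ y <= nth 0 pl j by apply: leq_trans (leq_div _ _) xj.
elim: (nth 0 pl j) (x %/ y) => [|m IH] q; first by rewrite big_ord0; lia.
rewrite big_ord_recr /= => qm.
case: (leqP q m) => le; first by rewrite IH // addn0.
rewrite (eq_bigr (fun=> 1)) => [|i _]; last by rewrite (ltn_trans (ltn_ord i)).
by rewrite sum_nat_const card_ord; lia.
Qed.

Lemma digFP jb jl jN x i : 0 < nth 0 pl jb -> x <= nth 0 pl jN -> i <= nth 0 pl jl ->
  ev (digF jb jl jN) [:: x; i] = digit (nth 0 pl jb) x i.
Proof.
move=> y0 xj il; rewrite /digF -lock evLet evLoop.
set y := nth 0 pl jb in y0 *.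
have itle m : iter m (fun a => a %/ y) x <= x.
  by elim: m => //= m IH; apply: leq_trans (leq_div _ _) IH.
have itE m : iter m (fun a => a %/ y) x = x %/ y ^ m.
  by elim: m => [|m IH]; rewrite ?divn1 //= IH -divnMA expnSr.
have -> : iteri (nth 0 pl jl) (fun j acc => ev (Ite (Lt (Var 2) (Var 1))
         (App (divF jN jb) [:: Var 3; Par jb]) (Var 3)) (rcons (rcons [:: x; i] j) acc))
         (ev (Var 0) [:: x; i]) = x %/ y ^ i.
  rewrite evE /= -itE -(iteri_iter_le _ _ il).
  move: {il}(nth 0 pl jl) => m.
  have le m' : iteri m' (fun j a => if j < i then a %/ y else a) x <= x.
    by elim: m' => //= m' IH; case: ifP => // _; apply: leq_trans (leq_div _ _) IH.
  elim: m => //= m ->; rewrite evIte trLt !evE /=; case: ifP => // _.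
  by rewrite divFP // (leq_trans (le m)).
have xle : x %/ y ^ i <= nth 0 pl jN by apply: leq_trans (leq_div _ _) xj.
rewrite !evE /= mulFP minnn !evE /= divFP // /digit.
by rewrite {1}(divn_eq (x %/ y ^ i) y) addKn.
Qed.

End EvalLemmas.

(** * The terms compute the search *)

Section Spec.
Variable G : sgraph.
Variables (r k b len N p thr t : nat).
Local Notation n := (nverts G).
Local Notation V := 'I_n.
Variable mm : nat -> nat.
Hypothesis mmE : forall u v : V, mm (u * n + v) = adj u v :> nat.
Hypothesis b0 : 0 < b.
Local Notation Nr := (Nr G r).
Local Notation U := (n + Nr).
Let pl := [:: n; k; n.+1; t; len; b; N; p; thr; Nr; U; r].
Local Notation ev := (eval mm pl).
Implicit Types (A B C D E K M Q R S W X Y Z Rest : {set V}) (v : V)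
  (H : {set {set V}}) (st : {set V} * {set {set V}}) (e : seq nat).

Let evE := (@evPar mm pl, @evVar mm pl, @evLit mm pl, @evPlus mm pl, @evMinus mm pl,
  @evRd mm pl, @evIte mm pl, @evLet mm pl, @evApp mm pl).

Lemma pow2FP i : i <= U -> ev pow2F [:: i] = 2 ^ i.
Proof.
move=> iU; rewrite /pow2F -lock evLoop.
transitivity (iteri U (fun j a => if j < i then a + a else a) 1).
  apply: eq_iteri => j a; rewrite evIte trLt !evE /=.
  by case: ifP.
rewrite iteri_iter_le //; elim: i {iU} => //= i ->.
by rewrite addnn -mul2n expnS.
Qed.

Lemma bitFP f i : i < U -> (ev bitF [:: code U f; i] != 0) = f i.
Proof.
move=> iU; rewrite /bitF -lock evLet evLoop.
have -> : iteri (nth 0 pl pU) (fun j acc => ev (Let (Minus (Minus (Par pU) (Lit 1)) (Var 2))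
          (Ite (Lt (Var 1) (Var 4))
             (Let (App pow2F [:: Var 4])
                (Ite (Lt (Var 3) (Var 5)) (Var 3) (Minus (Var 3) (Var 5))))
             (Var 3))) (rcons (rcons [:: code U f; i] j) acc))
         (ev (Var 0) [:: code U f; i]) = code U f %% 2 ^ i.+1.
  rewrite evE /=; set X := code U f.
  (* After [j] iterations the exponents from [U - 1] down to [U - j] have been treated, except those
     of at most [i]; hence the maximum. *)
  suff Hj j : j <= U -> iteri j (fun j acc => ev (Let (Minus (Minus (Par pU) (Lit 1)) (Var 2))
          (Ite (Lt (Var 1) (Var 4))
             (Let (App pow2F [:: Var 4])
                (Ite (Lt (Var 3) (Var 5)) (Var 3) (Minus (Var 3) (Var 5))))
             (Var 3))) [:: X; i; j; acc]) X = X %% 2 ^ maxn (U - j) i.+1.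
    by rewrite Hj // subnn max0n.
  elim: j => [|j IH] jU /=; first by rewrite subn0 (maxn_idPl iU) modn_small ?code_ltn.
  rewrite IH 1?ltnW // evLet evIte trLt !evE /=.
  have Ej : U - j = (U - 1 - j).+1 by lia.
  have Ej' : U - j.+1 = U - 1 - j by lia.
  rewrite Ej Ej'; set d := U - 1 - j.
  case: ltnP => id; last by congr (_ %% 2 ^ _); lia.
  rewrite trLt !evE /= pow2FP; last by lia.
  rewrite (maxn_idPl (leqW id)) (maxn_idPl id).
  by rewrite [RHS]modn_pow2S.
rewrite trNot trLt !evE /= !evE /= pow2FP -?leqNgt; last exact: ltnW.
exact: code_bit.
Qed.

Definition chi A (i : nat) : bool := [exists v : V, (v \in A) && (val v == i)].
Definition cs A : nat := code U (chi A).

Lemma chiE A v : chi A v = (v \in A).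
Proof.
apply/existsP/idP => [[u /andP[uA /eqP/val_inj <-]] //|vA].
by exists v; rewrite vA eqxx.
Qed.

Lemma chi_out A i : n <= i -> chi A i = false.
Proof.
move=> ni; apply/negbTE/existsP => -[v /andP[_ /eqP E]].
by move: (ltn_ord v); rewrite ltnNge E ni.
Qed.

Lemma cs_inj : injective cs.
Proof.
move=> A B /code_inj E; apply/setP => v.
by rewrite -!chiE E // (leq_trans (ltn_ord v)) ?leq_addr.
Qed.

Lemma cs0 : cs set0 = 0.
Proof.
rewrite /cs /code big1 // => i _; rewrite (_ : chi _ _ = false) //.
by apply/negbTE/existsP => -[v]; rewrite inE.
Qed.

Lemma ltnU v : v < U. Proof. by rewrite (leq_trans (ltn_ord v)) ?leq_addr. Qed.

Lemma trBit A v x y e : ev x e = cs A -> ev y e = val v ->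
  (ev (Bit x y) e != 0) = (v \in A).
Proof. by rewrite /Bit -lock evApp /= => -> ->; rewrite bitFP ?chiE ?ltnU. Qed.

Lemma MkP (phi : tm) A d e : size e = d ->
  (forall v, (ev phi (rcons e v) != 0) = (v \in A)) -> ev (Mk pn d phi) e = cs A.
Proof.
move=> sz E; rewrite /Mk -lock evSum /cs (@code_widen n) ?leq_addr //; last first.
  by move=> i ni _; rewrite chi_out.
apply: eq_bigr => v _; rewrite evIte E chiE !evE /= !evE nth_rcons sz ltnn eqxx.
by rewrite pow2FP ?(ltnW (ltnU v)) //; case: (v \in A); rewrite ?mul1n.
Qed.

Lemma MkUP (phi : tm) f d e : size e = d ->
  (forall i, i < U -> (ev phi (rcons e i) != 0) = f i) -> ev (Mk pU d phi) e = code U f.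
Proof.
move=> sz E; rewrite /Mk -lock evSum; apply: eq_bigr => i _.
rewrite evIte E // !evE /= !evE nth_rcons sz ltnn eqxx.
by rewrite pow2FP ?(ltnW (ltn_ord i)) //; case: (f i); rewrite ?mul1n.
Qed.

Lemma sum_IndP (phi : tm) A e :
  (forall v, (ev phi (rcons e v) != 0) = (v \in A)) -> ev (Sum pn (Ind phi)) e = #|A|.
Proof.
move=> E; rewrite evSum -sum1_card [RHS]big_mkcond /=; apply: eq_bigr => v _.
by rewrite trInd E; case: (v \in A).
Qed.

Lemma rankFP M v : ev rankF [:: cs M; val v] = rank M v.
Proof.
rewrite /rankF -lock; apply: sum_IndP => u.
by rewrite trAnd trLt (@trBit M u) // inE andbC.
Qed.

Lemma decFP jb jl jN M x : 0 < nth 0 pl jb -> x <= nth 0 pl jN ->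
  ev (decF jb jl jN) [:: cs M; x] = cs (decode (nth 0 pl jb) (nth 0 pl jl) M x).
Proof.
move=> y0 xj; rewrite /decF -lock; apply: MkP => // v.
rewrite trAnd (@trBit M v) // inE; congr andb.
rewrite trSum; apply: eq_existsb => i; rewrite trEq !evE /= !evE /=.
by rewrite rankFP digFP // ltnW.
Qed.

Lemma dvFP c : c <= Nr -> ev dvF [:: c] = cs (dv G r c).
Proof.
move=> cN; rewrite /dvF -lock evApp /= evE /=.
rewrite (@MkP _ setT) // => [|v]; last by rewrite evE inE.
by rewrite (@decFP pn1 pr pNr).
Qed.

Lemma dmFP M x : x <= N -> ev dmF [:: cs M; x] = cs (dm b len M x).
Proof. by move=> xN; rewrite /dmF -lock (@decFP pb plen pN). Qed.

Lemma unionFP A B : ev unionF [:: cs A; cs B] = cs (A :|: B).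
Proof.
by rewrite /unionF -lock; apply: MkP => // v; rewrite trOr (@trBit A v) // (@trBit B v) // inE. Qed.

Lemma diffFP A B : ev diffF [:: cs A; cs B] = cs (A :\: B).
Proof.
rewrite /diffF -lock; apply: MkP => // v.
by rewrite trAnd trNot (@trBit A v) // (@trBit B v) // inE andbC.
Qed.

Lemma cardFP A : ev cardF [:: cs A] = #|A|.
Proof. by rewrite /cardF -lock; apply: sum_IndP => v; rewrite (@trBit A v). Qed.

Lemma subFP A B : (ev subF [:: cs A; cs B] != 0) = (A \subset B).
Proof.
rewrite /subF -lock trNot trSum; apply/negP/subsetP => [H u uA|sAB /existsP[u]].
  apply/negPn/negP => uB; apply: H; apply/existsP; exists u.
  by rewrite trAnd trNot (@trBit A u) // (@trBit B u) // uA.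
by rewrite trAnd trNot (@trBit A u) // (@trBit B u) // => /andP[/sAB ->].
Qed.

Lemma disjFP A B : (ev disjF [:: cs A; cs B] != 0) = [disjoint A & B].
Proof.
rewrite /disjF -lock trNot trSum -setI_eq0; apply/negP/eqP => [H|AB /existsP[u]].
  apply/setP => u; rewrite !inE; apply/negP => uAB; apply: H; apply/existsP; exists u.
  by rewrite trAnd (@trBit A u) // (@trBit B u).
by rewrite trAnd (@trBit A u) // (@trBit B u) // -in_setI AB inE.
Qed.

Lemma adjFP (u v : V) : (ev adjF [:: val u; val v] != 0) = adj u v.
Proof. by rewrite /adjF -lock !evE /= mulFP !evE /= minnn mmE; case: adj. Qed.

Lemma cliqueFP A : (ev cliqueF [:: cs A] != 0) = is_clique A.
Proof.
rewrite /cliqueF -lock trNot trSum; apply/negP/'forall_implyP => [H u uA|cA /existsP[u]].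
  apply/'forall_implyP => w wA; apply/implyP => uw; apply/negPn/negP => nad.
  apply: H; apply/existsP; exists u; rewrite trAnd (@trBit A u) // uA /=.
  rewrite trSum; apply/existsP; exists w; rewrite trAnd (@trBit A w) // wA /=.
  by rewrite trAnd !trNot trEq !evE /= !evE adjFP nad andbT.
rewrite trAnd (@trBit A u) // => /andP[/cA/'forall_implyP cu].
rewrite trSum => /existsP[w]; rewrite trAnd (@trBit A w) // => /andP[/cu cuw].
rewrite trAnd !trNot trEq !evE /= !evE adjFP.
by move: cuw; rewrite -val_eqE; case: (_ == _) => //= ->.
Qed.

Lemma packFP B C : ev packF [:: cs B; cs C] = cs (pack r B C).
Proof.
rewrite /packF -lock evLoop evLit -[X in iteri _ _ X]cs0; apply: iteri_enc => c acc cN.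
rewrite !evLet evIte !trAnd trEq !evE /= !evE /= dvFP ?(ltnW cN) // !unionFP.
by rewrite cliqueFP cardFP disjFP /pack_step; case: ifP.
Qed.

Lemma delFP M R : ev delF [:: cs M; cs R] = cs (del b len N p M R).
Proof.
rewrite /delF -lock evLoop evLit -[X in iteri _ _ X]cs0; apply: iteri_enc => y D yN.
rewrite !evLet evIte !trAnd trEq !evE /= !evE /= dmFP ?(ltnW yN) //.
by rewrite cliqueFP cardFP disjFP diffFP unionFP /del_step; case: ifP.
Qed.

Lemma freshFP c : c < Nr -> (ev freshF [:: c] != 0) = fresh G r c.
Proof.
move=> cN; rewrite /freshF -lock trNot trSumI /fresh; congr negb.
apply: eq_in_has => c'; rewrite mem_iota add0n => /= c'N.
rewrite trAnd trLt trEq !evE /= !evE /= !dvFP ?(ltnW cN) ?(ltnW c'N) //.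
by rewrite (inj_eq cs_inj).
Qed.

(* Bits below [n] encode the kernel, bit [n + c] the set with code [c]. *)
Definition stc st : nat :=
  code U (fun i => if i < n then chi st.1 i else dv G r (i - n) \in st.2).

Lemma stc0 M : stc (M, set0) = cs M.
Proof.
apply: eq_code => i _ /=; rewrite inE; case: ltnP => // ni.
by rewrite chi_out.
Qed.

Lemma trBitSt st v x y e : ev x e = stc st -> ev y e = val v ->
  (ev (Bit x y) e != 0) = (v \in st.1).
Proof. by rewrite /Bit -lock evApp /= => -> ->; rewrite bitFP ?ltn_ord ?chiE ?ltnU. Qed.

Lemma trBitStH st c x y e : c < Nr -> ev x e = stc st -> ev y e = n + c ->
  (ev (Bit x y) e != 0) = (dv G r c \in st.2).
Proof.
move=> cN; rewrite /Bit -lock evApp /= => -> ->; rewrite bitFP ?ltn_add2l //.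
by rewrite ltnNge leq_addr /= addKn.
Qed.

Lemma getFP st : ev getF [:: stc st] = cs st.1.
Proof. by rewrite /getF -lock; apply: MkP => // v; rewrite (@trBitSt st v). Qed.

Lemma insFP M H C : ev insF [:: stc (M, H); cs C] = stc (M, C |: H).
Proof.
rewrite /insF -lock; apply: MkUP => // i iU; rewrite trOr trAnd trNot trLt trEq.
rewrite !evE /= !evE /= /Bit -lock !evE /= bitFP //= evVar /=.
case: ltnP => ni /=; first by rewrite orbF.
by rewrite dvFP ?leq_subLR ?(ltnW iU) // (inj_eq cs_inj) in_setU1 orbC.
Qed.

Lemma addFP M H X : ev addF [:: stc (M, H); cs X] = stc (M :|: X, H).
Proof.
rewrite /addF -lock; apply: MkUP => // i iU; rewrite trOr /Bit -!lock !evE /= !evE.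
rewrite !bitFP //=; case: ltnP => ni; last by rewrite chi_out // orbF.
by rewrite -[i]/(val (Ordinal ni)) !chiE inE.
Qed.

Lemma roundFP D R st :
  ev roundF [:: cs D; cs R; stc st] = stc (round r thr D R st).
Proof.
rewrite /roundF -lock evLet evLoop /=.
rewrite !evE /= !evE /= getFP; apply: iteri_enc => c st' cN.
rewrite evLet evIte !trAnd !trLt !evE /= !evE /= dvFP ?(ltnW cN) //.
rewrite freshFP // cliqueFP cardFP subFP disjFP trAnd !trNot trLt.
do 3?rewrite !evE /=.
rewrite getFP unionFP packFP cardFP subFP -leqNgt /round_step /branchable.
case: st' => M H /=; case: ifP => // _; case: ifP => _; first exact: insFP.
exact: addFP.
Qed.

Lemma goodFP M H W A : (ev goodF [:: stc (M, H); cs W; cs A] != 0) = good r H W A.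
Proof.
rewrite /goodF -lock trNot trSumI /good -all_predC.
apply: eq_in_all => c; rewrite mem_iota add0n => /= cN.
rewrite evLet !trAnd trOr trEq (@trBitStH (M, H) c) // !evE /= !evE /= dvFP ?(ltnW cN) //.
by rewrite cliqueFP subFP cardFP disjFP implybE -negb_and.
Qed.

Lemma compFP Rest v : ev compF [:: cs Rest; val v] = cs (component Rest v).
Proof.
rewrite /compF -lock evLoop evLit -[X in iteri _ _ X]cs0.
transitivity (cs (foldl (fun acc _ => comp_step Rest v acc) set0 (iota 0 n))).
  apply: iteri_enc => i acc _; apply: MkP => // u.
  rewrite trOr trAnd trEq (@trBit Rest u) // trSum inE; congr orb; congr andb.
  apply: eq_existsb => w; rewrite trAnd (@trBit acc w) // !evE /= !evE /=.
  by rewrite adjFP.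
by rewrite foldl_iota.
Qed.

Lemma rootFP Rest v : (ev rootF [:: cs Rest; val v] != 0) = is_root Rest v.
Proof.
rewrite /rootF -lock evLet !evE /= !evE compFP trAnd trNot (@trBit Rest v) //.
rewrite /is_root; congr andb; rewrite trSum negb_exists; apply: eq_forallb => u.
by rewrite trAnd trLt (@trBit (component Rest v) u) // negb_and implybE.
Qed.

Lemma minFP M H X Z K :
  ev minF [:: stc (M, H); cs X; cs Z; cs K] = minsol r k b len N H X Z K.
Proof.
rewrite /minF -lock evLoop !evE /= addn1 /minsol.
(* The accumulator is already a number, so the encoding is the identity. *)
rewrite -[RHS]/(id _) -[X in iteri _ _ X]/(id k.+1); apply: iteri_enc => y m yN.
rewrite evLet evIte trAnd trLt !evE /= !evE /= dmFP ?(ltnW yN) // !unionFP goodFP cardFP.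
by rewrite /min_step; case: ifP.
Qed.

Lemma checkFP M H D M' X Z :
  (ev checkF [:: cs D; stc (M, H); cs M'; cs X; cs Z] != 0) =
  final_check r k b len N D H M' X Z.
Proof.
rewrite /checkF -lock evLet !evE /= !evE diffFP trAnd trNot trLt !evE /= !evE /=.
rewrite goodFP !cardFP -leqNgt /final_check; congr (_ && (_ + _ <= _)).
rewrite evSum [RHS]big_mkcond /=; apply: eq_bigr => v _.
rewrite !evE /= !evE rootFP; case: ifP => // _.
by rewrite /= !evE compFP minFP.
Qed.

Lemma finalFP D st : (ev finalF [:: cs D; stc st] != 0) = final r k b len N D st.
Proof.
case: st => M H.
rewrite /finalF -lock evLet !evE /= !evE /= !evE getFP diffFP trSumI /final /=.
apply: eq_in_has => z; rewrite mem_iota add0n => /= zN.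
rewrite trSumI; apply: eq_in_has => x; rewrite mem_iota add0n => /= xN.
do 3?rewrite !evE /=.
by rewrite !dmFP ?(ltnW zN) ?(ltnW xN) // checkFP.
Qed.

Lemma searchFP i D st :
  (ev (searchF i) [:: cs D; stc st] != 0) = search r k b len N thr i D st.
Proof.
elim: i st => [|i IH] st /=; first exact: finalFP.
rewrite evLet !evE /= !evE getFP trSumI; apply: eq_in_has => x.
rewrite mem_iota add0n => /= xN.
do 3?rewrite !evE /=.
by rewrite dmFP ?(ltnW xN) // roundFP IH.
Qed.

Lemma mainFP : (ev (mainF r) [::] != 0) = accept G r k b len N p thr.
Proof.
have E0 : ev packF [:: 0; 0] = cs (pack r set0 set0) by rewrite -packFP cs0.
rewrite /mainF -lock evLet !evE /= !evE E0 trSumI /accept.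
apply: eq_in_has => x; rewrite mem_iota add0n => /= xN.
do 3?rewrite !evE /=.
by rewrite dmFP ?(ltnW xN) // delFP -[cs (pack _ _ _)]stc0 searchFP.
Qed.

End Spec.

(** * Separators from tree decompositions *)

Section TreeAvoid.
Variables (T : finType) (e : rel T).
Hypothesis eT : is_tree e.

Definition avoid (t : T) : rel T := [rel a b | [&& e a b, a != t & b != t]].

Lemma avoid_sym t : connect_sym (avoid t).
Proof.
case: eT => es _ _ _ _; apply: sym_connect_sym => a b.
by rewrite /avoid /= es; congr andb; rewrite andbC.
Qed.

Lemma connect_first (e' : rel T) s x : connect e' s x -> s != x ->
  exists2 u, e' s u & connect [rel a b | [&& e' a b, a != s & b != s]] u x.
Proof.
case/connectP => q0 pq0 ->; case/shortenP: pq0 => -[|u q] /=; first by rewrite eqxx.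
case/andP => esu pq /andP[sq _] _ _; exists u => //; apply/connectP; exists q => //.
have {sq} : s \notin u :: q by [].
elim: q u {esu} pq => //= v q IH u /andP[euv pq]; rewrite inE negb_or => /andP[su sq].
rewrite euv eq_sym su /= IH // andbT; move: sq; rewrite inE negb_or eq_sym.
by case/andP.
Qed.

(** Otherwise [t] closes a path from [u] to [u'] into a cycle of length at least 3. *)
Lemma tree_neighbour_unique t u u' : e t u -> e t u' ->
  connect (avoid t) u u' -> u = u'.
Proof.
case: eT => es ei _ _ ec tu tu' /connectP[q0 pq0]; case/shortenP: pq0 => q pq uq _ Eu'.
have sub : subrel (avoid t) e by move=> a b /and3P[].
have tq : t \notin u :: q.
  have tu0 : t != u by apply/eqP => E; move: tu; rewrite E ei.
  move: tu0 pq; clear uq Eu' tu; elim: q u => [|v q IH] u tu0 /=; first by rewrite inE.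
  case/andP => /and3P[_ _ vt] /(IH v); rewrite eq_sym => /(_ vt) H.
  by rewrite inE negb_or tu0.
case: q => [|v q] in pq uq Eu' tq *; first by rewrite Eu'.
suff : ucycle e (t :: u :: v :: q) by move/ec.
rewrite /ucycle /= tu; apply/andP; split; last exact/andP.
have := sub_path sub pq; rewrite /= => /andP[-> pv].
by rewrite rcons_path pv es; move: tu'; rewrite Eu' /= => ->.
Qed.

(** Every node on a walk from [s] that avoids [t] is itself reachable in this way, hence is not
    [u]. *)
Lemma connect_avoid s t u x :
  connect (avoid t) s x -> ~~ connect (avoid t) s u -> connect (avoid u) s x.
Proof.
case/connectP => q pq -> nu.
have H : forall y, connect (avoid t) s y -> path (avoid t) y q -> path (avoid u) y q.
  elim: q {pq} => //= z q IH y sy /andP[yz pz].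
  have sz : connect (avoid t) s z by apply: connect_trans sy (connect1 yz).
  rewrite IH // andbT /avoid /=; case/and3P: yz => -> _ _ /=.
  by apply/andP; split; apply: contraNneq nu => <-.
by apply/connectP; exists q => //; apply: H.
Qed.

Variable r0 : T.

(** The subtree hanging at [t] when the tree is rooted at [r0]. *)
Definition below (t : T) : {set T} := [set x | (x == t) || ~~ connect (avoid t) r0 x].

Lemma below_root x : x \in below r0.
Proof.
rewrite inE; case: eqP => //= /eqP xr; apply/negP => c.
by have [|u /and3P[_ /eqP]] := connect_first c; first by rewrite eq_sym.
Qed.

Lemma below_connect t a x : a \in below t -> a != t -> connect (avoid t) a x ->
  (x != t) && (x \in below t).
Proof.
rewrite !inE => /orP[/eqP->|na]; first by rewrite eqxx.
move=> at_ ax; have nx : ~~ connect (avoid t) r0 x.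
  by apply: contra na => rx; apply: connect_trans rx _; rewrite avoid_sym.
rewrite nx orbT andbT; case/connectP: ax => q; case/lastP: q => [_ -> //|q z].
by rewrite rcons_path last_rcons => /andP[_ /and3P[_ _ zt]] ->.
Qed.

(* The part of the tree hanging off [t] that contains [a] is cut off by the
   neighbour [u] of [t]. *)
Lemma below_child t a : a \in below t -> a != t -> exists u,
  below u \proper below t /\ forall x, connect (avoid t) a x -> x \in below u.
Proof.
case: (eT) => es ei _ ecn _ ab at_; have [|u tu ua] := connect_first (ecn t a).
  by rewrite eq_sym.
rewrite -/(avoid t) in ua.
have [ut ub] : (u != t) /\ (u \in below t).
  by apply/andP/(below_connect ab at_); rewrite avoid_sym.
have nu : ~~ connect (avoid t) r0 u by move: ub; rewrite inE (negbTE ut).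
exists u; split.
  apply/properP; split.
    apply/subsetP => x; rewrite !inE => xb; apply/negPn; rewrite negb_or negbK.
    apply/negP => /andP[xt rx]; case/orP: xb => [/eqP E|]; first by rewrite -E rx in nu.
    by rewrite (connect_avoid rx nu).
  exists t; first by rewrite inE eqxx.
  rewrite inE negb_or negbK eq_sym ut /=.
  case: (eqVneq r0 t) => [->|rt]; first exact: connect0.
  have := ecn t r0; move/connect_first => /(_ ltac:(by rewrite eq_sym)) [w tw wr].
  rewrite -/(avoid t) in wr.
  have rw : connect (avoid t) r0 w by rewrite avoid_sym.
  apply: connect_trans (connect_avoid rw nu) (connect1 _).
  rewrite /avoid /= es tw (eq_sym t u) ut andbT /=.
  by apply: contraNneq nu => <-.
move=> x ax; have [xt xb] := andP (below_connect ab at_ ax).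
rewrite inE; apply/negPn; rewrite negb_or negbK; apply/negP => /andP[xu rx].
have nx : ~~ connect (avoid t) r0 x by move: xb; rewrite inE (negbTE xt).
(* Otherwise [r0] does not reach [t] off [u], and then its walk to [x] off [u] avoids [t] as
   well. *)
have tx : connect (avoid u) t x.
  apply/negPn/negP => ntx.
  have : ~~ connect (avoid u) r0 t.
    by apply: contra ntx => rt; rewrite avoid_sym in rt; apply: connect_trans rt rx.
  by move/(connect_avoid rx); rewrite (negbTE nx).
have [|u' /and3P[tu' _ u'u] u'x] := connect_first tx; first by rewrite eq_sym.
have u'x' : connect (avoid t) u' x.
  apply: connect_sub u'x => y z /and3P[/and3P[yz _ _] yt zt].
  by apply: connect1; rewrite /avoid /= yz yt.
(* [u'] and [u] are neighbours of [t] in the same part of the tree without [t], hence equal; but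
   [u'] was chosen different from [u]. *)
move: u'u; rewrite (@tree_neighbour_unique t u' u) ?eqxx //.
by apply: connect_trans u'x' _; rewrite avoid_sym; apply: connect_trans ua ax.
Qed.

End TreeAvoid.

Section Separator.
Variables (G : sgraph) (T : finType) (e : rel T) (B : T -> {set 'I_(nverts G)}).
Variables (w s : nat).
Local Notation V := 'I_(nverts G).
Implicit Types A Z : {set V}.
Hypothesis eT : is_tree e.
Hypothesis Bw : forall t, #|B t| <= w.+1.

(** The axioms are relative to [A], so one tree with one family of bags serves all the subsets met
    in the recursion. *)
Definition decomposes A : Prop :=
  [/\ forall v, v \in A -> exists t, v \in B t,
      forall u v, u \in A -> v \in A -> adj u v -> exists t, (u \in B t) && (v \in B t)
    & forall v a b, v \in A -> v \in B a -> v \in B b ->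
        connect [rel a b | [&& e a b, v \in B a & v \in B b]] a b].

Definition small_components A : Prop :=
  forall v, v \in A -> #|[set u | connect (rest_rel A) v u]| <= s.

Lemma rest_connect A v u : v \in A -> connect (rest_rel A) v u -> u \in A.
Proof.
move=> vA /connectP[q]; case/lastP: q => [_ -> //|q x].
by rewrite rcons_path last_rcons => /andP[_ /and3P[_ xA _]] ->.
Qed.

Lemma small_componentsU A1 A2 : small_components A1 -> small_components A2 ->
  (forall u v, u \in A1 -> v \in A2 -> ~~ adj u v) -> small_components (A1 :|: A2).
Proof.
have half A A' : small_components A -> (forall u v, u \in A -> v \in A' -> ~~ adj u v) ->
    forall v, v \in A -> #|[set u | connect (rest_rel (A :|: A')) v u]| <= s.
  move=> sA nA v vA; apply: leq_trans (sA v vA); apply: subset_leq_card.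
  apply/subsetP => u; rewrite !inE => /connectP[q]; elim/last_ind: q u => [|q x IH] u.
    by move=> _ ->; apply: connect0.
  rewrite rcons_path last_rcons => /andP[/IH/(_ erefl) vl /and3P[_ xA lx]] ->.
  have lA := rest_connect vA vl; apply: connect_trans vl (connect1 _).
  rewrite /rest_rel /= lA lx andbT /=; move: xA; rewrite inE => /orP[//|xA'].
  by move: (nA _ _ lA xA'); rewrite lx.
move=> s1 s2 n12 v; rewrite inE => /orP[vA|vA]; first exact: half.
rewrite setUC; apply: half => // u u' uA uA'; rewrite adj_sym; exact: n12.
Qed.

Lemma decomposes_sub A A' : A' \subset A -> decomposes A -> decomposes A'.
Proof.
move=> /subsetP sub [H1 H2 H3]; split=> [v /sub|u v /sub uA /sub|v a b /sub].
- exact: H1.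
- exact: H2.
- exact: H3.
Qed.

(** Call a node heavy if the bags of its subtree hold more than [s] vertices of [A], and let [t] be
    a heavy node with smallest subtree. Its bag gives [Z]; what else lies below it is [A1], whose
    components lie below children of [t], and these are not heavy. The remainder [A2] lost more than
    [s] vertices as [t] is heavy. *)
Lemma cut_lowest A : decomposes A -> s < #|A| -> exists A1 A2 Z,
  [/\ A = Z :|: (A1 :|: A2) /\ #|Z| <= w.+1, [disjoint Z & A1 :|: A2],
      small_components A1, forall u v, u \in A1 -> v \in A2 -> ~~ adj u v
    & A2 \subset A /\ #|A2| + s < #|A|].
Proof.
move=> [Hv He Hc] sA.
have [r0 _] : exists r0 : T, r0 \in T.
  by case: eT => _ _ T0 _ _; case/card_gt0P: T0 => r0 r0T; exists r0.
pose L t := A :&: \bigcup_(x in below e r0 t) B x.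
have LP t v : reflect (exists x, [/\ v \in A, x \in below e r0 t & v \in B x]) (v \in L t).
  rewrite inE; apply: (iffP andP) => [[vA /bigcupP[x xt vx]]|[x [vA xt vx]]].
    by exists x.
  by split=> //; apply/bigcupP; exists x.
have LA t : L t \subset A by apply: subsetIl.
have heavy0 : s < #|L r0|.
  apply: leq_trans sA _; apply: subset_leq_card; apply/subsetP => v vA.
  have [t vt] := Hv v vA; apply/LP; exists t; split=> //; exact: below_root.
case: (@arg_minnP _ r0 (fun t => s < #|L t|) (fun t => #|below e r0 t|) heavy0).
move=> t ht least.
have avoidP v a b : v \in A -> v \notin B t -> v \in B a -> v \in B b ->
    connect (avoid e t) a b.
  move=> vA vt va vb; apply: connect_sub (Hc v a b vA va vb) => x y /and3P[xy vx vy].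
  apply: connect1; rewrite /avoid /= xy /=; apply/andP; split.
    by apply/eqP => E; rewrite E (negbTE vt) in vx.
  by apply/eqP => E; rewrite E (negbTE vt) in vy.
have neqt v a : v \in B a -> v \notin B t -> a != t.
  by move=> va vt; apply/eqP => E; rewrite E (negbTE vt) in va.
exists (L t :\: B t), (A :\: L t), (A :&: B t); split.
- split; last by apply: leq_trans (Bw t); apply: subset_leq_card; apply: subsetIr.
  apply/setP => v; rewrite in_setU in_setI in_setU !in_setD.
  case: (boolP (v \in A)) => vA /=; last first.
    by rewrite andbF orbF; apply/esym/negP => /andP[_ /(subsetP (LA t))]; apply/negP.
  by case: (v \in B t); case: (v \in L t).
- rewrite -setI_eq0; apply/eqP/setP => v; rewrite in_setI in_setU !in_setD in_set0 in_setI.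
  apply/negP => /andP[/andP[vA vt]]; rewrite vt /= vA andbT => /LP; apply.
  by exists t; split=> //; rewrite inE eqxx.
- move=> v; rewrite in_setD => /andP[vt /LP[a [vA ab va]]].
  have [u [ltu Hu]] := below_child eT ab (neqt v a va vt).
  apply/negPn/negP; rewrite -ltnNge => big.
  suff : s < #|L u| by move/least; rewrite leqNgt proper_card.
  apply: leq_trans big _; apply: subset_leq_card; apply/subsetP => x; rewrite inE => vx.
  have vL : v \in L t :\: B t by rewrite in_setD vt; apply/LP; exists a.
  have xL := rest_connect vL vx.
  move: (xL); rewrite in_setD => /andP[xt /LP[c [xA _ xc]]].
  apply/LP; exists c; split=> //; apply: Hu.
  (* Along a path in [A1] the bags stay in one part of the tree without [t]: consecutive vertices
     share a bag, and none of them lies in the bag of [t]. *)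
  case/connectP: vx => q; elim/last_ind: q x c xt xA xc {xL} => [|q y IH] x c xt xA xc.
    by move=> _ Ex; rewrite Ex in xA xt xc; apply: (avoidP v).
  rewrite rcons_path last_rcons => /andP[pq lx] Ex; rewrite -Ex in lx.
  case/and3P: lx => lL xL ladj.
  move: lL; rewrite in_setD => /andP[lt' /LP[d [lA _ _]]].
  have [f /andP[lf xf]] := He _ _ lA xA ladj.
  exact: connect_trans (IH _ f lt' lA lf pq erefl) (avoidP x f c xA xt xf xc).
- move=> u v; rewrite !in_setD => /andP[ut /LP[a [uA ab ua]]] /andP[vL vA].
  apply/negP => uv; have [f /andP[uf vf]] := He _ _ uA vA uv.
  case/negP: vL; apply/LP; exists f; split=> //.
  by have /andP[] := below_connect eT ab (neqt u a ua ut) (avoidP u a f uA ut ua uf).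
- split; first exact: subsetDl.
  have := cardsID (L t) A; rewrite (setIidPr (LA t)) => <-.
  by rewrite addnC ltn_add2r.
Qed.

(** Each cut adds at most [w.+1] vertices to [Z] and removes more than [s] from what is left, so
    there are at most [#|A| / s] cuts. *)
Lemma separator_exists A : decomposes A -> exists Z,
  [/\ Z \subset A, #|Z| * s <= w.+1 * #|A| & small_components (A :\: Z)].
Proof.
have [m] := ubnP #|A|; elim: m A => // m IH A; rewrite ltnS => Am HA.
case: (leqP #|A| s) => [le|lt].
  exists set0; rewrite sub0set cards0 mul0n setD0; split=> // v vA.
  apply: leq_trans le; apply: subset_leq_card; apply/subsetP => u; rewrite inE.
  exact: rest_connect.
have [A1 [A2 [Z1 [[EA Z1w] dZ s1 n12 [A2A lt2]]]]] := cut_lowest HA lt.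
have [||Z2 [Z2A Z2s s2]] := IH A2; first by lia.
  exact: decomposes_sub HA.
exists (Z1 :|: Z2); split.
- rewrite subUset (subset_trans Z2A A2A) andbT EA; exact: subsetUl.
- apply: leq_trans (leq_mul (leq_card_setU _ _) (leqnn s)) _; rewrite mulnDl.
  apply: leq_trans (leq_add (leq_mul Z1w (leqnn s)) Z2s) _.
  by rewrite -mulnDr leq_mul2l addnC ltnW ?orbT.
- have sub : A :\: (Z1 :|: Z2) \subset A1 :|: (A2 :\: Z2).
    apply/subsetP => v; rewrite EA !inE negb_or => /andP[/andP[v1 v2]].
    by rewrite (negbTE v1) v2.
  have sU : small_components (A1 :|: (A2 :\: Z2)).
    apply: small_componentsU => // u v uA; rewrite in_setD => /andP[_]; exact: n12.
  move=> v vA; apply: leq_trans (sU v (subsetP sub v vA)); apply: subset_leq_card.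
  apply/subsetP => u; rewrite !inE; apply: connect_sub => x y /and3P[xA yA xy].
  by apply: connect1; rewrite /rest_rel /= (subsetP sub x xA) (subsetP sub y yA).
Qed.

End Separator.

(** * Induced subgraphs as graphs of the class *)

Section Induced.
Variables (G : sgraph) (A : {set 'I_(nverts G)}).
Local Notation V := 'I_(nverts G).

Definition induced : sgraph :=
  @SGraph #|A| [rel x y | adj (enum_val x : V) (enum_val y)]
    (fun x y => adj_sym (enum_val x) (enum_val y))
    (fun x => adj_irrefl (enum_val x)).

Local Notation emb := (fun x : 'I_(nverts induced) => enum_val x : V).

Lemma emb_inj : injective emb.
Proof. exact: enum_val_inj. Qed.

Lemma induced_subP : induced_subgraph induced G.
Proof. by exists emb; split=> //; apply: emb_inj. Qed.

Lemma emb_onto v : v \in A -> exists x : 'I_(nverts induced), emb x = v.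
Proof. by move=> vA; exists (enum_rank_in vA v); rewrite enum_rankK_in. Qed.

Lemma emb_preim (C : {set V}) : C \subset A -> emb @: (emb @^-1: C) = C.
Proof.
move=> CA; apply/setP => v; apply/imsetP/idP => [[x]|vC]; first by rewrite inE => xC ->.
by have [x xv] := emb_onto (subsetP CA v vC); exists x; rewrite ?inE xv.
Qed.

Lemma clique_emb (C : {set 'I_(nverts induced)}) : is_clique C = is_clique (emb @: C).
Proof.
apply/'forall_implyP/'forall_implyP => H.
  move=> _ /imsetP[x xC ->]; apply/'forall_implyP => _ /imsetP[y yC ->].
  by rewrite (inj_eq emb_inj); move/'forall_implyP/(_ y yC): (H x xC).
move=> x xC; apply/'forall_implyP => y yC.
move/'forall_implyP/(_ _ (imset_f emb yC)): (H _ (imset_f emb xC)).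
by rewrite (inj_eq emb_inj).
Qed.

Lemma nb_cliques_induced r :
  #|[set C : {set V} | [&& is_clique C, 0 < #|C| < r & C \subset A]]|
    = nb_cliques_lt r induced.
Proof.
rewrite /nb_cliques_lt; have inj : injective (fun C : {set 'I_(nverts induced)} => emb @: C).
  exact: imset_inj emb_inj.
rewrite -(card_imset _ inj); apply: eq_card => C; rewrite inE.
apply/and3P/imsetP => [[cC rC CA]|[C']].
  exists (emb @^-1: C); last by rewrite emb_preim.
  by rewrite inE clique_emb emb_preim // cC -(card_imset _ emb_inj) emb_preim.
rewrite inE clique_emb => /andP[cC rC] ->; split=> //.
  by rewrite (card_imset _ emb_inj).
by apply/subsetP => _ /imsetP[x _ ->]; apply: enum_valP.
Qed.

Lemma clique_number_induced W :
  (forall K, is_clique K -> K \subset A -> #|K| <= W) -> clique_number induced <= W.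
Proof.
move=> HW; apply/bigmax_leqP => C; rewrite clique_emb => cC.
rewrite -(card_imset _ emb_inj); apply: HW => //.
by apply/subsetP => _ /imsetP[x _ ->]; apply: enum_valP.
Qed.

Lemma decomposes_induced w : treewidth induced <= w ->
  exists (T : finType) (e : rel T) (B : T -> {set V}),
    [/\ is_tree e, forall t, #|B t| <= w.+1 & decomposes e B A].
Proof.
rewrite /treewidth; case: ex_minnP => m /asboolP[T [e [B [[eT Hv He Hc] Bm]]]] _ mw.
exists T, e, (fun t => emb @: B t); split=> //.
  move=> t; rewrite (card_imset _ emb_inj).
  have : #|B t| <= \max_(t : T) #|B t| by apply: leq_bigmax.
  move/leq_trans; apply; move: Bm; rewrite /width.
  by case: (\max_(_ | _) _) => // x /= xm; rewrite ltnS (leq_trans xm).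
split.
- by move=> v /emb_onto[x <-]; have [t xt] := Hv x; exists t; apply: imset_f.
- move=> u v /emb_onto[x <-] /emb_onto[y <-] xy.
  by have [t /andP[xt yt]] := He x y xy; exists t; rewrite !imset_f.
- move=> v a b /emb_onto[x <-]; rewrite !(mem_imset _ _ emb_inj) => xa xb.
  apply: connect_sub (Hc x a b xa xb) => c d /and3P[cd xc xd].
  by apply: connect1; rewrite /= !(mem_imset _ _ emb_inj) cd xc xd.
Qed.

End Induced.

Lemma separator_of_treewidth (G : sgraph) (A : {set 'I_(nverts G)}) w s :
  treewidth (induced A) <= w ->
  exists Z : {set 'I_(nverts G)},
    [/\ Z \subset A, #|Z| * s <= w.+1 * #|A| & small_components s (A :\: Z)].
Proof.
by case/decomposes_induced => T [e [B [eT Bw HA]]]; apply: separator_exists eT Bw _ HA.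
Qed.

(** * Completeness of the search *)

Section Completeness.
Variable G : sgraph.
Variables (r k b len N t2 s kap : nat).
Local Notation n := (nverts G).
Local Notation V := 'I_n.
Implicit Types (A B C D E K M Q R W X Y Z acc Rest : {set V}) (v : V)
  (H : {set {set V}}) (st : {set V} * {set {set V}}).
Variable S : {set V}.
Hypothesis Sk : #|S| <= k.
Hypothesis Shit : forall K, is_clique K -> #|K| = r -> ~~ [disjoint K & S].
Hypothesis NE : N = b ^ len.
Hypothesis t20 : 0 < t2.
Local Notation p := (t2 + r).
Local Notation thr := (r * t2).
Hypothesis len_p : p <= len.
Hypothesis len_s : s <= len.
Hypothesis len_k : r * k <= t2 * len.
Local Notation Nr := (Nr G r).
Local Notation dv := (dv G r).
Local Notation dm := (dm b len).

Lemma cardsU_disjoint A B : [disjoint A & B] -> #|A :|: B| = #|A| + #|B|.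
Proof. by move/disjoint_setI0 => AB; rewrite cardsU AB cards0 subn0. Qed.

Lemma subset_card_ex A m : m <= #|A| -> exists2 B : {set V}, B \subset A & #|B| = m.
Proof.
elim: m => [|m IH] mA; first by exists set0; rewrite ?sub0set ?cards0.
have [B BA Bm] := IH (ltnW mA).
have /set0Pn[x] : A :\: B != set0.
  by rewrite -card_gt0 cardsD (setIidPr BA) Bm subn_gt0.
rewrite inE => /andP[xB xA]; exists (x |: B); last by rewrite cardsU1 xB Bm.
by rewrite subUset sub1set xA.
Qed.

(** For [r = 0] the empty clique would have to be hit. *)
Lemma rpos : 0 < r.
Proof.
rewrite lt0n; apply/negP => /eqP r0; have := @Shit set0.
rewrite cards0 r0 -setI_eq0 set0I eqxx => H.
suff : is_clique (set0 : {set V}) by move/H => /(_ erefl).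
by apply/'forall_implyP => x; rewrite inE.
Qed.

Lemma clique_avoiding Q : is_clique Q -> #|Q :\: S| < r.
Proof.
move=> cQ; rewrite ltnNge; apply/negP => /subset_card_ex[K KQ Kr].
have cK : is_clique K by apply: clique_sub cQ; apply: subset_trans KQ (subsetDl _ _).
case/negP: (Shit cK Kr); rewrite disjoints_subset.
by apply: subset_trans KQ _; rewrite setDE subsetIr.
Qed.

Lemma dmP M A : A \subset M -> #|A| <= len -> #|M| < b ->
  exists2 x, x \in iota 0 N & dm M x = A.
Proof.
move=> AM Al Mb; have [x xl xE] := decode_surj AM Al Mb.
by exists x; rewrite // mem_iota NE.
Qed.

(** A member together with [C] is an [r]-clique, which [S] hits outside [C]. So each of the disjoint
    members, of order at most [r], has its own vertex of [S]. *)
Lemma pack_bound B C : [disjoint C & S] ->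
  #|pack r B C| <= r * #|S :&: pack r B C|.
Proof.
move=> dC; rewrite /pack.
have : #|set0 : {set V}| <= r * #|S :&: set0| by rewrite cards0.
elim: (iota 0 Nr) (set0 : {set V}) => //= c l IH acc Hacc; apply: IH.
rewrite /pack_step; case: ifP => // /and3P[cE /eqP sE dE].
have dacc : [disjoint acc & dv c].
  by rewrite disjoint_sym; apply: disjointWr dE; apply: subsetUr.
have d' : [disjoint S :&: acc & S :&: dv c].
  by apply: disjointWl (subsetIr _ _) _; apply: disjointWr (subsetIr _ _) _.
rewrite setIUr !cardsU_disjoint // mulnDr leq_add //.
have le : #|dv c| <= r by have := subset_leq_card (subsetUl (dv c) C); rewrite sE.
apply: leq_trans le (leq_pmulr _ _); rewrite card_gt0.
have := Shit cE sE; rewrite -setI_eq0 => /set0Pn[x].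
rewrite in_setI in_setU => /andP[/orP[xE|xC] xS].
  by apply/set0Pn; exists x; rewrite in_setI xS.
by move: dC; rewrite disjoints_subset => /subsetP/(_ x xC); rewrite inE xS.
Qed.

Local Notation M0 := (pack r (set0 : {set V}) set0).

Lemma card_M0 : #|M0| <= r * k.
Proof.
apply: leq_trans (pack_bound set0 _) _; first by rewrite -setI_eq0 set0I.
rewrite leq_mul2l; apply/orP; right; apply: leq_trans Sk.
by apply: subset_leq_card; apply: subsetIl.
Qed.

(** ** Deleting the large cliques *)

(* The survivors of all the cliques met by the run that keeps exactly the
   vertices outside [S] form one small set [R]; every [R'] between [R] and
   the complement of [S] leads to the same run. *)
Lemma del_ideal M l D0 : D0 \subset S -> exists R : {set V},
  [/\ R \subset M, [disjoint R & S],
      foldl (del_step b len p M (~: S)) D0 l \subset S,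
      t2 * #|R| + r * #|D0| <= r * #|foldl (del_step b len p M (~: S)) D0 l|
    & forall R', R \subset R' -> [disjoint R' & S] ->
        foldl (del_step b len p M R') D0 l = foldl (del_step b len p M (~: S)) D0 l].
Proof.
elim: l D0 => [|y l IH] D0 D0S /=.
  by exists set0; rewrite sub0set cards0 muln0 -setI_eq0 set0I.
have stepE R' : del_step b len p M R' D0 y = if
    [&& is_clique (dm M y), #|dm M y| == p & [disjoint dm M y & D0]]
  then D0 :|: (dm M y :\: R') else D0 by [].
rewrite stepE; case: ifP => [/and3P[cQ /eqP sQ dQ]|ev]; last first.
  have [R [H1 H2 H3 H4 H5]] := IH D0 D0S; exists R; split=> // R' RR' dR'.
  by rewrite stepE ev H5.
set Q := dm M y in cQ sQ dQ *.
have QS : Q :\: ~: S = Q :&: S by rewrite setDE setCK.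
rewrite QS; have [|R [H1 H2 H3 H4 H5]] := IH (D0 :|: (Q :&: S)).
  by rewrite subUset D0S subsetIr.
exists ((Q :\: S) :|: R); split=> //.
- by rewrite subUset H1 andbT; apply: subset_trans (subsetDl _ _) (decode_sub _ _ _ _).
- rewrite -setI_eq0 setIUl setU_eq0 !setI_eq0 H2 andbT disjoints_subset.
  by rewrite setDE subsetIr.
- have d' : [disjoint D0 & Q :&: S].
    by rewrite disjoint_sym; apply: disjointWl dQ; apply: subsetIl.
  move: H4; rewrite cardsU_disjoint // => H4.
  have h1 := clique_avoiding cQ.
  have h2 : #|Q :&: S| + #|Q :\: S| = t2 + r by rewrite cardsID.
  have h3 : #|(Q :\: S) :|: R| <= #|Q :\: S| + #|R| by apply: leq_card_setU.
  (* Fewer than [r] of the [t2 + r] vertices of [Q] survive, so at least [t2] of them lie in [S]. *)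
  have h4 : t2 * #|Q :\: S| <= r * #|Q :&: S|.
    apply: leq_trans (leq_mul (leqnn _) (ltnW h1)) _.
    rewrite mulnC leq_mul2l; apply/orP; right.
    by rewrite -(leq_add2r #|Q :\: S|) h2 leq_add2l ltnW.
  have h5 : t2 * #|(Q :\: S) :|: R| <= t2 * #|Q :\: S| + t2 * #|R|.
    by rewrite -mulnDr leq_mul2l h3 orbT.
  move: H4; rewrite mulnDr addnA; apply: leq_trans.
  apply: leq_trans (leq_add h5 (leqnn _)) _; by rewrite [t2 * #|_| + _]addnC addnAC leq_add2l.
- move=> R'; rewrite subUset => /andP[QR' RR'] dR'.
  have -> : del_step b len p M R' D0 y = D0 :|: (Q :&: S).
    rewrite stepE cQ sQ eqxx dQ /=; congr setU; apply/setP => x.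
    rewrite in_setD in_setI; case: (boolP (x \in Q)) => xQ; rewrite ?andbF ?andbT //=.
    case: (boolP (x \in S)) => xS; last by rewrite (subsetP QR') // in_setD xS.
    apply/negP => xR; move: dR'; rewrite disjoints_subset => /subsetP/(_ x xR).
    by rewrite in_setC xS.
  exact: H5.
Qed.

(** A remaining clique has at most [t2 + r] vertices in [M0], since otherwise a subclique of that
    order would have lost a vertex, and at most [r] outside, by maximality of [M0]. *)
Lemma del_complete : #|M0| < b -> exists x, [/\ x \in iota 0 N,
  del b len N p M0 (dm M0 x) \subset S
  & forall K, is_clique K -> [disjoint K & del b len N p M0 (dm M0 x)] ->
     #|K| <= t2 + 2 * r].
Proof.
move=> M0b; have [R [RM dR DS Rb HR]] := del_ideal M0 (iota 0 N) (sub0set S).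
have Rlen : #|R| <= len.
  rewrite -(leq_pmul2l t20); apply: leq_trans len_k.
  apply: leq_trans (leq_trans (leq_addr _ _) Rb) _.
  by rewrite leq_mul2l (leq_trans _ Sk) ?orbT // subset_leq_card.
have [x xN xE] := dmP RM Rlen M0b.
exists x; rewrite /del xE HR //; split=> // K cK dK.
rewrite -(cardsID M0 K) mul2n -addnn addnA; apply: leq_add.
- rewrite leqNgt; apply/negP => big.
  have [Q QK sQ] := @subset_card_ex (K :&: M0) p (ltnW big).
  have cQ : is_clique Q by apply: clique_sub cK; apply: subset_trans QK (subsetIl _ _).
  have [||y yN yE] := @dmP M0 Q _ _ M0b.
  + by apply: subset_trans QK (subsetIr _ _).
  + by rewrite sQ.
  move: dK; case/splitPr: yN => l1 l2; rewrite foldl_cat /=.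
  set D1 := foldl _ _ l1; set D2 := foldl _ _ l2 => dK.
  have step_sub D c : D \subset del_step b len p M0 (~: S) D c.
    by rewrite /del_step; case: ifP => // _; apply: subsetUl.
  have sub : del_step b len p M0 (~: S) D1 y \subset D2 by apply: foldl_sub.
  have dQ2 : [disjoint Q & D2].
    by apply: disjointWl dK; apply: subset_trans QK (subsetIl _ _).
  have dQ1 : [disjoint Q & D1].
    by apply: disjointWr dQ2; apply: subset_trans (step_sub D1 y) sub.
  move: sub; rewrite /del_step yE cQ sQ eqxx dQ1 /= subUset setDE setCK => /andP[_ QS].
  have : Q :&: S != set0.
    apply: contraTneq (clique_avoiding cQ) => Q0; rewrite -leqNgt.
    by have := cardsID S Q; rewrite Q0 cards0 add0n sQ => ->; apply: leq_addl.
  case/set0Pn => u uQS; move: dQ2; rewrite disjoints_subset => /subsetP/(_ u).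
  by rewrite (subsetP (subsetIl Q S) u uQS) !inE (subsetP QS) // => /(_ isT).
- rewrite leqNgt; apply/negP => big.
  have [E EK sE] := @subset_card_ex (K :\: M0) r (ltnW big).
  have cE : is_clique E by apply: clique_sub cK; apply: subset_trans EK (subsetDl _ _).
  have := @pack_max G r set0 set0 E; rewrite setU0 set0U => /(_ cE sE).
  rewrite -card_gt0 sE rpos => /(_ isT); rewrite disjoints_subset.
  by rewrite (subset_trans EK) // setDE subsetIr.
Qed.

(** ** The rounds *)

Variable D : {set V}.
Hypothesis DS : D \subset S.
Hypothesis few_cliques : forall M, [disjoint M & D] ->
  #|[set C | [&& is_clique C, 0 < #|C| < r & C \subset M]]| <= kap * #|M|.

(** The potential [r * #|S :&: st.1|] is at most [r * k]. A large packing around a clique that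
    avoids [S] brings at least [t2] new vertices of [S] into the kernel; the increase pays both for
    the clique put into [R] and for the growth of the kernel. A small packing adds less than [thr],
    once per branchable code. *)
Lemma round_ideal M l st : (forall C, C \in st.2 -> ~~ [disjoint C & S]) ->
  let st1 := foldl (round_step r thr D (~: S) M) st l in exists R : {set V},
  [/\ R \subset M /\ [disjoint R & S],
      forall C, C \in st1.2 -> ~~ [disjoint C & S],
      t2 * #|R| + r * #|S :&: st.1| <= r * #|S :&: st1.1|,
      #|st1.1| + r * #|S :&: st.1| <=
        #|st.1| + thr * count (branchable r D M) l + r * #|S :&: st1.1|
    & forall R', R \subset R' -> [disjoint R' & S] ->
        foldl (round_step r thr D R' M) st l = st1].
Proof.
elim: l st => [|c l IH] st HH /=.
  exists set0; rewrite sub0set cards0 !muln0 addn0 -setI_eq0 set0I eqxx.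
  by split.
have stepE R' : round_step r thr D R' M st c = if branchable r D M c then
    if (thr <= #|pack r (D :|: st.1) (dv c)|) && ~~ (dv c \subset R')
    then (st.1, dv c |: st.2)
    else (st.1 :|: pack r (D :|: st.1) (dv c), st.2) else st by [].
rewrite stepE; case: ifP => br; last first.
  have [R [H1 H2 H3 H4 H5]] := IH st HH; exists R; split=> // R' RR' dR'.
  by rewrite stepE br H5.
have [cC CM rC] : [/\ is_clique (dv c), dv c \subset M & #|dv c| <= r].
  by case/and5P: br => _ ? /andP[_ /ltnW ?] ? _.
set X := pack r (D :|: st.1) (dv c); case: ifP => big.
  have [/= C|R [H1 H2 H3 H4 H5]] := IH (st.1, dv c |: st.2).
    rewrite !inE => /orP[/eqP->|/HH //]; rewrite disjoints_subset.
    by case/andP: big.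
  exists R; split=> //; first by
    apply: leq_trans H4 _; rewrite /= leq_add2r leq_add2l leq_mul2l leq_addl orbT.
  move=> R' RR' dR'; rewrite stepE br -/X; move: big => /andP[-> CS] /=.
  (* The clique meets [S], so no guess disjoint from [S] contains it. *)
  rewrite (_ : ~~ (dv c \subset R')) ?H5 //.
  by apply: contra CS => /subset_trans; apply; rewrite -disjoints_subset.
have dX : [disjoint st.1 & X].
  by rewrite disjoint_sym; apply: disjointWr (pack_disjoint _ _ _); apply: subsetUr.
have dSX : [disjoint S :&: st.1 & S :&: X].
  by apply: disjointWl (subsetIr _ _) _; apply: disjointWr (subsetIr _ _) _.
have [//|R [[R1 R2] H2 H3 H4 H5]] := IH (st.1 :|: X, st.2).
move: H3 H4; rewrite /= setIUr !cardsU_disjoint // mulnDr => H3 H4.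
case: (leqP thr #|X|) => large; last first.
  have ar1 x a e d : x + (a + e) <= d -> x + a <= d by clear; lia.
  have ar2 x a e m y u d q : x + (a + e) <= m + y + u + d -> y < q ->
    x + a <= m + (q + u) + d by clear; lia.
  exists R; split=> //; first exact: ar1 H3.
    by rewrite mulnDr muln1; exact: ar2 H4 large.
  by move=> R' RR' dR'; rewrite stepE br -/X leqNgt large H5.
have CnS : dv c \subset ~: S by move: big; rewrite large /= => /negbFE.
have Xb : #|X| <= r * #|S :&: X| by apply: pack_bound; rewrite disjoints_subset.
have t2X : t2 <= #|S :&: X| by rewrite -(leq_pmul2l rpos); apply: leq_trans large Xb.
exists (dv c :|: R); split=> //.
- by rewrite subUset CM R1 -setI_eq0 setIUl setU_eq0 !setI_eq0 R2 disjoints_subset CnS.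
- have h : t2 * #|dv c :|: R| <= r * #|S :&: X| + t2 * #|R|.
    apply: leq_trans (leq_mul (leqnn _) (leq_card_setU _ _)) _; rewrite mulnDr leq_add2r.
    by rewrite [r * _]mulnC; apply: leq_mul.
  have ar x a e d y : x + (a + e) <= d -> y <= e + x -> y + a <= d by clear; lia.
  exact: ar H3 h.
- have ar x a e m y u d q : x + (a + e) <= m + y + u + d -> y <= e ->
    x + a <= m + (q + u) + d by clear; lia.
  by rewrite mulnDr muln1; exact: ar H4 Xb.
- move=> R'; rewrite subUset => /andP[CR' RR'] dR'.
  by rewrite stepE br -/X CR' andbF H5.
Qed.

(** Freshness makes [dv] injective on branchable codes, so they are counted by the small cliques of
    [M :\: D], where the density bound is available. *)
Lemma count_branchable M :
  count (branchable r D M) (iota 0 Nr) <= kap * #|M|.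
Proof.
have step : kap * #|M :\: D| <= kap * #|M|.
  by rewrite leq_mul2l subset_leq_card ?orbT // subsetDl.
apply: leq_trans step; apply: leq_trans (few_cliques _); last first.
  by rewrite disjoints_subset setDE subsetIr.
rewrite -size_filter -(size_map dv).
set f := filter _ _.
have uf : uniq [seq dv c | c <- f].
  rewrite map_inj_in_uniq ?filter_uniq ?iota_uniq // => c c'.
  rewrite !mem_filter => /andP[/and5P[fc _ _ _ _] cN] /andP[/and5P[fc' _ _ _ _] cN'] E.
  case: (ltngtP c c') => // lt.
    by move/hasPn: fc' => /(_ c cN); rewrite lt E eqxx.
  by move/hasPn: fc => /(_ c' cN'); rewrite lt E eqxx.
rewrite -(card_uniqP uf); apply: subset_leq_card; apply/subsetP => C /mapP[c].
rewrite mem_filter => /andP[/and5P[_ cC rC CM dC] _] ->; rewrite inE cC rC /=.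
by rewrite subsetD CM.
Qed.

Lemma round_complete st : (forall C, C \in st.2 -> ~~ [disjoint C & S]) ->
  #|st.1| < b -> exists x, [/\ x \in iota 0 N,
    forall C, C \in (round r thr D (dm st.1 x) st).2 -> ~~ [disjoint C & S]
    & #|(round r thr D (dm st.1 x) st).1| <= #|st.1| * (1 + thr * kap) + r * k].
Proof.
move=> HH Mb; have [R [[RM dR] H2 H3 H4 H5]] := round_ideal st.1 (iota 0 Nr) HH.
set st1 := foldl _ _ _ in H2 H3 H4 H5.
have Sst1 : r * #|S :&: st1.1| <= r * k.
  rewrite leq_mul2l (leq_trans _ Sk) ?orbT //.
  by apply: subset_leq_card; apply: subsetIl.
have Rlen : #|R| <= len.
  rewrite -(leq_pmul2l t20); apply: leq_trans len_k; apply: leq_trans Sst1.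
  exact: leq_trans (leq_addr _ _) H3.
have [x xN xE] := dmP RM Rlen Mb.
exists x; rewrite /round xE (H5 R) //; split=> //.
have := leq_mul (leqnn thr) (count_branchable st.1).
rewrite mulnDr muln1 [thr * (kap * _)]mulnA [thr * kap * #|_|]mulnC => cb.
apply: leq_trans (leq_trans (leq_addr _ _) H4) _.
by apply: leq_add Sst1; rewrite leq_add2l.
Qed.

(** ** Solving the kernel *)

Lemma good_complete H W A : (forall C, C \in H -> ~~ [disjoint C & S]) ->
  S :&: A \subset W -> good r H W A.
Proof.
move=> HH SW; apply/allP => c _; apply/implyP => /and3P[cC CA HC].
have : ~~ [disjoint dv c & S] by case/orP: HC => [/HH //|/eqP]; apply: Shit.
rewrite -!setI_eq0 => /set0Pn[x]; rewrite in_setI => /andP[xC xS].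
by apply/set0Pn; exists x; rewrite in_setI xC (subsetP SW) // inE xS (subsetP CA).
Qed.

Lemma minsol_leq H X Z K y : y \in iota 0 N -> good r H (X :|: dm K y) (Z :|: K) ->
  minsol r k b len N H X Z K <= #|dm K y|.
Proof.
move=> + gd; rewrite /minsol; elim: (iota 0 N) k.+1 => //= y' l IH m.
have mono m' l' : foldl (min_step r b len H X Z K) m' l' <= m'.
  elim: l' m' => //= z l' IH' m'; apply: leq_trans (IH' _) _.
  by rewrite /min_step; case: ifP => // /andP[_ /ltnW].
rewrite inE => /orP[/eqP<-|/IH //]; apply: leq_trans (mono _ _) _.
by rewrite /min_step gd /=; case: ltnP.
Qed.

(** With [S :&: Z] as the guess on [Z], a component [K] needs at most [#|S :&: K|] further
    vertices. *)
Lemma final_complete st : (forall C, C \in st.2 -> ~~ [disjoint C & S]) ->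
  #|st.1| < b ->
  (exists Z : {set V}, [/\ Z \subset st.1 :\: D, #|Z| <= len
     & small_components s ((st.1 :\: D) :\: Z)]) ->
  final r k b len N D st.
Proof.
case: st => M H /= HH Mb [Z [ZM Zl sm]].
have M'b : #|M :\: D| < b by apply: leq_ltn_trans Mb; apply: subset_leq_card; apply: subsetDl.
have [z zN zE] := dmP ZM Zl M'b.
have [||x xN xE] := @dmP (M :\: D) (S :&: Z) _ _ M'b.
- by apply: subset_trans (subsetIr _ _) ZM.
- by apply: leq_trans Zl; apply: subset_leq_card; apply: subsetIr.
apply/hasP; exists z => //; apply/hasP; exists x => //; rewrite zE xE /=.
set Rest := (M :\: D) :\: Z in sm *.
rewrite /final_check -/Rest good_complete //=.
have dDZ : [disjoint D & S :&: (M :\: D)].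
  rewrite disjoint_sym; apply: disjointWl (subsetIr _ _) _.
  by rewrite disjoints_subset setDE subsetIr.
have dZR : [disjoint S :&: Z & S :&: Rest].
  rewrite disjoint_sym disjoints_subset; apply/subsetP => v; rewrite !inE.
  by case/and3P => _ /negbTE->; rewrite andbF.
apply: leq_trans Sk.
apply: (@leq_trans (#|D| + #|S :&: Z| + #|S :&: Rest|)); last first.
  rewrite -addnA -cardsU_disjoint // -setIUr -cardsU_disjoint.
    by apply: subset_leq_card; rewrite subUset DS subsetIl.
  apply: disjointWr dDZ; apply: setIS; rewrite subUset ZM; exact: subsetDl.
rewrite leq_add2l.
have rootR v : is_root Rest v -> v \in Rest by case/andP.
apply: (@leq_trans (\sum_(v | is_root Rest v) #|S :&: component Rest v|)).
  apply: leq_sum => v rv; have vR := rootR v rv.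
  have Ks : #|component Rest v| <= s by rewrite compE // sm.
  have [|||y yN yE] := @dmP (component Rest v) (S :&: component Rest v).
  - exact: subsetIr.
  - by rewrite (leq_trans _ len_s) // (leq_trans _ Ks) // subset_leq_card // subsetIr.
  - apply: leq_ltn_trans M'b; apply: subset_leq_card; rewrite compE //.
    apply/subsetP => u; rewrite inE => /(rest_connect vR); rewrite inE => /andP[] //.
  rewrite -yE; apply: minsol_leq => //.
  by rewrite yE -setIUr; apply: good_complete.
rewrite (eq_bigr (fun v => \sum_(x in S :&: component Rest v) 1)) => [|v _]; last first.
  by rewrite sum1_card.
rewrite (exchange_big_dep (mem (S :&: Rest))) /= => [|v a /rootR vR]; last first.
  rewrite !inE compE // inE => /andP[->] /(rest_connect vR).
  by rewrite !inE.
rewrite -sum1_card; apply: leq_sum => a _; rewrite sum1dep_card.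
(* Two roots whose components share a vertex are both the least vertex of the same component. *)
apply/card_le1P => u; rewrite inE => /andP[ru au] u'; rewrite !inE.
apply/andP/eqP => [[ru' au']|->]; last by move: au; rewrite inE.
have [uR uR'] := (rootR u ru, rootR u' ru').
move: au au'; rewrite !inE !compE // !inE => /andP[_ ua] /andP[_ ua'].
have uu : connect (rest_rel Rest) u' u.
  by apply: connect_trans ua' _; rewrite (sym_connect_sym (@rest_rel_sym _ Rest)).
have uu' : connect (rest_rel Rest) u u'.
  by rewrite (sym_connect_sym (@rest_rel_sym _ Rest)).
apply/val_inj; case: (ltngtP u' u) => // lt.
  by case/andP: ru => _ /forallP/(_ u'); rewrite lt compE // inE uu'.
by case/andP: ru' => _ /forallP/(_ u); rewrite lt compE // inE uu.
Qed.

(** ** The whole search *)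

(** Bound on the order of the kernel after [i] rounds started at order [m], by [round_complete]. *)
Fixpoint mseq (i m : nat) : nat :=
  if i is i'.+1 then mseq i' (m * (1 + thr * kap) + r * k) else m.

Lemma mseq_leq i m m' : m <= m' -> mseq i m <= mseq i m'.
Proof.
by elim: i m m' => //= i IH m m' mm; apply: IH; rewrite leq_add2r leq_mul2r mm orbT.
Qed.

Lemma mseq_geq i m : m <= mseq i m.
Proof.
elim: i m => //= i IH m; apply: leq_trans (IH _); apply: leq_trans (leq_addr _ _).
by rewrite mulnDr muln1 leq_addr.
Qed.

Lemma search_complete i st : (forall C, C \in st.2 -> ~~ [disjoint C & S]) ->
  mseq i #|st.1| < b ->
  (forall M, [disjoint M & D] -> #|M| <= mseq i #|st.1| ->
     exists Z : {set V}, [/\ Z \subset M, #|Z| <= len & small_components s (M :\: Z)]) ->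
  search r k b len N thr i D st.
Proof.
elim: i st => [|i IH] st HH /= mb Hsep.
  apply: final_complete => //; apply: Hsep.
    by rewrite disjoints_subset setDE subsetIr.
  by apply: subset_leq_card; apply: subsetDl.
have stb : #|st.1| < b.
  apply: leq_ltn_trans mb; apply: leq_trans (mseq_geq i _).
  by rewrite mulnDr muln1 -addnA leq_addr.
have [x [xN HH' le]] := round_complete HH stb.
apply/hasP; exists x => //; apply: IH => //.
  exact: leq_ltn_trans (mseq_leq i le) mb.
by move=> M dM Mm; apply: Hsep => //; apply: leq_trans Mm (mseq_leq i le).
Qed.

End Completeness.

(** The strict inequality leaves room in the factor [q] for the additive term [r * k]. *)
Lemma mseq_bound r k t2 kap i m c q : r * k <= c -> m <= c -> 1 + r * t2 * kap < q ->
  mseq r k t2 kap i m <= c * q ^ i.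
Proof.
elim: i m c => [|i IH] m c rc mc qb /=; first by rewrite muln1.
rewrite expnS mulnA; apply: IH => //.
  apply: leq_trans rc (leq_pmulr _ _); exact: leq_ltn_trans qb.
apply: leq_trans (leq_add (leq_mul mc (leqnn _)) rc) _.
by rewrite -mulnSr leq_mul2l qb orbT.
Qed.

Lemma accept_complete (G : sgraph) (r k b len N t2 s kap m : nat) :
  N = b ^ len -> 0 < t2 -> t2 + r <= len -> s <= len -> r * k <= t2 * len ->
  mseq r k t2 kap r (r * k) <= m -> m < b ->
  (forall A : {set 'I_(nverts G)},
     (forall K, is_clique K -> K \subset A -> #|K| <= t2 + 2 * r) ->
     #|[set C : {set 'I_(nverts G)} | [&& is_clique C, 0 < #|C| < r & C \subset A]]|
       <= kap * #|A|) ->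
  (forall A : {set 'I_(nverts G)},
     (forall K, is_clique K -> K \subset A -> #|K| <= t2 + 2 * r) -> #|A| <= m ->
     exists Z : {set 'I_(nverts G)},
       [/\ Z \subset A, #|Z| <= len & small_components s (A :\: Z)]) ->
  Kr_cover r G k -> accept G r k b len N (t2 + r) (r * t2).
Proof.
move=> NE t20 len_p len_s len_k mm mb few sep /existsP[S /andP[Sk /existsPn HS]].
have Shit K : is_clique K -> #|K| = r -> ~~ [disjoint K & S].
  by move=> cK /eqP sK; apply/negP => dK; move: (HS K); rewrite cK sK dK.
have M0k := card_M0 Sk Shit.
have M0b : #|pack r (set0 : {set 'I_(nverts G)}) set0| < b.
  by apply: leq_ltn_trans mb; apply: leq_trans mm; apply: leq_trans M0k (mseq_geq _ _ _ _ _ _).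
have [x [xN DS small]] := del_complete Sk Shit NE t20 len_p len_k M0b.
apply/hasP; exists x => //=.
set D := del _ _ _ _ _ _ in DS small *.
have small' (A : {set 'I_(nverts G)}) : [disjoint A & D] ->
    forall K, is_clique K -> K \subset A -> #|K| <= t2 + 2 * r.
  by move=> dA K cK KA; exact: small K cK (disjointWl KA dA).
have le := mseq_leq r k t2 kap r M0k.
apply: (search_complete (S := S) (kap := kap) (s := s)) => //=.
- by move=> M dM; apply: few; apply: small'.
- by move=> C; rewrite inE.
- exact: leq_ltn_trans (leq_trans le mm) mb.
- by move=> M dM Mm; apply: sep; [apply: small' | apply: leq_trans Mm (leq_trans le mm)].
Qed.

Section Params.
(* Throughout [t] is about [k ^ (1 / q)]; all thresholds are monomials in [t]. *)
Variables r m c1 c3 q a : nat.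

(** [cst1 * t ^ exp1] strictly exceeds the growth factor [1 + r * t ^ 2 * clique_density t] of a
    round; [cst2 * t ^ exp2] is the result of [r] such rounds started at [r.+1 * t ^ q]. In [cst4]
    the summand [c3 * cst2] is for the separator, [r + 1] for all other guesses. *)
Definition cst1 : nat := 2 + r * c1 * (1 + 2 * r) ^ m.
Definition exp1 : nat := 2 * m + 2.
Definition cst2 : nat := r.+1 * cst1 ^ r.
Definition exp2 : nat := q + exp1 * r.
Definition cst4 : nat := c3 * cst2 + r + 1.
Definition kernel_size (t : nat) : nat := cst2 * t ^ exp2.
Definition guess_len (t : nat) : nat := cst4 * t ^ (q - 2).
Definition guess_base (t : nat) : nat := kernel_size t + 1.
Definition clique_density (t : nat) : nat := c1 * (1 + 2 * r) ^ m * t ^ (2 * m).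

Hypothesis q4 : 4 <= q.
Hypothesis qa : 2 * m + a + exp1 * r + 4 <= q.

Lemma cst2_gt0 : 0 < cst2.
Proof. by rewrite /cst2 muln_gt0 expn_gt0. Qed.

Lemma len_lb t x y : 0 < t -> x <= r.+1 -> y <= q - 2 -> x * t ^ y <= guess_len t.
Proof.
move=> t0 xr yq; apply: leq_mul; last by rewrite leq_pexp2l.
by rewrite /cst4 -addnA addn1 (leq_trans xr) // leq_addl.
Qed.

Lemma len_p t : 0 < t -> t ^ 2 + r <= guess_len t.
Proof.
move=> t0; apply: (@leq_trans (r.+1 * t ^ 2)); last by apply: len_lb => //; lia.
by rewrite mulSn leq_add2l leq_pmulr // expn_gt0 t0.
Qed.

Lemma accept_correct (G : sgraph) (k t : nat) : 0 < t -> k < t ^ q ->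
  (forall A : {set 'I_(nverts G)},
     (forall K, is_clique K -> K \subset A -> #|K| <= t ^ 2 + 2 * r) ->
     nb_cliques_lt r (induced A) <= clique_density t * #|A|) ->
  (forall A : {set 'I_(nverts G)},
     (forall K, is_clique K -> K \subset A -> #|K| <= t ^ 2 + 2 * r) ->
     #|A| <= kernel_size t -> (treewidth (induced A)).+1 <= c3 * t ^ (2 * m + a)) ->
  accept G r k (guess_base t) (guess_len t) (guess_base t ^ guess_len t) (t ^ 2 + r) (r * t ^ 2)
    = Kr_cover r G k.
Proof.
move=> t0 kt Hclq Htw; apply/idP/idP; first exact: accept_sound.
have pos x : 0 < t ^ x by rewrite expn_gt0 t0.
apply: (@accept_complete G r k (guess_base t) (guess_len t) _ (t ^ 2) (t ^ (q - 2))
  (clique_density t) (kernel_size t)) => //.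
- exact: len_p.
- by rewrite -[X in X <= _]mul1n; apply: len_lb.
- apply: (@leq_trans (t ^ 2 * (r.+1 * t ^ (q - 2)))).
    rewrite mulnCA -expnD (_ : 2 + (q - 2) = q); last by lia.
    by apply: leq_mul => //; apply: ltnW.
  by rewrite leq_mul2l len_lb ?orbT.
- apply: leq_trans (@mseq_bound r k (t ^ 2) (clique_density t) r (r * k) (r.+1 * t ^ q)
    (cst1 * t ^ exp1) _ _ _) _.
  + by apply: leq_mul => //; apply: ltnW.
  + by apply: leq_mul => //; apply: ltnW.
  + have -> : r * t ^ 2 * clique_density t = r * c1 * (1 + 2 * r) ^ m * t ^ exp1.
      have E x y c w : r * x * (c * w * y) = r * c * w * (y * x) by clear; lia.
      by rewrite /clique_density /exp1 expnD E.
    by rewrite /cst1 mulnDl -addSn leq_add2r leq_pmulr.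
  + rewrite /kernel_size /cst2 /exp2 expnMn expnD expnM; apply/eq_leq.
    by rewrite -!mulnA; congr (_ * _); rewrite mulnCA.
- by rewrite /guess_base addn1.
- by move=> A HA; rewrite nb_cliques_induced; apply: Hclq.
- move=> A HA Am.
  have [Z [ZA Zs sm]] :=
    separator_of_treewidth (t ^ (q - 2)) (leqnn (treewidth (induced A))).
  exists Z; split=> //; rewrite -(leq_pmul2r (pos (q - 2))); apply: leq_trans Zs _.
  apply: leq_trans (leq_mul (Htw A HA Am) Am) _; rewrite /kernel_size /guess_len mulnACA -expnD.
  rewrite -[X in _ <= X]mulnA -[X in _ <= _ * X]expnD.
  apply: leq_mul; first by rewrite /cst4 -addnA leq_addr.
  (* This is where [qa] comes from: [(2 * m + a) + (q + exp1 * r) <= 2 * (q - 2)]. *)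
  by rewrite leq_pexp2l // /exp2; lia.
Qed.

End Params.

(** * The program and its running time *)

Definition powT (j : nat) (x : tm) (base : tm) (q : nat) : tm :=
  iter q (fun acc => App (mulF j) [:: acc; x]) base.

Arguments powT : simpl never.

Lemma powTP mm pl j x base q e : eval mm pl x e <= nth 0 pl j ->
  eval mm pl (powT j x base q) e = eval mm pl base e * eval mm pl x e ^ q.
Proof.
move=> xj; elim: q => [|q IH]; first by rewrite muln1.
rewrite /powT iterS -/(powT j x base q) evApp /= mulFP IH (minn_idPl xj).
by rewrite expnSr mulnA.
Qed.

(** The product is iterated inside an argument, and a call takes the maximum of the depths. So the
    depth is bounded independently of [q], which depends on [alpha] and [mu]. *)
Lemma depth_powT j x base q :
  depth (powT j x base q) <= maxn (depth base) (maxn (depth x) (depth (mulF j))).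
Proof.
elim: q => [|q IH]; first by rewrite leq_maxl.
rewrite /powT iterS -/(powT j x base q) /= maxn0.
by rewrite !geq_max IH /= !leq_max !leqnn !orbT.
Qed.

(** The least positive [t] with [k < t ^ q], found by counting up from 1; [n] increments suffice
    because [k <= n]. *)
Definition rootT (q : nat) : tm :=
  Loop pn (Lit 1) (Ite (Minus (powT pn1 (Var 1) (Lit 1) q) (Par pk))
                       (Var 1) (Plus (Var 1) (Lit 1))).

Lemma rootTP mm n k q : 0 < q -> k <= n -> exists t,
  [/\ eval mm [:: n; k; n.+1] (rootT q) [::] = t, 0 < t <= n.+1, k < t ^ q
    & (t.-1) ^ q <= k \/ t = 1].
Proof.
move=> q0 kn; set pl := [:: n; k; n.+1]; rewrite /rootT evLoop evLit.
have H i : i <= n -> exists t, [/\ iteri i (fun i acc =>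
      eval mm pl (Ite (Minus (powT pn1 (Var 1) (Lit 1) q) (Par pk))
                      (Var 1) (Plus (Var 1) (Lit 1))) [:: i; acc]) 1 = t,
    0 < t <= i.+1, k < t ^ q \/ t = i.+1 & (t.-1) ^ q <= k \/ t = 1].
  elim: i => [|i IH] il; first by exists 1; split=> //; right.
  have [t [Et /andP[t0 ti] Ht Ht']] := IH (ltnW il).
  rewrite iteriS Et evIte evMinus powTP /= ?evVar ?evLit ?evPar /=; last by lia.
  rewrite mul1n subn_eq0 -ltnNge; case: ltnP => kt.
    by exists t; rewrite t0 (leqW ti); split=> //; left.
  exists (t + 1); rewrite evPlus evVar evLit /=.
  case: Ht => [|Et']; first by rewrite ltnNge kt.
  split=> //; first by rewrite Et' addn1 ltnSn.
    by right; rewrite Et' addn1.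
  by left; rewrite addn1.
have [t [Et /andP[t0 tn] Ht Ht']] := H n (leqnn n).
exists t; split=> //; first by rewrite t0.
case: Ht => // ->; apply: (@leq_trans (n.+1)) => //.
by rewrite -[X in X <= _]expn1 leq_pexp2l.
Qed.

Definition defs (r q c2 e2 c4 : nat) : seq tm :=
  [:: Plus (Par pn) (Lit 1);
      rootT q;
      powT pt (Par pt) (Lit c4) (q - 2);
      Plus (powT pt (Par pt) (Lit c2) e2) (Lit 1);
      Loop plen (Lit 1) (App (mulF pb) [:: Var 1; Par pb]);
      Plus (powT pt (Par pt) (Lit 1) 2) (Lit r);
      powT pt (Par pt) (Lit r) 2;
      powT pn1 (Par pn1) (Lit 1) r;
      Plus (Par pn) (Par pNr);
      Lit r;
      Ind (mainF r)].

Definition main_depth (r : nat) : nat :=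
  (depth (Ind (mainF r)) + depth (mulF pn1) + depth (mulF pt) + depth (mulF pb)).+1.

Lemma defs_depth r q c2 e2 c4 :
  all (fun t => depth t <= main_depth r) (defs r q c2 e2 c4).
Proof.
have H j x base e : depth x = 0 -> depth base = 0 ->
    depth (powT j x base e) <= depth (mulF j).
  by move=> x0 b0; have := depth_powT j x base e; rewrite x0 b0 !max0n.
rewrite /defs /rootT /main_depth /all.
move: (depth (mulF pn1)) (H pn1) (depth (mulF pt)) (H pt) => d1 H1 d2 H2.
move: (depth (Ind (mainF r))) => d0.
have := H2 (Par pt) (Lit c4) (q - 2) erefl erefl.
have := H2 (Par pt) (Lit c2) e2 erefl erefl.
have := H2 (Par pt) (Lit 1) 2 erefl erefl.
have := H2 (Par pt) (Lit r) 2 erefl erefl.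
have := H1 (Par pn1) (Lit 1) r erefl erefl.
have := H1 (Var 1) (Lit 1) q erefl erefl.
clear H H1 H2.
move: (powT pn1 (Var 1) (Lit 1) q) (powT pn1 (Par pn1) (Lit 1) r)
  (powT pt (Par pt) (Lit r) 2) (powT pt (Par pt) (Lit 1) 2)
  (powT pt (Par pt) (Lit c2) e2) (powT pt (Par pt) (Lit c4) (q - 2))
  (mulF pb) => x1 x2 x3 x4 x5 x6 x7 /= h1 h2 h3 h4 h5 h6.
do !(apply/andP; split); lia.
Qed.

Lemma defs_extend (G : sgraph) mm k r q c2 e2 c4 :
  (forall u v : 'I_(nverts G), mm (u * nverts G + v) = adj u v :> nat) ->
  0 < q -> k <= nverts G -> exists t,
  let len := c4 * t ^ (q - 2) in let b := c2 * t ^ e2 + 1 in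
  [/\ 0 < t <= (nverts G).+1, k < t ^ q, (t.-1) ^ q <= k \/ t = 1
    & extend mm [:: nverts G; k] (defs r q c2 e2 c4) =
      [:: nverts G; k; (nverts G).+1; t; len; b; b ^ len; t ^ 2 + r; r * t ^ 2;
          (nverts G).+1 ^ r; nverts G + (nverts G).+1 ^ r; r;
          nat_of_bool (accept G r k b len (b ^ len) (t ^ 2 + r) (r * t ^ 2))]].
Proof.
move=> mmE q0 kn; set n := nverts G.
have [t [Et tn kt tk]] := rootTP mm q0 kn.
exists t => len b; split=> //; rewrite /extend /defs.
rewrite [foldl _ _ _]/= evPlus evPar evLit /= addn1 Et.
rewrite !powTP ?evPar //= !evLit -/len.
rewrite !evPlus !powTP ?evPar //= !evLit -/b.
have NE pl' : nth 0 pl' plen = len -> nth 0 pl' pb = b ->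
    eval mm pl' (Loop plen (Lit 1) (App (mulF pb) [:: Var 1; Par pb])) [::] = b ^ len.
  move=> E1 E2; rewrite evLoop evLit E1; elim: len {E1} => //= l ->.
  by rewrite evApp /= mulFP evVar evPar /= E2 minnn expnSr.
rewrite NE // !mul1n trInd.
by rewrite mainFP // /b addn1.
Qed.

Lemma leq_expn2 m n e : m <= n -> m ^ e <= n ^ e.
Proof. by move=> mn; elim: e => // e IH; rewrite !expnS leq_mul. Qed.

Lemma input_adj (G : sgraph) k (u v : 'I_(nverts G)) :
  Defs.mem (input G k) (u * nverts G + v) = adj u v :> nat.
Proof.
rewrite /=; congr nat_of_bool; apply/existsP/idP => [[x /existsP[y /andP[/eqP E xy]]]|uv].
  have n0 : 0 < nverts G by apply: leq_ltn_trans (ltn_ord u).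
  have ux : u = x.
    apply/val_inj => /=; have := congr1 (divn^~ (nverts G)) E.
    by rewrite !divnMDl // !divn_small // !addn0.
  have vy : v = y by apply/val_inj; move: E; rewrite ux => /addnI.
  by rewrite ux vy.
by exists u; apply/existsP; exists v; rewrite eqxx.
Qed.

Lemma Kr_cover_min r G k : Kr_cover r G (minn k (nverts G)) = Kr_cover r G k.
Proof.
apply/existsP/existsP => -[S /andP[Sk HS]]; exists S; rewrite HS andbT.
  by apply: leq_trans Sk _; apply: geq_minl.
by rewrite leq_min Sk -[X in _ <= X]card_ord; apply: max_card.
Qed.

Definition def_size (r q c2 e2 c4 : nat) : nat :=
  sumn [seq csize t | t <- defs r q c2 e2 c4].

Lemma program_run (G : sgraph) k r q c2 e2 c4 :
  3 < q -> 0 < c2 -> r < c4 -> exists t s T,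
  let len := c4 * t ^ (q - 2) in let b := c2 * t ^ e2 + 1 in
  let k' := minn k (nverts G) in
  [/\ 0 < t /\ k' < t ^ q, t.-1 ^ q <= k' \/ t = 1,
      exec (program (defs r q c2 e2 c4)) (input G k) s T,
      (reg s 0 != 0) = accept G r k' b len (b ^ len) (t ^ 2 + r) (r * t ^ 2)
    & T <= def_size r q c2 e2 c4 *
           (b ^ len * (nverts G).+1 ^ r.+1) ^ main_depth r + 5].
Proof.
move=> q3 c20 rc4; set n := nverts G; set k' := minn k n.
have [|//|t [/andP[t0 tn] kt tk ext]] :=
  @defs_extend G (Defs.mem (input G k)) k' r q c2 e2 c4 (@input_adj G k); first by lia.
  exact: geq_minr.
set len := c4 * t ^ (q - 2) in ext *; set b := c2 * t ^ e2 + 1 in ext *.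
set acc := accept _ _ _ _ _ _ _ _ in ext.
have b1 : 1 < b by rewrite /b addn1 ltnS muln_gt0 c20 expn_gt0 t0.
have tq : t ^ 2 <= t ^ (q - 2) by rewrite leq_pexp2l //; clear -q3; lia.
have tp : 0 < t ^ 2 by rewrite expn_gt0 t0.
have le_len x : x <= c4 -> x * t ^ 2 <= len by move=> xc; apply: leq_mul.
have len0 : 0 < len by apply: leq_trans (le_len 1 _); [rewrite mul1n | apply: leq_trans rc4].
have N0 : 0 < b ^ len by rewrite expn_gt0 (ltnW b1).
have lenN : len <= b ^ len by apply: ltnW; apply: ltn_expl.
have bN : b <= b ^ len by rewrite -[X in X <= _]expn1 leq_pexp2l // ltnW.
(* One bound for all parameters: those that describe guesses and thresholds are at most [b ^ len],
   and [n], [k], [t] and the code counts are at most [n.+1 ^ r.+1]. *)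
set V := b ^ len * n.+1 ^ r.+1.
have n0 x : 0 < n.+1 ^ x by rewrite expn_gt0.
have leN x : x <= b ^ len -> x <= V by move=> xN; apply: leq_trans xN (leq_pmulr _ _).
have len_n x : x <= n.+1 ^ r.+1 -> x <= V by move=> xn; apply: leq_trans xn (leq_pmull _ _).
have nr : n.+1 <= n.+1 ^ r.+1 by rewrite -[X in X <= _]expn1 leq_pexp2l.
have V0 : 0 < V by rewrite muln_gt0 N0 n0.
have HV : all (fun x => x <= V) (extend (Defs.mem (input G k)) [:: n; k'] (defs r q c2 e2 c4)).
  rewrite ext /=; apply/and5P; split.
  - by apply: len_n; apply: leq_trans nr.
  - by apply: len_n; apply: leq_trans nr; apply: leqW; apply: geq_minr.
  - exact: len_n.
  - by apply: len_n; apply: leq_trans nr.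
  apply/and5P; split.
  - exact: leN.
  - exact: leN.
  - exact: leN.
  - apply: leN; apply: leq_trans lenN; apply: leq_trans (le_len r.+1 rc4).
    by rewrite mulSn leq_add2l leq_pmulr.
  apply/and5P; split.
  - by apply: leN; apply: leq_trans lenN; apply: le_len; apply: ltnW.
  - by apply: len_n; rewrite leq_pexp2l.
  - apply: len_n; rewrite expnS mulSnr leq_add2r leq_pmulr //.
  - apply: leN; apply: leq_trans lenN; apply: leq_trans (le_len r (ltnW rc4)).
    by rewrite leq_pmulr.
  - by rewrite andbT; apply: leq_trans V0; apply: leq_b1.
have [//|s [T [X R L]]] := @program_correct V (main_depth r) (defs r q c2 e2 c4)
  (input G k) V0 _ HV (defs_depth r q c2 e2 c4).
exists t, s, T; split=> //; rewrite R -/n -/k' ext /=.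
by rewrite eqb0 negbK.
Qed.

(** The crude estimates [c2 <= 2 ^ c2] and [t <= 2 ^ t] make the base [2 ^ O(t)]; this raises the
    exponent of [t] from [q - 2] to [q - 1]. *)
Lemma tape_bound t q c2 e2 c4 : 0 < t -> 0 < c2 -> 1 < q ->
  (c2 * t ^ e2 + 1) ^ (c4 * t ^ (q - 2)) <= 2 ^ ((1 + c2 + e2) * c4 * t ^ (q - 1)).
Proof.
move=> t0 c20 q1; have te : 0 < t ^ e2 by rewrite expn_gt0 t0.
have le : c2 * t ^ e2 + 1 <= 2 ^ ((1 + c2 + e2) * t).
  apply: (@leq_trans (2 ^ (1 + c2 + e2 * t))).
    rewrite !expnD expn1 -mulnA mul2n -addnn; apply: leq_add.
      apply: leq_mul; first by apply: ltnW; apply: ltn_expl.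
      by rewrite mulnC expnM leq_expn2 //; apply: ltnW; apply: ltn_expl.
    by rewrite muln_gt0 !expn_gt0.
  by rewrite leq_pexp2l // mulnDl leq_add2r leq_pmulr.
apply: leq_trans (_ : (2 ^ ((1 + c2 + e2) * t)) ^ (c4 * t ^ (q - 2)) <= _).
  exact: leq_expn2.
rewrite -expnM leq_pexp2l //.
have -> : q - 1 = (q - 2).+1 by clear -q1; lia.
by rewrite expnS mulnACA.
Qed.

(** * Estimates over the reals *)

Local Open Scope ring_scope.

Section Reals.
Variable R : realType.

Lemma nat_upper (x : R) : exists n : nat, x <= n%:R.
Proof.
exists (Num.bound `|x|); apply: le_trans (ler_norm x) (ltW _).
exact: archi_boundP.
Qed.

Lemma nat_upper_tight (x : R) : 0 <= x -> exists n : nat, x <= n%:R /\ n%:R <= x + 1.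
Proof.
move=> x0; have /andP[le gt] := truncn_itv x0.
by exists (Num.truncn x).+1; split; [apply: ltW | rewrite -natr1 lerD2r].
Qed.

(** Beyond [X] the factor [A] is at most [x] to the power [b' - b]; up to [X] the left side is
    bounded by a constant. *)
Lemma powR_absorb (A b b' : R) : 0 <= A -> 0 <= b < b' ->
  exists2 K : R, 0 <= K & forall x, 0 <= x -> A * x `^ b <= x `^ b' + K.
Proof.
move=> A0 /andP[b0 bb']; pose X := A `^ (b' - b)^-1.
have d0 : 0 < b' - b by rewrite subr_gt0.
exists (A * X `^ b); first by rewrite mulr_ge0 ?powR_ge0.
move=> x x0; case: (lerP x X) => [xX|Xx].
  rewrite -[leLHS]add0r; apply: lerD; first exact: powR_ge0.
  by apply: ler_wpM2l => //; apply: ge0_ler_powR => //; rewrite nnegrE ?powR_ge0.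
have xp : 0 < x by apply: le_lt_trans (powR_ge0 _ _) Xx.
have AX : A <= x `^ (b' - b).
  have -> : A = X `^ (b' - b) by rewrite -powRrM mulVf ?gt_eqF // powRr1.
  by apply: ge0_ler_powR; rewrite ?nnegrE ?powR_ge0 ?ltW.
have -> : x `^ b' = x `^ (b' - b) * x `^ b.
  by rewrite -powRD ?subrK // (gt_eqF xp) implybT.
rewrite -[leLHS]addr0; apply: lerD; first by apply: ler_wpM2r => //; apply: powR_ge0.
by rewrite mulr_ge0 ?powR_ge0.
Qed.

(** For [t >= 2] one has [t <= 2 * t.-1], and [t.-1] is at most the [q]-th root of [k]; the added 1
    covers smaller [t]. *)
Lemma root_bound (k t q : nat) : (0 < q)%N -> (t.-1 ^ q <= k)%N \/ t = 1%N ->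
  (t ^ (q - 1))%:R <= (2 ^ (q - 1))%:R * (k%:R `^ (1 - q%:R^-1) + 1) :> R.
Proof.
move=> q0 tk; have q0R : 0 < q%:R :> R by rewrite ltr0n.
have P0 := powR_ge0 (k%:R : R) (1 - q%:R^-1).
have E1 : (1 : R) <= (2 ^ (q - 1))%:R by rewrite ler1n expn_gt0.
case: t tk => [|[|u]] /= tk.
- case: tk => // _; case: q q0 q0R P0 E1 => [//|[|q]] _ _ P0 E1.
    by rewrite expn0 mul1r lerDr.
  by rewrite subn1 /= exp0n // mulr_ge0 ?ler0n ?addr_ge0.
- by rewrite exp1n -[leLHS]mulr1 ler_pM // lerDr.
case: tk => // tk.
apply: (@le_trans _ _ ((2 ^ (q - 1))%:R * (u.+1 ^ (q - 1))%:R)).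
  rewrite -natrM ler_nat -expnMn; apply: leq_expn2; lia.
apply: ler_wpM2l; first exact: ler0n.
apply: (@le_trans _ _ (k%:R `^ (1 - q%:R^-1))); last by rewrite lerDl.
have -> : (u.+1 ^ (q - 1))%:R = ((u.+1 ^ q)%:R : R) `^ (1 - q%:R^-1).
  rewrite natrX -powR_mulrn ?ler0n // natrX -[X in _ = X `^ _]powR_mulrn ?ler0n // -powRrM.
  by rewrite mulrBr mulr1 mulfV ?gt_eqF // natrB.
apply: ge0_ler_powR; rewrite ?nnegrE ?ler0n ?ler_nat //.
by rewrite subr_ge0 invf_le1 // ler1n.
Qed.

End Reals.

Lemma omega_powR (R : realType) (mu : R) (m r t w : nat) :
  0 <= mu <= m%:R -> (0 < t)%N -> (w <= t ^ 2 + 2 * r)%N ->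
  w%:R `^ mu <= ((1 + 2 * r) ^ m * t ^ (2 * m))%:R.
Proof.
move=> /andP[mu0 mum] t0 wt; set W := ((1 + 2 * r) * t ^ 2)%N.
have t20 : (0 < t ^ 2)%N by rewrite expn_gt0 t0.
have wW : (w <= W)%N.
  by apply: leq_trans wt _; rewrite /W mulnDl mul1n leq_add2l leq_pmulr.
have W1 : 1 <= W%:R :> R by rewrite ler1n muln_gt0 t20 addn_gt0.
apply: (@le_trans _ _ (W%:R `^ mu)).
  by apply: ge0_ler_powR; rewrite ?nnegrE ?ler0n ?ler_nat.
apply: le_trans (ler_powR W1 mum) _.
by rewrite powR_mulrn ?ler0n // -natrX ler_nat /W expnMn -expnM.
Qed.

Lemma small_treewidth (R : realType) (alpha mu C2 : R) (GG : sgraph -> Prop)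
  (G : sgraph) (A : {set 'I_(nverts G)}) (r m c2 a t : nat) (kc ke : nat) :
  0 <= alpha <= 1 -> 0 <= mu <= m%:R -> C2 <= c2%:R -> alpha * ke%:R <= a%:R ->
  (0 < t)%N -> (0 < kc)%N ->
  (treewidth (induced A))%:R
    <= C2 * ((clique_number (induced A))%:R `^ mu * #|A|%:R `^ alpha) ->
  (forall K, is_clique K -> K \subset A -> (#|K| <= t ^ 2 + 2 * r)%N) ->
  (#|A| <= kc * t ^ ke)%N ->
  ((treewidth (induced A)).+1 <=
     (c2 * (1 + 2 * r) ^ m * kc + 1) * t ^ (2 * m + a))%N.
Proof.
move=> /andP[al0 al1] mum Cc aa t0 kc0 tw HK Ak.
have w1 := omega_powR mum t0 (clique_number_induced HK).
have kc1 : 1 <= kc%:R :> R by rewrite ler1n.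
have t1 : 1 <= t%:R :> R by rewrite ler1n.
have w2 : #|A|%:R `^ alpha <= (kc * t ^ a)%:R :> R.
  apply: (@le_trans _ _ ((kc * t ^ ke)%:R `^ alpha)).
    by apply: ge0_ler_powR; rewrite ?nnegrE ?ler0n ?ler_nat.
  rewrite !natrM powRM ?ler0n //; apply: ler_pM; rewrite ?powR_ge0 //.
    exact: ler1_powR.
  rewrite !natrX -[X in X `^ alpha]powR_mulrn ?ler0n // -powRrM.
  rewrite -[leRHS]powR_mulrn ?ler0n //; apply: ler_powR => //.
  by rewrite mulrC.
have tw' : (treewidth (induced A) <=
    c2 * ((1 + 2 * r) ^ m * t ^ (2 * m) * (kc * t ^ a)))%N.
  rewrite -(ler_nat R); apply: le_trans tw _; rewrite natrM.
  apply: (@le_trans _ _ (c2%:R * ((clique_number (induced A))%:R `^ mu * #|A|%:R `^ alpha))).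
    by apply: ler_wpM2r => //; rewrite mulr_ge0 ?powR_ge0.
  apply: ler_wpM2l; first exact: ler0n.
  by rewrite natrM; apply: ler_pM; rewrite ?powR_ge0.
have E x y z u : (c2 * (x * y * (z * u)) = c2 * x * z * (y * u))%N by clear; lia.
(* The summand 1 of the constant accounts for bags having one vertex more than the width. *)
rewrite mulnDl mul1n -addn1 expnD; apply: leq_add; first by rewrite -E.
by rewrite muln_gt0 !expn_gt0 t0.
Qed.

Lemma few_small_cliques (R : realType) (mu C1 : R) (G : sgraph)
  (A : {set 'I_(nverts G)}) (r m c1 t : nat) :
  0 <= mu <= m%:R -> C1 <= c1%:R -> (0 < t)%N ->
  (nb_cliques_lt r (induced A))%:R
    <= C1 * ((clique_number (induced A))%:R `^ mu * #|A|%:R) ->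
  (forall K, is_clique K -> K \subset A -> (#|K| <= t ^ 2 + 2 * r)%N) ->
  (nb_cliques_lt r (induced A) <= clique_density r m c1 t * #|A|)%N.
Proof.
move=> mum Cc t0 nb HK; have w1 := omega_powR mum t0 (clique_number_induced HK).
rewrite -(ler_nat R); apply: le_trans nb _.
apply: (@le_trans _ _ (c1%:R * ((clique_number (induced A))%:R `^ mu * #|A|%:R))).
  by apply: ler_wpM2r => //; rewrite mulr_ge0 ?powR_ge0.
rewrite /clique_density -!mulnA natrM; apply: ler_wpM2l; first exact: ler0n.
by rewrite mulnA natrM; apply: ler_wpM2r.
Qed.

(** With [a <= alpha * (q + e * r) + 1] the second condition follows from [2 * m + 2 * (e * r) + 5
    <= q * (1 - alpha)]. *)
Lemma exponent_choice (R : realType) (alpha : R) (m e r : nat) : 0 < alpha < 1 ->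
  exists q a : nat, [/\ (4 <= q)%N, (2 * m + a + e * r + 4 <= q)%N
    & alpha * (q + e * r)%:R <= a%:R].
Proof.
case/andP => al0 al1; have d0 : 0 < 1 - alpha by rewrite subr_gt0.
have [q qP] := nat_upper ((2 * m + 2 * (e * r) + 5)%:R / (1 - alpha)).
have q1 : (2 * m + 2 * (e * r) + 5)%:R <= q%:R * (1 - alpha) by rewrite -ler_pdivrMr.
have al_ge0 : 0 <= alpha * (q + e * r)%:R by rewrite mulr_ge0 ?ler0n // ltW.
have [a [a1 a2]] := nat_upper_tight al_ge0.
exists q, a.
have qa : (2 * m + a + e * r + 4 <= q)%N.
  rewrite -(ler_nat R) !natrD; move: q1 a2; rewrite !natrD.
  have er : alpha * (e * r)%:R <= (e * r)%:R.
    by rewrite -[leRHS]mul1r ler_wpM2r ?ler0n // ltW.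
  by move=> q1 a2; nra.
by split=> //; move: qa; clear; lia.
Qed.

(* The exponent [c] of n^{O_r(1)} is chosen from [r] alone; the multiplicative
   constant [K] may depend on everything but the input.  The base is [n + 1]
   instead of [n] because the class may contain the graph with n = 0. *)
Theorem theorem1p4 (R : realType) (r : nat) :
  exists c : nat,
  forall (alpha mu : R) (GG : sgraph -> Prop),
    0 < alpha < 1 ->
    0 < mu ->
    hereditary GG ->
    (exists C : R, forall G : sgraph, GG G ->
       (nb_cliques_lt r G)%:R
         <= C * ((clique_number G)%:R `^ mu * (nverts G)%:R)) ->
    (exists C : R, forall G : sgraph, GG G ->
       (treewidth G)%:R
         <= C * ((clique_number G)%:R `^ mu * (nverts G)%:R `^ alpha)) ->
    exists (eps : R) (p : prog) (K : R),
      eps < 1 /\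
      solves_Kr_cover_within p r GG
        (fun G k => K * 2 `^ (k%:R `^ eps) * (nverts G).+1%:R ^+ c).
Proof.
set d := main_depth r; exists (r.+1 * d)%N => alpha mu GG al01 mu0 her [C1 H1] [C2 H2].
have [m mum] := nat_upper mu; have [c1 Cc1] := nat_upper C1; have [c2 Cc2] := nat_upper C2.
have mum' : 0 <= mu <= m%:R by rewrite (ltW mu0).
have [q [a [q4 qa aa]]] := exponent_choice m (exp1 m) r al01.
set k2 := cst2 r m c1; set c3 := (c2 * (1 + 2 * r) ^ m * k2 + 1)%N.
set e2 := exp2 r m q; set c4 := cst4 r m c1 c3.
have k20 : (0 < k2)%N by apply: cst2_gt0.
have rc4 : (r < c4)%N by rewrite /c4 /cst4 -addnA addn1 leq_addl.
have q1 : (1 < q)%N by apply: leq_trans q4.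
have q0R : 0 < q%:R :> R by rewrite ltr0n; apply: leq_trans q4.
(* The exponent of 2 is [O(k ^ beta)]; moving halfway from [beta] to 1 absorbs the constant
   factor. *)
pose beta : R := 1 - q%:R^-1; pose eps : R := 1 - (2 * q%:R)^-1.
have qi : 0 < q%:R^-1 :> R by rewrite invr_gt0.
have qi1 : q%:R^-1 <= 1 :> R by rewrite invf_le1 // ler1n ltnW.
have eps_b : 0 <= beta < eps by rewrite /beta /eps invfM; apply/andP; split; lra.
(* The three factors come from the loop depth, from [tape_bound] and from [root_bound]. *)
pose A : nat := (d * ((1 + k2 + e2) * c4) * 2 ^ (q - 1))%N.
have [K0 K00 HK0] := @powR_absorb R A%:R beta eps (ler0n _ _) eps_b.
pose Cs := def_size r q k2 e2 c4.
(* [K0] is the additive loss in absorbing the factor [A], and the summand [A] is the contribution of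
   the added 1 in [root_bound]. *)
exists eps, (program (defs r q k2 e2 c4)), ((Cs + 5)%:R * 2 `^ (K0 + A%:R)).
split; first by rewrite /eps gtrBl invr_gt0 mulr_gt0.
move=> G k GG_G.
have [t [s [T [[t0 kt] tk X Rs LT]]]] := @program_run G k r q k2 e2 c4 q4 k20 rc4.
exists s, T; split=> //.
  rewrite Rs -(Kr_cover_min r G k); apply: (accept_correct (c3 := c3) q4 qa t0 kt) => S HS.
    have GS := her _ _ GG_G (induced_subP S).
    exact: few_small_cliques mum' Cc1 t0 (H1 _ GS) HS.
  move=> Sk; have GS := her _ _ GG_G (induced_subP S).
  have al01' : 0 <= alpha <= 1 by case/andP: al01 => /ltW-> /ltW->.
  exact: small_treewidth al01' mum' Cc2 aa t0 k20 (H2 _ GS) HS Sk.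
set N := (_ ^ (c4 * _))%N in LT.
have Nb : (N ^ d <= 2 ^ (d * ((1 + k2 + e2) * c4) * t ^ (q - 1)))%N.
  apply: leq_trans (leq_expn2 d (tape_bound _ _ t0 k20 q1)) _.
  by rewrite -expnM leq_pexp2l // mulnC mulnA.
have n1 : (0 < (nverts G).+1 ^ (r.+1 * d))%N by rewrite expn_gt0.
have N1 : (0 < N)%N by rewrite expn_gt0 addn1.
have LT' : (T <= (Cs + 5) * (N ^ d * (nverts G).+1 ^ (r.+1 * d)))%N.
  apply: leq_trans LT _; rewrite -/d expnMn -expnM mulnDl leq_add2l.
  by rewrite leq_pmulr // muln_gt0 expn_gt0 N1.
apply: (@le_trans _ _ ((Cs + 5) * (N ^ d * (nverts G).+1 ^ (r.+1 * d)))%:R).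
  by rewrite ler_nat.
rewrite natrM [(N ^ d * _)%:R]natrM [((nverts G).+1 ^ _)%:R]natrX mulrA.
apply: ler_wpM2r; first exact: exprn_ge0.
rewrite -mulrA; apply: ler_wpM2l; first exact: ler0n.
rewrite -powRD; last by rewrite pnatr_eq0 implybT.
apply: (@le_trans _ _ (2 `^ (d * ((1 + k2 + e2) * c4) * t ^ (q - 1))%:R)).
  by rewrite powR_mulrn ?ler0n // -natrX ler_nat.
apply: ler_powR; first by rewrite ler1n.
rewrite natrM; set B := (d * _)%N.
have tk' : (t.-1 ^ q <= k)%N \/ t = 1%N.
  by case: tk => [h|]; [left; apply: leq_trans h (geq_minl _ _) | right].
apply: (@le_trans _ _ (B%:R * ((2 ^ (q - 1))%:R * (k%:R `^ beta + 1)))).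
  by apply: ler_wpM2l; [apply: ler0n | apply: root_bound => //; apply: ltnW].
rewrite mulrA -natrM -/A mulrDr mulr1.
by have := HK0 k%:R (ler0n _ _); lra.
Qed.
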